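(* Let $(\bm{u}(t),p(t))$ be the (sufficiently smooth) solution of the variational Biot problem, and let $(\bm{u}_h^n,p_h^n)$ be the solutions produced by the explicit coupling algorithm for the stabilized P1-P1 discretization (both as described in the context). If $L=\omega\,\frac{\alpha^2}{\lambda+2\mu/d}$ with $\omega\ge1$, then there is a constant $C>0$ independent of $h$, $\tau$ and $n$ such that for $1\le n\le N-1$ $$ \begin{aligned} &\|\bm{u}(t_n)-\bm{u}_h^n\|_A+\|p(t_n)-p_h^n\|_B+\|p(t_n)-p_h^n\|\\ &\le C\left(\|e_{\bm{u}}^0\|_A+\|e_p^0\|_B\right)+Ch\left(|\bm{u}(t_0)|_2+|p(t_0)|_2+|\bm{u}(t_n)|_2+|p(t_n)|_2\right)\\ &\quad+C\tau\left[\left(\int_{t_0}^{t_{n+1}}\|\partial_{tt}p(s)\|^2\,\mathrm{d}s\right)^{1/2}+\left(\int_{t_0}^{t_{n+1}}\|\partial_{tt}\bm{u}(s)\|_1^2\,\mathrm{d}s\right)^{1/2}\right]\\ &\quad+Ch\Bigg[\left(\int_{t_0}^{t_{n+1}}|\partial_tp(s)|_2^2\,\mathrm{d}s\right)^{1/2}+\left(\int_{t_0}^{t_{n+1}}\left(|\partial_t\bm{u}(s)|_2^2+|\partial_tp(s)|_2^2\right)\mathrm{d}s\right)^{1/2}\\ &\qquad\qquad+\left(\tau\sum_{j=0}^{n}|\partial_tp(t_{j+1})|_1^2\right)^{1/2}+\tau\left(\int_{t_0}^{t_{n+1}}|\partial_{tt}p(s)|_1^2\,\mathrm{d}s\right)^{1/2}\Bigg],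 \end{aligned} $$ where $e_{\bm{u}}^0=\bm{u}(t_0)-\bm{u}_h^0$ and $e_p^0=p(t_0)-p_h^0$.
   Context: **Continuous problem.** $\Omega\subset\mathbb{R}^d$, $d\in\{2,3\}$, is a bounded polygonal/polyhedral domain, $T>0$, $\bm{V}=(H_0^1(\Omega))^d$, $Q=H_0^1(\Omega)$; $(\cdot,\cdot)$ and $\|\cdot\|$ are the $L^2(\Omega)$ inner product and norm; $\|\cdot\|_1$ is the $H^1(\Omega)$ norm and $|\cdot|_m$ the $H^m(\Omega)$ seminorm. The physical parameters are constants: Lamé parameters $\lambda,\mu>0$, Biot coefficient $\alpha>0$, Biot modulus $\beta>0$, hydraulic conductivity $K>0$. With $\varepsilon(\bm{u})=\frac12(\nabla\bm{u}+\nabla^T\bm{u})$, define $$a(\bm{u},\bm{v})=2\mu\int_\Omega\varepsilon(\bm{u}):\varepsilon(\bm{v})+\lambda\int_\Omega\operatorname{div}\bm{u}\operatorname{div}\bm{v},\qquad b(p,q)=\int_\Omega K\nabla p\cdot\nabla q,$$ and $\|\bm{v}\|_A=a(\bm{v},\bm{v})^{1/2}$, $\|q\|_B=b(q,q)^{1/2}$. Given sources $\bm{f},g$, the exact solution $(\bm{u},p)\in C^1([0,T];\bm{V})\times C^1([0,T];Q)$ satisfies for $t\in[0,T]$ $$a(\bm{u},\bm{v})-\alpha(p,\operatorname{div}\bm{v})=(\bm{f},\bm{v})\ \ \forall\bm{v}\in\bm{V},\qquad \tfrac1\beta(\partial_tp,q)+\alpha(\operatorname{div}\partial_t\bm{u},q)+b(p,q)=(g,q)\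 \ \forall q\in Q.$$ **P1-P1 spaces.** $\mathcal{T}_h$ is a simplicial partition of $\Omega$ with mesh size $h$; $\bm{V}_h\subset\bm{V}$ and $Q_h\subset Q$ consist of the continuous functions (vector-valued, resp. scalar) that are piecewise linear on $\mathcal{T}_h$ and vanish on $\partial\Omega$. They satisfy the weak inf-sup condition $$\sup_{0\ne\bm{w}_h\in\bm{V}_h}\frac{(\operatorname{div}\bm{w}_h,q_h)}{\|\bm{w}_h\|_A}\ge\frac{\eta}{\sqrt{\lambda+2\mu/d}}\|q_h\|-\frac{\epsilon}{\sqrt{\lambda+2\mu/d}}h\|\nabla q_h\|\quad\forall q_h\in Q_h,$$ with constants $\eta,\epsilon>0$ independent of $h$ and of the physical parameters. **Mass lumping.** $(\cdot,\cdot)_0$ is the mass-lumped approximation of the $L^2$ inner product on $Q_h$: $(p_h,q_h)_0=\sum_{T\in\mathcal{T}_h}\frac{|T|}{d+1}\sum_{x\text{ vertex of }T}p_h(x)q_h(x)$. With $\|q_h\|_Z^2=(q_h,q_h)_0-(q_h,q_h)$ one has the norm equivalence $C_1\|q_h\|_Z^2\le h^2\|\nabla q_h\|^2\le C_2\|q_h\|_Z^2$ for all $q_h\in Q_h$, with $C_1,C_2>0$ independent of $h$. **Time grid and data.** $t_j=j\tau$, $j=0,\dots,N$, $\tau=T/N$. The discrete source data are those of time $t_j$: $(\bm{f}_h^j,\bm{v}_h)=(\bm{f}(t_j),\bm{v}_h)$ for $0\le j\le N$, $(g_h^j,q_h)=(g(t_j),q_h)$ for $1\le j\le N$; $g_h^0$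 is a given discrete initial datum. $(\bm{u}_h^0,p_h^0)\in\bm{V}_h\times Q_h$ is assumed to satisfy $a(\bm{u}_h^0,\bm{v}_h)-\alpha(p_h^0,\operatorname{div}\bm{v}_h)=(\bm{f}_h^0,\bm{v}_h)$ for all $\bm{v}_h\in\bm{V}_h$ and $\alpha(\operatorname{div}\bm{u}_h^0,q_h)=(g_h^0,q_h)$ for all $q_h\in Q_h$. **First step (fully implicit).** $(\bm{u}_h^1,p_h^1)\in\bm{V}_h\times Q_h$ solves, for all $\bm{v}_h\in\bm{V}_h$, $q_h\in Q_h$, $$a(\bm{u}_h^1,\bm{v}_h)-\alpha(p_h^1,\operatorname{div}\bm{v}_h)=(\bm{f}_h^1,\bm{v}_h),$$ $$\tfrac1\beta\Big(\tfrac{p_h^1-p_h^0}{\tau},q_h\Big)+L\Big(\tfrac{p_h^1-p_h^0}{\tau},q_h\Big)_0-L\Big(\tfrac{p_h^1-p_h^0}{\tau},q_h\Big)+\alpha\Big(\operatorname{div}\tfrac{\bm{u}_h^1-\bm{u}_h^0}{\tau},q_h\Big)+b(p_h^1,q_h)=(g_h^1,q_h).$$ **Explicit coupling algorithm for stabilized P1-P1.** For $j=1,\dots,N-1$: first find $p_h^{j+1}\in Q_h$ such that for all $q_h\in Q_h$ $$\tfrac1\beta\Big(\tfrac{p_h^{j+1}-p_h^j}{\tau},q_h\Big)+L\Big(\tfrac{p_h^{j+1}-p_h^j}{\tau},q_h\Big)_0+b(p_h^{j+1},q_h)=-\alpha\Big(\operatorname{div}\tfrac{\bm{u}_h^j-\bm{u}_h^{j-1}}{\tau},q_h\Big)+L\Big(\tfrac{p_h^j-p_h^{j-1}}{\tau},q_h\Big)+(g_h^{j+1},q_h);$$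 then find $\bm{u}_h^{j+1}\in\bm{V}_h$ such that $a(\bm{u}_h^{j+1},\bm{v}_h)=\alpha(p_h^{j+1},\operatorname{div}\bm{v}_h)+(\bm{f}_h^{j+1},\bm{v}_h)$ for all $\bm{v}_h\in\bm{V}_h$. **Approximation assumption.** For each $t$ the elliptic projections $(\bar{\bm{u}}_h(t),\bar p_h(t))\in\bm{V}_h\times Q_h$ are defined by $b(\bar p_h,q_h)=b(p,q_h)$ for all $q_h\in Q_h$ and $a(\bar{\bm{u}}_h,\bm{v}_h)-\alpha(\bar p_h,\operatorname{div}\bm{v}_h)=a(\bm{u},\bm{v}_h)-\alpha(p,\operatorname{div}\bm{v}_h)$ for all $\bm{v}_h\in\bm{V}_h$. With $\rho_{\bm{u}}=\bm{u}-\bar{\bm{u}}_h$ and $\rho_p=p-\bar p_h$ it is assumed that, for all $t$, $$\|\rho_{\bm{u}}\|_A\le ch(|\bm{u}|_2+|p|_2),\quad\|\rho_p\|_B\le ch|p|_2,\quad\|\rho_p\|\le ch^2|p|_2,$$ with $c$ independent of $h$, and the same estimates hold for $\partial_t\rho_{\bm{u}},\partial_t\rho_p$ with $\partial_t\bm{u},\partial_tp$ on the right-hand side. The constant $C$ may depend on the physical parameters, $\Omega$, $T$, $\eta$, $\epsilon$, $C_1$, $C_2$, $\omega$ and $c$. The exact solution is assumed regular enough that all quantities on the right-hand side are defined and finite. *)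

(* Defs.v *)
From HB Require Import structures.
From mathcomp Require Import all_boot all_order all_algebra.
From mathcomp Require Import all_classical all_reals all_analysis.

Set Implicit Arguments.
Unset Strict Implicit.
Unset Printing Implicit Defensive.

Import Order.TTheory GRing.Theory Num.Theory.
Import numFieldNormedType.Exports.

Local Open Scope classical_set_scope.
Local Open Scope ring_scope.

Definition rV_display : measure_display.
Proof. exact: default_measure_display. Qed.

(* Generated by the coordinates, i.e. the Borel sigma-algebra of R^n. *)
Section rV_measurable.
Context (R : realType) (n : nat).

Let coors : 'I_n -> 'rV[R]_n -> R := fun i x => x ord0 i.

Let rV_set0 : g_sigma_preimage coors set0.
Proof. exact: sigma_algebra0. Qed.

Let rV_setC A : g_sigma_preimage coors A -> g_sigma_preimage coors (~` A).
Proof. exact: sigma_algebraC. Qed.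

Let rV_bigcup (F : _^nat) : (forall i, g_sigma_preimage coors (F i)) ->
  g_sigma_preimage coors (\bigcup_i (F i)).
Proof. exact: sigma_algebra_bigcup. Qed.

HB.instance Definition _ := @isMeasurable.Build rV_display
  'rV[R]_n (g_sigma_preimage coors) rV_set0 rV_setC rV_bigcup.

Lemma measurable_coord (i : 'I_n) :
  measurable_fun [set: 'rV[R]_n] (fun x : 'rV[R]_n => x ord0 i).
Proof.
move=> _ Y mY; rewrite setTI; apply: sub_sigma_algebra => /=.
rewrite -bigcup_seq/=; exists i => /=; first by rewrite mem_index_enum.
by exists Y => //; rewrite setTI.
Qed.

Lemma measurable_fun_coordP d (T : measurableType d) (f : T -> 'rV[R]_n) :
  (forall i, measurable_fun [set: T] (fun x => f x ord0 i)) ->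
  measurable_fun [set: T] f.
Proof.
move=> mf _ A mA; rewrite setTI.
suff: g_sigma_preimage coors `<=` [set B | measurable (f @^-1` B)] by exact.
apply: smallest_sub.
  split=> /=.
  - by rewrite preimage_set0.
  - by move=> B mB; rewrite setTD preimage_setC; exact: measurableC.
  - by move=> F mF; rewrite preimage_bigcup; exact: bigcupT_measurable.
move=> B; rewrite -bigcup_seq => -[i _] [C mC <-] /=.
by rewrite setTI -[_ @^-1` _]setTI; exact: mf.
Qed.

End rV_measurable.

Section sigma_finite_copy.
Context d (T : measurableType d) (R : realType) (m : {measure set T -> \bar R}).
Hypothesis sm : sigma_finite setT m.

Definition sigma_finite_copy : set T -> \bar R := let _ := sm in m.

HB.instance Definition _ := Measure.copy sigma_finite_copy m.

HB.instance Definition _ :=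
  Measure_isSigmaFinite.Build _ _ _ sigma_finite_copy sm.

End sigma_finite_copy.

Section lebesgue_rV.
Context (R : realType).

Definition cons_rV n (p : R * 'rV[R]_n) : 'rV[R]_n.+1 :=
  row_mx (const_mx p.1 : 'rV[R]_1) p.2.

(* R^(m+1) is identified with R * R^m by cons_rV. *)
Fixpoint lebesgue_rV n : set 'rV[R]_n -> \bar R :=
  match n with
  | 0 => \d_(0 : 'rV[R]_0)
  | m.+1 => fun A =>
      ((@lebesgue_measure R) \x (@lebesgue_rV m))%E (@cons_rV m @^-1` A)
  end.

Lemma measurable_cons_rV n : measurable_fun setT (@cons_rV n).
Proof.
apply: measurable_fun_coordP => i; rewrite /cons_rV.
have [j ->|j ->] := @split_ordP 1 n i.
  rewrite (_ : (fun x => _) = fst); first exact: measurable_fst.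
  by apply/funext => x; rewrite (@row_mxEl _ 1 1 n) mxE.
rewrite (_ : (fun x => _) = (fun y : 'rV[R]_n => y ord0 j) \o snd).
  by apply: measurableT_comp; [exact: measurable_coord|exact: measurable_snd].
by apply/funext => x; rewrite (@row_mxEr _ 1 1 n).
Qed.

Let lebesgue_rV_bundle n :
  {m : {sigma_finite_measure set 'rV[R]_n -> \bar R} |
    m = @lebesgue_rV n :> (set _ -> _)}.
Proof.
elim: n => [|n [m IH]] /=.
  by exists (\d_(0 : 'rV[R]_0)).
rewrite -IH.
have mp : measurable_fun setT (@cons_rV n) := @measurable_cons_rV n.
have [p pE] : {p : {measure set 'rV[R]_n.+1 -> \bar R} |
    p = pushforward ((@lebesgue_measure R) \x m)%E (@cons_rV n)
      :> (set _ -> _)}.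
  by unshelve refine (exist _
    (pushforward ((@lebesgue_measure R) \x m)%E (@cons_rV n) :
      {measure set 'rV[R]_n.+1 -> \bar R}) _).
pose g (v : 'rV[R]_(1 + n)) : R * 'rV[R]_n := (v ord0 ord0, rsubmx v).
have mg : measurable_fun [set: 'rV[R]_n.+1] g.
  apply/measurable_fun_pair.
    exact: measurable_coord.
  apply: measurable_fun_coordP => i.
  rewrite (_ : (fun x => _) = fun x : 'rV[R]_n.+1 => x ord0 (rshift 1 i)).
    exact: measurable_coord.
  by apply/funext => x; rewrite mxE.
have gK : cancel (@cons_rV n) g.
  move=> [x v]; rewrite /g /cons_rV /= row_mxKr; congr pair.
  have -> : (ord0 : 'I_n.+1) = lshift n (ord0 : 'I_1) by exact/val_inj.
  by rewrite (@row_mxEl _ 1 1 n) mxE.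
have sp : sigma_finite setT p.
  have /sigma_finiteP[F [TF ndF Foo]] := sigma_finiteT (@lebesgue_measure R).
  have /sigma_finiteP[G [TG ndG Goo]] := sigma_finiteT m.
  exists (fun i => g @^-1` (F i `*` G i)).
    rewrite -preimage_bigcup -[LHS](preimage_setT g); congr (_ @^-1` _).
    rewrite -setXTT TF TG predeqE => -[x y]; split.
      move=> [/= [i _ Fix] [k _ Gky]]; exists (maxn i k) => //; split.
      - by move: x Fix; exact/subsetPset/ndF/leq_maxl.
      - by move: y Gky; exact/subsetPset/ndG/leq_maxr.
    by move=> [i _ []/= ? ?]; split; exists i.
  move=> i; have [mF Fi] := Foo i; have [mG Gi] := Goo i; split.
    by rewrite -[_ @^-1` _]setTI; apply: mg => //; exact: measurableX.
  rewrite pE /pushforward -comp_preimage (_ : g \o _ = id); last exact/funext.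
  by rewrite preimage_id product_measure1E// lte_mul_pinfty// ge0_fin_numE.
by exists (sigma_finite_copy sp); rewrite /sigma_finite_copy pE.
Qed.

Let lebesgue_rV0 n : @lebesgue_rV n set0 = 0%E.
Proof. by have [m <-] := lebesgue_rV_bundle n; rewrite measure0. Qed.

Let lebesgue_rV_ge0 n A : (0 <= @lebesgue_rV n A)%E.
Proof. by have [m <-] := lebesgue_rV_bundle n. Qed.

Let lebesgue_rV_semi_sigma_additive n : semi_sigma_additive (@lebesgue_rV n).
Proof.
by have [m <-] := lebesgue_rV_bundle n; exact: measure_semi_sigma_additive.
Qed.

HB.instance Definition _ n := isMeasure.Build _ _ _ (@lebesgue_rV n)
  (lebesgue_rV0 n) (@lebesgue_rV_ge0 n) (@lebesgue_rV_semi_sigma_additive n).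

Let lebesgue_rV_sigma_finite n : sigma_finite setT (@lebesgue_rV n).
Proof. by have [m <-] := lebesgue_rV_bundle n; exact: sigma_finiteT. Qed.

HB.instance Definition _ n := Measure_isSigmaFinite.Build _ _ _
  (@lebesgue_rV n) (@lebesgue_rV_sigma_finite n).

End lebesgue_rV.
Arguments lebesgue_rV {R} n.


Section sobolev.
Context (R : realType) (d : nat) (Omega : set 'rV[R]_d).
Implicit Types (f g phi : 'rV[R]_d -> R) (i j : 'I_d).

(* The integral is the total one, equal to 0 when it is undefined or infinite:
   the forms and norms below are meaningful for square-integrable data only. *)
Definition ip f g : R := \int[lebesgue_rV d]_(x in Omega) (f x * g x).

Definition L2norm f : R := Num.sqrt (ip f f).

Definition L2fun f : Prop :=
  measurable_fun Omega f /\
  (lebesgue_rV d).-integrable Omega (fun x => (f x ^+ 2)%:E).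

Definition partial i phi : 'rV[R]_d -> R := fun x => 'D_(delta_mx 0 i) phi x.

Definition smooth phi : Prop :=
  forall (s : seq 'I_d) x, differentiable (foldr partial phi s) x.

Definition test_function phi : Prop :=
  smooth phi /\
  exists K : set 'rV[R]_d,
    [/\ compact K, K `<=` Omega & forall x, ~ K x -> phi x = 0].

Definition weak_partial i f g : Prop :=
  L2fun g /\ forall phi, test_function phi -> ip f (partial i phi) = - ip g phi.

(* An element of H^1 is a function together with (a representative of) its
   weak gradient, which is determined by the function almost everywhere. The
   regular module R^o only provides the pointwise linear structure. *)
Definition h1fun : Type :=
  (('rV[R]_d -> R^o) * ('I_d -> 'rV[R]_d -> R^o))%type.

Implicit Types v w : h1fun.

(* Closure of the test functions in the H^1 norm. *)
Definition H1_0 v : Prop :=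
  [/\ L2fun v.1, forall i, L2fun (v.2 i) &
    forall e : R, 0 < e -> exists phi,
      [/\ test_function phi, L2norm (fun x => v.1 x - phi x) < e &
        forall i, L2norm (fun x => v.2 i x - partial i phi x) < e]].

Definition H1ip v w : R := ip v.1 w.1 + \sum_i ip (v.2 i) (w.2 i).

Definition H1norm v : R := Num.sqrt (H1ip v v).

Definition H1semi v : R := Num.sqrt (\sum_i L2norm (v.2 i) ^+ 2).

Definition H2 v : Prop := forall i j, exists g, weak_partial j (v.2 i) g.

Definition wderiv j f : 'rV[R]_d -> R := get [set g | weak_partial j f g].

(* One term for each multi-index of order 2. *)
Definition H2semi v : R :=
  Num.sqrt (\sum_(i < d) \sum_(j < d | (i <= j)%N)
    L2norm (wderiv j (v.2 i)) ^+ 2).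

Definition h1vec : Type := 'I_d -> h1fun.

Implicit Types u z : h1vec.

Definition V_space u : Prop := forall i, H1_0 (u i).

Definition H1norm_vec u : R := Num.sqrt (\sum_i H1norm (u i) ^+ 2).

Definition H2semi_vec u : R := Num.sqrt (\sum_i H2semi (u i) ^+ 2).

Definition ip_vec (f : 'I_d -> 'rV[R]_d -> R) u : R := \sum_i ip (f i) (u i).1.

Definition divergence u : 'rV[R]_d -> R := fun x => \sum_i (u i).2 i x.

Definition sym_grad u i j : 'rV[R]_d -> R :=
  fun x => ((u i).2 j x + (u j).2 i x) / 2.

Definition a_form (lambda mu : R) u z : R :=
  2 * mu * \int[lebesgue_rV d]_(x in Omega)
              (\sum_i \sum_j sym_grad u i j x * sym_grad z i j x)
  + lambda * ip (divergence u) (divergence z).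

Definition b_form (K : R) v w : R :=
  \int[lebesgue_rV d]_(x in Omega) (K * \sum_i v.2 i x * w.2 i x).

Definition A_norm (lambda mu : R) u : R := Num.sqrt (a_form lambda mu u u).

Definition B_norm (K : R) v : R := Num.sqrt (b_form K v v).

End sobolev.

Section time.
Context (R : realType).

(* v is in C^1([0, T]; S) with derivative dv, S being normed by nrm (one-sided
   derivatives at the end points). *)
Definition C1_path (X : lmodType R) (S : X -> Prop) (nrm : X -> R) (T : R)
    (v dv : R -> X) : Prop :=
  forall t, t \in `[0, T] ->
    [/\ S (v t), S (dv t),
      nrm ((s - t)^-1 *: (v s - v t) - dv t) @[s --> within `[0, T] t^'] --> 0 &
      nrm (dv s - dv t) @[s --> within `[0, T] (nbhs t)] --> 0].

(* dv is in L^2(0, T; H^1_0) and v(t) = v(0) + int_0^t dv(s) ds, the Bochner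
   integral being expressed weakly. *)
Definition L2_time_derivative d (Omega : set 'rV[R]_d) (T : R)
    (v dv : R -> h1fun R d) : Prop :=
  [/\ forall s, s \in `[0, T] -> H1_0 Omega (dv s),
      lebesgue_measure.-integrable `[0, T]
        (fun s => (L2norm Omega (dv s).1 ^+ 2)%:E),
      lebesgue_measure.-integrable `[0, T]
        (fun s => (H1semi Omega (dv s) ^+ 2)%:E) &
      forall z : h1fun R d,
        L2fun Omega z.1 -> (forall i, L2fun Omega (z.2 i)) ->
        measurable_fun `[0, T] (fun s => H1ip Omega (dv s) z) /\
        forall t, t \in `[0, T] ->
          H1ip Omega (v t - v 0) z =
          \int[lebesgue_measure]_(s in `[0, t]) H1ip Omega (dv s) z].

End time.

Section mesh.
Context (R : realType) (d : nat).
Implicit Types (P : 'I_d.+1 -> 'rV[R]_d).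

Definition face P (I : {set 'I_d.+1}) : set 'rV[R]_d :=
  [set x | exists w : 'I_d.+1 -> R,
    [/\ forall i, 0 <= w i, forall i, i \notin I -> w i = 0,
        \sum_i w i = 1 & x = \sum_i w i *: P i]].

Definition simplex P : set 'rV[R]_d := face P [set: 'I_d.+1]%SET.

Definition nondegenerate P : Prop :=
  row_free (\matrix_(i < d) (P (lift ord0 i) - P ord0)).

Definition polyhedral_domain (Omega : set 'rV[R]_d) : Prop :=
  [/\ Omega !=set0, connected Omega &
    exists (m : nat) (P : 'I_m -> 'I_d.+1 -> 'rV[R]_d),
      (forall k, nondegenerate (P k)) /\
      Omega = (\bigcup_k simplex (P k))°].

Definition eucl_dist (x y : 'rV[R]_d) : R :=
  Num.sqrt (\sum_i (x ord0 i - y ord0 i) ^+ 2).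

Definition diam (A : set 'rV[R]_d) : R :=
  sup [set eucl_dist x y | x in A & y in A].

Record mesh := Mesh {
  ncells : nat;
  vertex : 'I_ncells -> 'I_d.+1 -> 'rV[R]_d }.

Implicit Types M : mesh.

Definition cell M (k : 'I_(ncells M)) : set 'rV[R]_d := simplex (vertex k).

Definition simplicial_partition M (Omega : set 'rV[R]_d) : Prop :=
  [/\ forall k, nondegenerate (@vertex M k),
      closure Omega = \bigcup_k @cell M k,
      forall k l, k != l -> (@cell M k)° `&` (@cell M l)° = set0 &
      forall k l, k != l -> @cell M k `&` @cell M l =
        face (@vertex M k)
          [set i | [exists j, vertex k i == vertex l j]]%SET].

Definition mesh_size M : R := \big[Num.max/0]_k diam (@cell M k).

Definition affine_on (A : set 'rV[R]_d) (f : 'rV[R]_d -> R) : Prop :=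
  exists (a : 'rV[R]_d) (b : R),
    forall x, A x -> f x = \sum_i a ord0 i * x ord0 i + b.

(* The value component is extended by zero outside Omega, so that continuity
   on the whole space includes the vanishing on the boundary. *)
Definition Q_h M (Omega : set 'rV[R]_d) (q : h1fun R d) : Prop :=
  [/\ H1_0 Omega q, continuous (q.1 : 'rV[R]_d -> R),
      forall x, ~ Omega x -> q.1 x = 0 &
      forall k, affine_on (@cell M k) q.1].

Definition V_h M (Omega : set 'rV[R]_d) (v : h1vec R d) : Prop :=
  forall i, Q_h M Omega (v i).

Definition lumped M (p q : h1fun R d) : R :=
  \sum_k fine (lebesgue_rV d (@cell M k)) / d.+1%:R *
    \sum_i p.1 (@vertex M k i) * q.1 (@vertex M k i).

Definition Z_norm_sqr M (Omega : set 'rV[R]_d) (q : h1fun R d) : R :=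
  lumped M q q - ip Omega q.1 q.1.

Definition weak_inf_sup M (Omega : set 'rV[R]_d) (lambda mu eta eps : R) :
    Prop :=
  forall q, Q_h M Omega q ->
    eta / Num.sqrt (lambda + 2 * mu / d%:R) * L2norm Omega q.1
    - eps / Num.sqrt (lambda + 2 * mu / d%:R) * mesh_size M * H1semi Omega q
    <= sup [set ip Omega (divergence w) q.1 / A_norm Omega lambda mu w
           | w in [set w : h1vec R d | V_h M Omega w /\
                                       exists i x, (w i).1 x <> 0]].

Definition Z_norm_equivalence M (Omega : set 'rV[R]_d) (C1 C2 : R) : Prop :=
  forall q, Q_h M Omega q ->
    C1 * Z_norm_sqr M Omega q <= mesh_size M ^+ 2 * H1semi Omega q ^+ 2 /\
    mesh_size M ^+ 2 * H1semi Omega q ^+ 2 <= C2 * Z_norm_sqr M Omega q.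

End mesh.

Section biot.
Context (R : realType) (d : nat) (Omega : set 'rV[R]_d).
Context (lambda mu alpha beta K T : R).

Local Notation a := (a_form Omega lambda mu).
Local Notation b := (b_form Omega K).
Local Notation "<[ f , g ]>" := (ip Omega f g).

Definition biot_solution (f : R -> 'I_d -> 'rV[R]_d -> R)
    (g : R -> 'rV[R]_d -> R) (u du : R -> h1vec R d) (p dp : R -> h1fun R d) :
    Prop :=
  [/\ C1_path (V_space Omega) (H1norm_vec Omega) T u du,
      C1_path (H1_0 Omega) (H1norm Omega) T p dp &
      forall t, t \in `[0, T] ->
        (forall v, V_space Omega v ->
           a (u t) v - alpha * <[(p t).1, divergence v]> =
           ip_vec Omega (f t) v) /\
        (forall q, H1_0 Omega q ->
           beta^-1 * <[(dp t).1, q.1]> + alpha * <[divergence (du t), q.1]>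
           + b (p t) q = <[g t, q.1]>)].

(* Regularity making all the norms of the error bound finite. *)
Definition regular_solution (u du ddu : R -> h1vec R d)
    (p dp ddp : R -> h1fun R d) : Prop :=
  [/\ forall t, t \in `[0, T] ->
        (forall i, H2 Omega (u t i) /\ H2 Omega (du t i)) /\
        H2 Omega (p t) /\ H2 Omega (dp t),
      lebesgue_measure.-integrable `[0, T]
        (fun s => (H2semi_vec Omega (du s) ^+ 2)%:E),
      lebesgue_measure.-integrable `[0, T]
        (fun s => (H2semi Omega (dp s) ^+ 2)%:E),
      forall i,
        L2_time_derivative Omega T (fun s => du s i) (fun s => ddu s i) &
      L2_time_derivative Omega T dp ddp].

Context (M : mesh R d).

Definition elliptic_projection (u ub : h1vec R d) (p pb : h1fun R d) : Prop :=
  [/\ V_h M Omega ub, Q_h M Omega pb,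
      forall q, Q_h M Omega q -> b pb q = b p q &
      forall v, V_h M Omega v ->
        a ub v - alpha * <[pb.1, divergence v]> =
        a u v - alpha * <[p.1, divergence v]>].

Definition projection_bounds (c : R) (u ru : h1vec R d) (p rp : h1fun R d) :
    Prop :=
  let h := mesh_size M in
  [/\ A_norm Omega lambda mu ru <=
        c * h * (H2semi_vec Omega u + H2semi Omega p),
      B_norm Omega K rp <= c * h * H2semi Omega p &
      L2norm Omega rp.1 <= c * h ^+ 2 * H2semi Omega p].

Definition approximation_assumption (c : R) (u du : R -> h1vec R d)
    (p dp : R -> h1fun R d) : Prop :=
  exists (ub dru : R -> h1vec R d) (pb drp : R -> h1fun R d),
    [/\ forall t, t \in `[0, T] ->
          elliptic_projection (u t) (ub t) (p t) (pb t),
        C1_path (V_space Omega) (H1norm_vec Omega) T (fun t => u t - ub t) dru,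
        C1_path (H1_0 Omega) (H1norm Omega) T (fun t => p t - pb t) drp,
        forall t, t \in `[0, T] ->
          projection_bounds c (u t) (u t - ub t) (p t) (p t - pb t) &
        forall t, t \in `[0, T] ->
          projection_bounds c (du t) (dru t) (dp t) (drp t)].

Context (L : R) (N : nat).

Let tau : R := T / N%:R.

Definition time_node (j : nat) : R := j%:R * tau.

Definition dquot (X : lmodType R) (x : nat -> X) (j : nat) : X :=
  tau^-1 *: (x j.+1 - x j).

Definition discrete_data (f : R -> 'I_d -> 'rV[R]_d -> R)
    (g : R -> 'rV[R]_d -> R) (fh : nat -> 'I_d -> 'rV[R]_d -> R)
    (gh : nat -> 'rV[R]_d -> R) : Prop :=
  [/\ forall j i, (j <= N)%N -> L2fun Omega (fh j i),
      forall j, (j <= N)%N -> L2fun Omega (gh j),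
      forall j, (j <= N)%N -> forall v, V_h M Omega v ->
        ip_vec Omega (fh j) v = ip_vec Omega (f (time_node j)) v &
      forall j, (1 <= j <= N)%N -> forall q, Q_h M Omega q ->
        <[gh j, q.1]> = <[g (time_node j), q.1]>].

Definition initial_step (fh : nat -> 'I_d -> 'rV[R]_d -> R)
    (gh : nat -> 'rV[R]_d -> R) (uh : nat -> h1vec R d)
    (ph : nat -> h1fun R d) : Prop :=
  (forall v, V_h M Omega v ->
     a (uh 0%N) v - alpha * <[(ph 0%N).1, divergence v]> =
     ip_vec Omega (fh 0%N) v) /\
  (forall q, Q_h M Omega q ->
     alpha * <[divergence (uh 0%N), q.1]> = <[gh 0%N, q.1]>).

Definition implicit_first_step (fh : nat -> 'I_d -> 'rV[R]_d -> R)
    (gh : nat -> 'rV[R]_d -> R) (uh : nat -> h1vec R d)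
    (ph : nat -> h1fun R d) : Prop :=
  (forall v, V_h M Omega v ->
     a (uh 1%N) v - alpha * <[(ph 1%N).1, divergence v]> =
     ip_vec Omega (fh 1%N) v) /\
  (forall q, Q_h M Omega q ->
     beta^-1 * <[(dquot ph 0%N).1, q.1]>
     + L * lumped M (dquot ph 0%N) q - L * <[(dquot ph 0%N).1, q.1]>
     + alpha * <[divergence (dquot uh 0%N), q.1]> + b (ph 1%N) q =
     <[gh 1%N, q.1]>).

Definition explicit_coupling (fh : nat -> 'I_d -> 'rV[R]_d -> R)
    (gh : nat -> 'rV[R]_d -> R) (uh : nat -> h1vec R d)
    (ph : nat -> h1fun R d) : Prop :=
  forall j, (1 <= j < N)%N ->
    (forall q, Q_h M Omega q ->
       beta^-1 * <[(dquot ph j).1, q.1]> + L * lumped M (dquot ph j) q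
       + b (ph j.+1) q =
       - alpha * <[divergence (dquot uh j.-1), q.1]>
       + L * <[(dquot ph j.-1).1, q.1]> + <[gh j.+1, q.1]>) /\
    (forall v, V_h M Omega v ->
       a (uh j.+1) v =
       alpha * <[(ph j.+1).1, divergence v]> + ip_vec Omega (fh j.+1) v).

Definition discrete_solution (f : R -> 'I_d -> 'rV[R]_d -> R)
    (g : R -> 'rV[R]_d -> R) (uh : nat -> h1vec R d) (ph : nat -> h1fun R d) :
    Prop :=
  exists fh gh,
    [/\ discrete_data f g fh gh,
        forall j, (j <= N)%N -> V_h M Omega (uh j) /\ Q_h M Omega (ph j),
        initial_step fh gh uh ph, implicit_first_step fh gh uh ph &
        explicit_coupling fh gh uh ph].

End biot.

(* Main.v *)
Require Import Defs.
From mathcomp Require Import all_boot all_order all_algebra.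
From mathcomp Require Import all_classical all_reals all_analysis.
From mathcomp Require Import measurable_realfun ring lra.

Set Implicit Arguments.
Unset Strict Implicit.
Unset Printing Implicit Defensive.

Import Order.TTheory GRing.Theory Num.Theory.
Import numFieldNormedType.Exports.

Local Open Scope classical_set_scope.
Local Open Scope ring_scope.

(** Why the bound holds. The elliptic projection (ub, pb) splits each error into
    a projection error, which is small by assumption, and a discrete part
    theta_u = ub - uh, theta_p = pb - ph. The discrete parts satisfy the momentum
    equation without load,
      a(theta_u^j, v) = alpha (theta_p^j, div v),
    at all times ([theta_equilibrium]). Let d^j and w^j be the difference
    quotients of theta_p and theta_u from t_j to t_(j+1), and let Z(p, q) be the
    excess (p, q)_0 - (p, q) of the lumped product. Subtracting the pressure
    equations gives ([pressure_error_equation])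
      (d^j, q) / beta + L Z(d^j, q) + L (d^j - d^(j-1), q)
        + alpha (div w^(j-1), q) + b(theta_p^(j+1), q)
      = (r^j, q) + L Z(D pb^j, q)
    with a residual r^j, where D pb^j is the quotient of the projection, and where
    j - 1 is read as j in the implicit first step j = 0.

    Stability ([energy_step]). Test with q = d^j. The coupling term becomes
    a(w^j, w^(j-1)), which is at least - a(w^j - w^(j-1), w^j - w^(j-1)) / 2. As
    (lambda + 2 mu / d) ||div v||^2 <= a(v, v) ([a_form_coercive_div]) and
    w^j - w^(j-1) is in equilibrium with d^j - d^(j-1), this negative part is at
    most alpha^2 / (lambda + 2 mu / d) times ||d^j - d^(j-1)||^2 / 2. Since L is at
    least that factor, it is compensated by
      L (d^j - d^(j-1), d^j)
      = L (||d^j||^2 - ||d^(j-1)||^2 + ||d^j - d^(j-1)||^2) / 2.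
    What remains, with the first step multiplied by 1 + L beta, telescopes
    ([energy_telescope]) and controls b(theta_p, theta_p) as well as the sum of
    the ||d^j||^2 by the initial value of the former, the residuals and
    Z(D pb^j, D pb^j).

    Consistency ([residual_le], [lumping_error_le]). The residual compares
    difference quotients of the projections over [t_(j-1), t_j] and
    [t_j, t_(j+1)] with the derivatives at t_(j+1). The part due to time is
    bounded by the second derivatives over the window [t_(j-1), t_(j+1)]
    ([difference_quotient_error]), the part due to the projection by the time
    derivative of the projection error ([integral_path_increment]). Finally
    Z(D pb^j, D pb^j) is at most h^2 / C1 times the square of the gradient of
    D pb^j, which the elliptic projection does not increase.

    Closing the argument. The L^2 norm of theta_p at the final time follows from
    the quotients and from theta_p^0, and the latter from theta_u^0 and
    h ||grad theta_p^0|| by the weak inf-sup condition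
    ([inf_sup_pressure_bound]); the energy of theta_u is controlled by the L^2
    norm of theta_p. Superfluous powers of h are absorbed by a bound of the mesh
    size that depends on the domain.

    The forms a, b, Z and the L^2 and H^1 products are handled together as
    semi-inner products. For H^1_0 and the finite element spaces, linearity has
    to be established first: test functions must be square-integrable, so the
    domain has finite measure and continuous functions are measurable. *)

(** * Semi-inner products on linear subsets *)

Section semi_inner_products.
Context {R : realType} {X : lmodType R}.
Implicit Types (S : X -> Prop) (B : X -> X -> R).

Definition lin_closed S : Prop :=
  S 0 /\ forall k u v, S u -> S v -> S (k *: u + v).

(** Every form of the problem is degenerate on pairs of a function and a weak
    gradient, and linear only where the integrals exist; hence a linear
    subset S, and positivity instead of definiteness. *)
Record semi_inner S B : Prop := SemiInner {
  si_closed : lin_closed S;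
  si_lin : forall k u v w, S u -> S v -> S w ->
    B (k *: u + v) w = k * B u w + B v w;
  si_sym : forall u v, S u -> S v -> B u v = B v u;
  si_ge0 : forall u, S u -> 0 <= B u u }.

Lemma lin_closedD S u v : lin_closed S -> S u -> S v -> S (u + v).
Proof. by move=> [_ cS] Su Sv; rewrite -(scale1r u); exact: cS. Qed.

Lemma lin_closedZ S k u : lin_closed S -> S u -> S (k *: u).
Proof. by move=> [S0 cS] Su; rewrite -(addr0 (k *: u)); exact: cS. Qed.

Lemma lin_closedB S u v : lin_closed S -> S u -> S v -> S (u - v).
Proof.
by move=> [_ cS] Su Sv; rewrite addrC -scaleN1r; exact: cS.
Qed.

Lemma lin_closed_sum S (I : Type) (r : seq I) (x : I -> X) : lin_closed S ->
  (forall i, S (x i)) -> S (\sum_(i <- r) x i).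
Proof.
move=> cS Sx; elim/big_ind : _ => //; first exact: cS.1.
by move=> u v Su Sv; exact: lin_closedD.
Qed.

Section theory.
Context {S : X -> Prop} {B : X -> X -> R} (siB : semi_inner S B).
Let cS := si_closed siB.

Lemma si_D u v w : S u -> S v -> S w -> B (u + v) w = B u w + B v w.
Proof.
by move=> Su Sv Sw; rewrite -[u]scale1r (si_lin siB)// mul1r scale1r.
Qed.

Lemma si_0 w : S w -> B 0 w = 0.
Proof.
move=> Sw; have := si_D cS.1 cS.1 Sw; rewrite addr0 => /eqP.
by rewrite -subr_eq0 opprD addNKr oppr_eq0 => /eqP.
Qed.

Lemma si_Z k u w : S u -> S w -> B (k *: u) w = k * B u w.
Proof.
move=> Su Sw; rewrite -[k *: u]addr0 (si_lin siB)// ?si_0 ?addr0//.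
exact: cS.1.
Qed.

Lemma si_B u v w : S u -> S v -> S w -> B (u - v) w = B u w - B v w.
Proof.
move=> Su Sv Sw; rewrite addrC -scaleN1r (si_lin siB)// mulN1r addrC.
by [].
Qed.

Lemma si_Dr u v w : S u -> S v -> S w -> B w (u + v) = B w u + B w v.
Proof.
move=> Su Sv Sw; rewrite (si_sym siB)// ?si_D// 1?(si_sym siB Su)//.
  by rewrite (si_sym siB Sv).
exact: lin_closedD.
Qed.

Lemma si_Br u v w : S u -> S v -> S w -> B w (u - v) = B w u - B w v.
Proof.
move=> Su Sv Sw; rewrite (si_sym siB)// ?si_B// 1?(si_sym siB Su)//.
  by rewrite (si_sym siB Sv).
exact: lin_closedB.
Qed.

Lemma si_Zr k u w : S u -> S w -> B w (k *: u) = k * B w u.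
Proof.
move=> Su Sw; rewrite (si_sym siB)// ?si_Z// 1?(si_sym siB Su)//.
exact: lin_closedZ.
Qed.

Lemma si_sqrB u v : S u -> S v ->
  B (u - v) (u - v) = B u u - 2 * B u v + B v v.
Proof.
move=> Su Sv; have Suv := lin_closedB cS Su Sv.
rewrite si_B// !si_Br// (si_sym siB Sv Su); ring.
Qed.

Lemma si_sqrD u v : S u -> S v ->
  B (u + v) (u + v) = B u u + 2 * B u v + B v v.
Proof.
move=> Su Sv; have Suv := lin_closedD cS Su Sv.
rewrite si_D// !si_Dr// (si_sym siB Sv Su); ring.
Qed.

Lemma si_sqrZ k u : S u -> B (k *: u) (k *: u) = k ^+ 2 * B u u.
Proof.
move=> Su; have Sku := lin_closedZ k cS Su.
rewrite si_Z// si_Zr//; ring.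
Qed.

Lemma si_sqrD_le u v : S u -> S v ->
  B (u + v) (u + v) <= 2 * B u u + 2 * B v v.
Proof.
move=> Su Sv; have := si_ge0 siB (lin_closedB cS Su Sv).
rewrite si_sqrB// si_sqrD//; lra.
Qed.

Lemma si_sqrB_le u v : S u -> S v ->
  B (u - v) (u - v) <= 2 * B u u + 2 * B v v.
Proof.
move=> Su Sv; have := si_ge0 siB (lin_closedD cS Su Sv).
rewrite si_sqrB// si_sqrD//; lra.
Qed.

Lemma si_CauchySchwarz u v : S u -> S v -> B u v ^+ 2 <= B u u * B v v.
Proof.
move=> Su Sv; have Bu := si_ge0 siB Su; have Bv := si_ge0 siB Sv.
have H k l : 0 <= k ^+ 2 * B u u - 2 * k * l * B u v + l ^+ 2 * B v v.
  have := si_ge0 siB (lin_closedB cS (lin_closedZ k cS Su) (lin_closedZ l cS Sv)).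
  rewrite si_sqrB ?si_sqrZ//; [|exact: lin_closedZ..].
  rewrite si_Z// ?si_Zr//; last exact: lin_closedZ.
  by congr (_ <= _); ring.
have [v0|v0] := eqVneq (B v v) 0.
  (* when B v v vanishes, the quadratic form is affine in [l], so its slope
     vanishes *)
  suff -> : B u v = 0 by rewrite v0 mulr0 expr0n.
  apply/eqP/negPn/negP => uv0.
  have := H 1 ((B u u + 1) / (2 * B u v)).
  rewrite v0 mulr0 addr0 expr1n mul1r mulr1.
  have -> : 2 * ((B u u + 1) / (2 * B u v)) * B u v = B u u + 1 by field.
  lra.
have {}v0 : 0 < B v v by rewrite lt_neqAle eq_sym v0.
have := H (B v v) (B u v).
have -> : B v v ^+ 2 * B u u - 2 * B v v * B u v * B u v + B u v ^+ 2 * B v v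
  = B v v * (B u u * B v v - B u v ^+ 2) by ring.
by rewrite pmulr_rge0// subr_ge0.
Qed.

Lemma si_CauchySchwarz_sqrt u v : S u -> S v ->
  `|B u v| <= Num.sqrt (B u u) * Num.sqrt (B v v).
Proof.
move=> Su Sv; rewrite -sqrtrM ?(si_ge0 siB)// -sqrtr_sqr ler_wsqrtr//.
exact: si_CauchySchwarz.
Qed.

Lemma si_triangle u v : S u -> S v ->
  Num.sqrt (B (u + v) (u + v)) <= Num.sqrt (B u u) + Num.sqrt (B v v).
Proof.
move=> Su Sv; rewrite -[leRHS]ger0_norm ?addr_ge0 ?sqrtr_ge0//.
rewrite -sqrtr_sqr ler_wsqrtr// si_sqrD// sqrrD !sqr_sqrtr ?(si_ge0 siB)//.
have := le_trans (ler_norm _) (si_CauchySchwarz_sqrt Su Sv).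
rewrite -mulr_natl; lra.
Qed.

Lemma si_triangleB u v : S u -> S v ->
  Num.sqrt (B (u - v) (u - v)) <= Num.sqrt (B u u) + Num.sqrt (B v v).
Proof.
move=> Su Sv; have Snv : S (- 1 *: v) by exact: lin_closedZ.
have := si_triangle Su Snv; rewrite scaleN1r => /le_trans; apply.
by rewrite -scaleN1r si_sqrZ// sqrrN expr1n mul1r.
Qed.

Lemma si_suml (I : Type) (r : seq I) (x : I -> X) w : (forall i, S (x i)) ->
  S w -> B (\sum_(i <- r) x i) w = \sum_(i <- r) B (x i) w.
Proof.
move=> Sx Sw; elim: r => [|i r IH]; first by rewrite !big_nil si_0.
by rewrite !big_cons si_D ?IH//; exact: lin_closed_sum.
Qed.

(** Up to scaling, the difference of the two sides is the sum of the squares of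
    the deviations of the vectors from their mean. *)
Lemma si_sqr_sum n (x : 'I_n -> X) : (forall i, S (x i)) ->
  B (\sum_i x i) (\sum_i x i) <= n%:R * \sum_i B (x i) (x i).
Proof.
case: n x => [|n] x Sx; first by rewrite !big_ord0 mulr0 si_0//; exact: cS.1.
have Sy : S (\sum_i x i) by exact: lin_closed_sum.
rewrite -subr_ge0 -(pmulr_rge0 _ (ltr0Sn R n)).
set y := \sum_i x i in Sy *.
suff -> : n.+1%:R * (n.+1%:R * \sum_i B (x i) (x i) - B y y) =
    \sum_i B (n.+1%:R *: x i - y) (n.+1%:R *: x i - y).
  apply: sumr_ge0 => i _; apply: (si_ge0 siB).
  exact: (lin_closedB cS (lin_closedZ _ cS (Sx i)) Sy).
rewrite [RHS](eq_bigr (fun i =>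
    n.+1%:R ^+ 2 * B (x i) (x i) - 2 * n.+1%:R * B (x i) y + B y y)).
  rewrite big_split sumrB /= sumr_const card_ord -!mulr_sumr -si_suml//.
  by rewrite -/y -[_ *+ _.+1]mulr_natl; ring.
move=> i _; have Snx := lin_closedZ n.+1%:R cS (Sx i).
by rewrite si_sqrB// si_sqrZ// si_Z// mulrA.
Qed.

End theory.

Lemma semi_inner_scale S B k : 0 <= k -> semi_inner S B ->
  semi_inner S (fun u v => k * B u v).
Proof.
move=> k0 [cS lB sB pB]; split=> //.
- by move=> l u v w *; rewrite lB//; ring.
- by move=> u v *; rewrite sB.
- by move=> u *; rewrite mulr_ge0// pB.
Qed.

Lemma semi_innerD S B B' : semi_inner S B -> semi_inner S B' ->
  semi_inner S (fun u v => B u v + B' u v).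
Proof.
move=> [cS lB sB pB] [_ lB' sB' pB']; split=> //.
- by move=> l u v w *; rewrite lB// lB'//; ring.
- by move=> u v *; rewrite sB// sB'.
- by move=> u *; rewrite addr_ge0 ?pB ?pB'.
Qed.

Lemma semi_inner_sum S n (B : 'I_n -> X -> X -> R) : lin_closed S ->
  (forall i, semi_inner S (B i)) ->
  semi_inner S (fun u v => \sum_i B i u v).
Proof.
move=> cS siB; split=> //.
- move=> l u v w *; rewrite mulr_sumr -big_split/=.
  by apply: eq_bigr => i _; rewrite (si_lin (siB i)).
- by move=> u v *; apply: eq_bigr => i _; rewrite (si_sym (siB i)).
- by move=> u *; apply: sumr_ge0 => i _; rewrite (si_ge0 (siB i)).
Qed.

Lemma semi_inner_eq S B B' : (forall u v, S u -> S v -> B u v = B' u v) ->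
  semi_inner S B -> semi_inner S B'.
Proof.
move=> BB' siB; have cS := si_closed siB; split=> //.
- move=> k u v w Su Sv Sw; rewrite -!BB'// ?(si_lin siB)//.
  exact: cS.2.
- by move=> u v Su Sv; rewrite -!BB'// (si_sym siB).
- by move=> u Su; rewrite -BB'// (si_ge0 siB).
Qed.

End semi_inner_products.

Lemma semi_inner_comp {R : realType} {X Y : lmodType R} (S : X -> Prop)
    (S' : Y -> Prop) (B : Y -> Y -> R) (l : X -> Y) : lin_closed S ->
  (forall k u v, l (k *: u + v) = k *: l u + l v) ->
  (forall u, S u -> S' (l u)) -> semi_inner S' B ->
  semi_inner S (fun u v => B (l u) (l v)).
Proof.
move=> cS lin SS' siB; split=> //.
- by move=> k u v w *; rewrite lin (si_lin siB)//; exact: SS'.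
- by move=> u v *; rewrite (si_sym siB)//; exact: SS'.
- by move=> u *; apply: (si_ge0 siB); exact: SS'.
Qed.

(** Both directions of the triangle inequality are useful for a splitting of
    an error: at the initial time the discrete part th is estimated by the
    error e, at the final time e is estimated by th. *)
Lemma si_split {R : realType} {X : lmodType R} {S : X -> Prop} {B : X -> X -> R}
    (siB : semi_inner S B) (e r th : X) : S r -> S th -> e = r + th ->
  Num.sqrt (B th th) <= Num.sqrt (B e e) + Num.sqrt (B r r) /\
  Num.sqrt (B e e) <= Num.sqrt (B r r) + Num.sqrt (B th th).
Proof.
move=> Sr Sth ->; split; last exact: (si_triangle siB Sr Sth).
have Se := lin_closedD (si_closed siB) Sr Sth.
have := si_triangleB siB Se Sr; rewrite addrAC subrr add0r.
by [].
Qed.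

(** * The inner product of square-integrable functions *)

Section real_integrands.
Context {R : realType} {d} {T : measurableType d}.
Context {mu : {measure set T -> \bar R}} {D : set T} (mD : measurable D).

Lemma integrable_scale k (f : T -> R) : mu.-integrable D (EFin \o f) ->
  mu.-integrable D (EFin \o (fun x => k * f x)).
Proof. by move=> iF; have := integrableZl mD k iF. Qed.

Lemma integrable_add (f g : T -> R) : mu.-integrable D (EFin \o f) ->
  mu.-integrable D (EFin \o g) ->
  mu.-integrable D (EFin \o (fun x => f x + g x)).
Proof. by move=> iF iG; have := integrableD mD iF iG. Qed.

End real_integrands.

Lemma Rintegral_sum {R : realType} {d} {T : measurableType d}
    (mu : {measure set T -> \bar R}) (D : set T) (I : Type) (r : seq I)
    (F : I -> T -> R) : measurable D ->
  (forall i, mu.-integrable D (EFin \o F i)) ->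
  mu.-integrable D (EFin \o (fun x => \sum_(i <- r) F i x)) /\
  \int[mu]_(x in D) (\sum_(i <- r) F i x) =
  \sum_(i <- r) \int[mu]_(x in D) F i x.
Proof.
move=> mD iF; elim: r => [|i r [IH1 IH2]].
  have E x : \sum_(i <- [::]) F i x = 0 by rewrite big_nil.
  split; first by apply: (eq_integrable mD (cst 0%E));
    [move=> x _; rewrite /= E|exact: integrable0].
  rewrite big_nil /Rintegral; under eq_integral do rewrite E.
  by rewrite integral0.
split.
  have := integrableD mD (iF i) IH1; apply: eq_integrable => // x _ /=.
  by rewrite big_cons.
rewrite big_cons -IH2 -RintegralD//.
by apply: eq_Rintegral => x _; rewrite big_cons.
Qed.
Arguments Rintegral_sum {R d T mu D I} r {F}.

Section L2_forms.
Context {R : realType} {d : nat} {Omega : set 'rV[R]_d}.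
Hypothesis mO : measurable Omega.
Local Notation mu := (lebesgue_rV d).
Local Notation fn := ('rV[R]_d -> R^o).
Implicit Types f g : fn.

Lemma L2fun_mul_integrable f g : L2fun Omega f -> L2fun Omega g ->
  mu.-integrable Omega (EFin \o (fun x => f x * g x)).
Proof.
move=> [mf f2] [mg g2].
apply: (@le_integrable _ _ _ _ _ mO _
  (fun x => ((f x ^+ 2)%:E + (g x ^+ 2)%:E)%E)).
- by apply/measurable_EFinP => /=; exact: measurable_funM.
- move=> x _; rewrite /= lee_fin [leRHS]ger0_norm ?addr_ge0 ?sqr_ge0//.
  have := sqr_ge0 (f x - g x); have := sqr_ge0 (f x + g x).
  rewrite normrM -(real_normK (num_real (f x))) -(real_normK (num_real (g x))).
  have := sqr_ge0 (`|f x| - `|g x|); have := normr_ge0 (f x).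
  have := normr_ge0 (g x); nra.
- exact: integrableD.
Qed.

Lemma L2fun_lin_closed : lin_closed (X := fn) (L2fun Omega).
Proof.
split.
  split; first exact: measurable_cst.
  apply: (eq_integrable mO (cst 0%E)); last exact: integrable0.
  by move=> x _; rewrite /= expr0n.
move=> k f g Lf Lg; split.
  apply: measurable_funD; last exact: Lg.1.
  by apply: measurable_funM; [exact: measurable_cst|exact: Lf.1].
have := integrableD mO (integrableD mO
  (integrableZl mO (k ^+ 2) (L2fun_mul_integrable Lf Lf))
  (integrableZl mO (2 * k) (L2fun_mul_integrable Lf Lg)))
  (L2fun_mul_integrable Lg Lg).
apply: eq_integrable => // x _ /=; rewrite -!EFinM -!EFinD; congr EFin.
by change (k ^+ 2 * (f x * f x) + 2 * k * (f x * g x) + g x * g x =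
  (k * (f x : R) + g x : R) ^+ 2); ring.
Qed.

Lemma semi_inner_ip : semi_inner (X := fn) (L2fun Omega) (ip Omega).
Proof.
split.
- exact: L2fun_lin_closed.
- move=> k u v w Lu Lv Lw; rewrite /ip.
  have := RintegralZl k mO (L2fun_mul_integrable Lu Lw) => /= <-.
  rewrite -RintegralD//; last 2 first.
    by have := integrableZl mO k (L2fun_mul_integrable Lu Lw).
    exact: L2fun_mul_integrable.
  apply: eq_Rintegral => x _; by change ((k * (u x : R) + v x) * w x = k * (u x * w x) + v x * w x); ring.
- by move=> u v *; apply: eq_Rintegral => x _; rewrite mulrC.
- by move=> u _; apply: Rintegral_ge0 => x _; rewrite -expr2 sqr_ge0.
Qed.

End L2_forms.

(** * Borel sets of row vectors, bounded domains and the mesh size *)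

Section borel_rV.
Context {R : realType} {d : nat}.
Implicit Types (A : set 'rV[R]_d) (x : 'rV[R]_d).

Lemma ball_rVP x (e : R) y : 0 < e ->
  ball x e y <-> forall i, `|x ord0 i - y ord0 i| < e.
Proof.
move=> e0; split=> [[_ xey] i|xey]; first exact: (xey ord0 i).
by split=> // i j; rewrite ord1; exact: xey.
Qed.

Lemma measurable_ball_rV x (e : R) : measurable (ball x e : set 'rV[R]_d).
Proof.
have [e0|e0] := ltP 0 e; last first.
  rewrite (_ : ball x e = set0)//; apply/seteqP; split=> // y [e0' _].
  by have := lt_le_trans e0' e0; rewrite ltxx.
rewrite (_ : ball x e = \bigcap_(i : 'I_d)
    (fun y : 'rV[R]_d => y ord0 i) @^-1` ball (x ord0 i) e); last first.
  apply/seteqP; split=> y /=.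
    by move=> /(ball_rVP _ _ e0) xey i _; exact: xey.
  by move=> xey; apply/ball_rVP => // i; exact: (xey i).
apply: fin_bigcap_measurable => // i _; rewrite -[_ @^-1` _]setTI.
exact: (@measurable_coord R d i) (measurable_ball _ _).
Qed.

(** The measurable sets are generated by the coordinates only, which makes balls
    of the maximum norm measurable; an open set is a countable union of balls
    with rational data. *)
Lemma open_measurable_rV A : open A -> measurable A.
Proof.
move=> oA.
(* F k is the ball of rational centre and radius 1 / (n + 1) coded by k, or
   set0 when that ball leaves A *)
pose c (q : 'rV[rat]_d * nat) : 'rV[R]_d := map_mx ratr q.1.
pose F k : set 'rV[R]_d := if @unpickle ('rV[rat]_d * nat)%type k is Some q then
  if `[< ball (c q) q.2.+1%:R^-1 `<=` A >] then ball (c q) q.2.+1%:R^-1 else set0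
  else set0.
have mF k : measurable (F k).
  rewrite /F; case: unpickle => // q; case: ifP => // _.
  exact: measurable_ball_rV.
suff -> : A = \bigcup_k F k by exact: bigcupT_measurable.
apply/seteqP; split=> [x Ax|x [k _]]; last first.
  by rewrite /F; case: unpickle => [q|[]]; case: asboolP => [sub /sub//|_ []].
have [e /= e0 xeA] : exists2 e : R, 0 < e & ball x e `<=` A.
  by have /nbhs_ballP[e e0 xeA] := open_nbhs_nbhs (conj oA Ax); exists e.
have [n ne] : exists n : nat, n.+1%:R^-1 < e / 2.
  have e20 : 0 < e / 2 by rewrite divr_gt0.
  exists (Num.truncn (e / 2)^-1); rewrite invf_plt ?posrE//.
  by rewrite truncnS_gt.
have n0 : 0 < n.+1%:R^-1 :> R by rewrite invr_gt0.
have [q xq] : exists q : 'rV[rat]_d,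
    forall i, `|x ord0 i - ratr (q ord0 i)| < n.+1%:R^-1 :> R.
  have H (e' : R) i : 0 < e' -> exists r : rat, `|x ord0 i - ratr r| < e'.
    move=> e'0; have : x ord0 i - e' < x ord0 i + e' by lra.
    move=> /rat_in_itvoo[r]; rewrite in_itv/= => /andP[r1 r2]; exists r.
    by rewrite ltr_norml; lra.
  have [f fP] := choice (fun i => H _ i n0); exists (\row_i f i) => i; rewrite mxE; exact: fP.
have cxq : ball (c (q, n)) n.+1%:R^-1 x.
  by apply/ball_rVP => // i; rewrite mxE distrC; exact: xq.
exists (pickle (q, n)) => //; rewrite /F pickleK; case: asboolP => // -[].
move=> y /= cyq; apply: xeA.
apply: (@le_ball _ _ _ (n.+1%:R^-1 + n.+1%:R^-1)).
  by rewrite [e]splitr ltW// ltrD.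
by apply: ball_triangle cyq; exact: ball_sym.
Qed.

Lemma continuous_measurable_rV (f : 'rV[R]_d -> R) :
  continuous f -> measurable_fun setT f.
Proof.
move=> cf; apply: (measurability _ (RGenOInfty.measurableE R)).
move=> /= _ [_ [a ->]] <-; apply: measurableI => //.
apply: open_measurable_rV; move/continuousP : cf; apply.
by rewrite set_itvE; exact: open_gt.
Qed.

End borel_rV.
Section bounded_domains.
Context {R : realType}.

Definition cube d (b : R) : set 'rV[R]_d :=
  [set x | forall i, `|x ord0 i| <= b].

Lemma measurable_cube d b : measurable (@cube d b).
Proof.
rewrite (_ : cube b = \bigcap_(i : 'I_d)
    (fun y : 'rV[R]_d => y ord0 i) @^-1` `[- b, b]).
  apply: fin_bigcap_measurable => // i _; rewrite -[_ @^-1` _]setTI.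
  exact: (@measurable_coord R d i).
apply/seteqP; split=> x /= xb i; first by move=> _; rewrite /= in_itv/= -ler_norml.
by have := xb i I; rewrite /= in_itv/= -ler_norml.
Qed.

(** Lebesgue measure is built as an iterated product, and a cube is the product
    of a segment and a cube of lower dimension. *)
Lemma lebesgue_cube_lty d b : (lebesgue_rV d (@cube d b) < +oo)%E.
Proof.
elim: d => [|d IH].
  rewrite (_ : lebesgue_rV 0 _ = \d_(0 : 'rV[R]_0) (@cube 0 b))//.
  by rewrite diracE ltry.
have -> : lebesgue_rV d.+1 (@cube d.+1 b) =
    ((@lebesgue_measure R) \x (@lebesgue_rV R d))%E
      (`[- b, b]%classic `*` @cube d b).
  rewrite /=; congr (_ _); apply/seteqP; split=> -[x v] /=.
    move=> H; split.
      have := H (@lshift 1 d ord0).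
      by rewrite /cons_rV (@row_mxEl _ 1 1 d) mxE /= in_itv/= -ler_norml.
    by move=> i; have := H (@rshift 1 d i); rewrite /cons_rV (@row_mxEr _ 1 1 d).
  move=> [+ H]; rewrite in_itv/= -ler_norml => xb i; rewrite /cons_rV.
  have [j ->|j ->] := @split_ordP 1 d i; first by rewrite (@row_mxEl _ 1 1 d) mxE.
  by rewrite (@row_mxEr _ 1 1 d).
rewrite product_measure1E//; last exact: measurable_cube.
apply: lte_mul_pinfty => //.
have : lebesgue_measure (`[(- b)%R, b]%classic : set R) \is a fin_num.
  by rewrite lebesgue_measure_itv/=; case: ifP; rewrite // -EFinD.
exact.
Qed.

Lemma face_coord_le d (P : 'I_d.+1 -> 'rV[R]_d) I x j : face P I x ->
  `|x ord0 j| <= \sum_i `|P i ord0 j|.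
Proof.
move=> [w [w0 _ w1 ->]]; rewrite summxE (le_trans (ler_norm_sum _ _ _))//.
apply: ler_sum => i _; rewrite mxE normrM ger0_norm// ler_piMl//.
by rewrite -w1 (bigD1 i)//= lerDl sumr_ge0.
Qed.

Lemma polyhedral_bounded d (Omega : set 'rV[R]_d) : polyhedral_domain Omega ->
  exists2 b, 0 <= b & Omega `<=` @cube d b.
Proof.
move=> [_ _ [m [P [_ ->]]]]; exists (\sum_k \sum_i \sum_j `|P k i ord0 j|).
  by do 3!apply: sumr_ge0 => ? _.
move=> x /interior_subset[k _ /face_coord_le xP] j.
apply: (le_trans (xP j)); rewrite [leRHS](bigD1 k)//=.
rewrite -[leLHS]addr0 lerD//; last by do 3!apply: sumr_ge0 => ? _.
apply: ler_sum => i _; rewrite (bigD1 j)//= lerDl.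
by apply: sumr_ge0.
Qed.

Lemma polyhedral_measurable d (Omega : set 'rV[R]_d) :
  polyhedral_domain Omega -> measurable Omega.
Proof.
move=> [_ _ [m [P [_ ->]]]]; apply: open_measurable_rV; exact: open_interior.
Qed.

Lemma closure_cube d (Omega : set 'rV[R]_d) b : Omega `<=` @cube d b ->
  closure Omega `<=` @cube d (b + 1).
Proof.
move=> sub x clx i; have [y [/sub yb /(ball_rVP _ _ ltr01) xy]] :=
  clx _ (nbhsx_ballx x 1 ltr01).
rewrite -(subrK (y ord0 i) (x ord0 i)) addrC.
by rewrite (le_trans (ler_normD _ _))// lerD ?yb// ltW.
Qed.

Lemma mesh_size_ge0 d (M : mesh R d) : 0 <= mesh_size M.
Proof.
by rewrite /mesh_size; elim/big_rec : _ => // i x _ x0; rewrite le_max x0 orbT.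
Qed.

(** The cells of a partition lie in the closure of the domain. A bound of the
    mesh size that depends on the domain alone is what allows superfluous
    powers of h to be absorbed in the constant. *)
Lemma mesh_size_le d (M : mesh R d) (Omega : set 'rV[R]_d) b : 0 <= b ->
  Omega `<=` @cube d b -> simplicial_partition M Omega ->
  mesh_size M <= Num.sqrt (d%:R * (2 * (b + 1)) ^+ 2).
Proof.
move=> b0 sub [_ clE _ _]; rewrite /mesh_size.
elim/big_ind : _ => [|x y xb yb|k _]; first exact: sqrtr_ge0.
  by rewrite ge_max xb yb.
have cub x : cell k x -> cube (b + 1) x.
  by move=> kx; apply: (closure_cube sub); rewrite clE; exists k.
rewrite /diam; set D := (X in sup X).
have [->|/set0P D0] := eqVneq D set0; first by rewrite sup0 sqrtr_ge0.
apply: ge_sup => // _ [x /cub xb [y /cub yb <-]].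
apply: ler_wsqrtr; rewrite mulr_natl -[in leRHS](card_ord d) -sumr_const.
apply: ler_sum => i _; rewrite -real_normK ?num_real// lerXn2r ?nnegrE//.
  by rewrite mulr_ge0// addr_ge0.
rewrite (le_trans (ler_normB _ _))// mulr_natl mulr2n lerD//.
Qed.

End bounded_domains.

(** * Test functions *)

Section test_functions.
Context {R : realType} {d : nat} {Omega : set 'rV[R]_d}.
Local Notation fn := ('rV[R]_d -> R^o).
Implicit Types (phi psi : fn).

Lemma partialD (i : 'I_d) k phi psi : (forall x, differentiable phi x) ->
  (forall x, differentiable psi x) ->
  partial i (k *: phi + psi) = k *: partial i phi + partial i psi :> fn.
Proof.
move=> dphi dpsi; apply/funext => x; rewrite /partial deriveD.
- by rewrite deriveZ//; exact: diff_derivable.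
- by apply: diff_derivable; exact: differentiableZ.
- exact: diff_derivable.
Qed.

Lemma foldr_partialD (s : seq 'I_d) k phi psi : smooth phi -> smooth psi ->
  foldr (@partial R d) (k *: phi + psi) s =
  k *: foldr (@partial R d) phi s + foldr (@partial R d) psi s :> fn.
Proof.
move=> sphi spsi; elim: s => //= i s ->.
by rewrite partialD.
Qed.

Lemma smoothD k phi psi : smooth phi -> smooth psi ->
  smooth (k *: phi + psi : fn).
Proof.
move=> sphi spsi s x; rewrite foldr_partialD//.
by apply: differentiableD; [apply: differentiableZ; exact: sphi|exact: spsi].
Qed.

Lemma smooth_cst0 : smooth (0 : fn).
Proof.
move=> s x; rewrite (_ : foldr _ _ _ = 0 :> fn); first exact: differentiable_cst.
elim: s => //= i s ->; apply/funext => y; rewrite /partial; exact: derive_cst.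
Qed.

(** H^1_0 is the closure of the test functions, so that its linearity rests on
    theirs. *)
Lemma test_function_lin_closed : lin_closed (X := fn) (test_function Omega).
Proof.
split.
  split; first exact: smooth_cst0.
  by exists set0; split => //; exact: compact0.
move=> k phi psi [sphi [K [cK KO K0]]] [spsi [K' [cK' KO' K0']]]; split.
  exact: smoothD.
exists (K `|` K'); split.
- exact: compactU.
- by move=> x [/KO|/KO'].
- move=> x /not_orP[Kx K'x].
  change (k * (phi x : R) + psi x = 0).
  by rewrite K0// K0'// mulr0 addr0.
Qed.

Lemma test_function_partial i phi : test_function Omega phi ->
  test_function Omega (partial i phi).
Proof.
move=> [sphi [K [cK KO K0]]]; split.
  by move=> s x; have := sphi (rcons s i) x; rewrite foldr_rcons.
exists K; split => // x Kx; rewrite /partial.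
rewrite (@near_eq_derive _ _ _ _ (cst 0)) ?derive_cst//.
have oK : open (~` K).
  by apply: closed_openC; apply: compact_closed cK; exact: norm_hausdorff.
by apply: filterS (open_nbhs_nbhs (conj oK Kx)) => y; exact: K0.
Qed.

Hypothesis mO : measurable Omega.
Context {b : R}.
Hypothesis Ob : Omega `<=` @cube R d b.

(** A test function is continuous with compact support, hence bounded, and the
    domain has finite measure. *)
Lemma test_function_L2 phi : test_function Omega phi -> L2fun Omega phi.
Proof.
move=> [sphi [K [cK KO K0]]].
have cphi : continuous phi.
  by move=> x; apply: differentiable_continuous; exact: (sphi [::] x).
have mphi : measurable_fun Omega phi.
  apply: (@measurable_funS _ _ _ _ setT) => //.
  exact: (@continuous_measurable_rV R d).
split=> //.
have [M M0 phiM] : exists2 M : R, 0 <= M & forall x, `|phi x| <= M.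
  have : compact (phi @` K).
    by apply: continuous_compact => //; exact: continuous_subspaceT.
  move=> /compact_bounded[M [_ phiM]]; exists (Num.max 0 (M + 1)).
    by rewrite le_max lexx.
  move=> x; have [Kx|Kx] := pselect (K x).
    rewrite le_max; apply/orP; right.
    by apply: (phiM (M + 1)); [rewrite ltrDl|exists x].
  by rewrite K0// normr0 le_max lexx.
have Ofin : (lebesgue_rV d Omega < +oo)%E.
  apply: le_lt_trans (@lebesgue_cube_lty R d b).
  by apply: le_measure => //; rewrite inE//; exact: measurable_cube.
apply: (measurable_bounded_integrable mO Ofin).
  exact: measurable_funX.
exists (M ^+ 2); split; first exact: num_real.
move=> r /ltW Mr x _ /=; apply: le_trans Mr.
by rewrite normrX lerXn2r ?nnegrE.
Qed.

End test_functions.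

(** * The bilinear forms of the Biot system *)

Section energy_forms.
Context {R : realType} {d : nat}.
Local Notation fn := ('rV[R]_d -> R^o).
Local Notation h1 := (h1fun R d).
Local Notation h1v := (h1vec R d).
Implicit Types (v w : h1) (u z : h1v).

Section defs.
Variable Omega : set 'rV[R]_d.

(** Domain on which all the forms below are semi-inner products; it contains
    H^1_0, the discrete spaces and the differences of their elements. *)
Definition L2h v : Prop := L2fun Omega v.1 /\ forall i, L2fun Omega (v.2 i).

Definition L2v u : Prop := forall i, L2h (u i).

Definition val_form v w : R := ip Omega v.1 w.1.

Definition grad_form v w : R := \sum_i ip Omega (v.2 i) (w.2 i).

Definition H1ip_vec u z : R := \sum_i H1ip Omega (u i) (z i).

Definition div_form u z : R := ip Omega (divergence u) (divergence z).

End defs.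

Context {Omega : set 'rV[R]_d}.
Hypothesis mO : measurable Omega.
Let siL2 := semi_inner_ip mO.

Lemma h1fun_valE k v w : (k *: v + w).1 = k *: v.1 + w.1.
Proof. by []. Qed.

Lemma h1fun_gradE k v w i : (k *: v + w).2 i = k *: v.2 i + w.2 i.
Proof. by []. Qed.

Lemma h1vecE k u z i : (k *: u + z) i = k *: u i + z i.
Proof. by []. Qed.

Lemma fnE k (f g : fn) x : (k *: f + g) x = k * f x + g x :> R.
Proof. by []. Qed.

Lemma L2h_lin_closed : lin_closed (L2h Omega).
Proof.
have [L0 cL] := L2fun_lin_closed mO; split; first by split.
move=> k v w [v1 v2] [w1 w2]; split=> [|i].
  by rewrite h1fun_valE; exact: cL.
by rewrite h1fun_gradE; apply: cL; [exact: v2|exact: w2].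
Qed.

Lemma L2v_lin_closed : lin_closed (L2v Omega).
Proof.
have [L0 cL] := L2h_lin_closed; split=> // k u z Lu Lz i.
by rewrite h1vecE; exact: cL.
Qed.

Lemma semi_inner_val : semi_inner (L2h Omega) (val_form Omega).
Proof.
apply: (semi_inner_comp (l := fun v : h1 => v.1)) siL2 => //; last by move=> v [].
exact: L2h_lin_closed.
Qed.

Lemma semi_inner_grad : semi_inner (L2h Omega) (grad_form Omega).
Proof.
apply: semi_inner_sum => [|i]; first exact: L2h_lin_closed.
apply: (semi_inner_comp (l := fun v : h1 => v.2 i)) siL2 => //.
  exact: L2h_lin_closed.
by move=> v [].
Qed.

Lemma semi_inner_H1 : semi_inner (L2h Omega) (H1ip Omega).
Proof. exact: semi_innerD semi_inner_val semi_inner_grad. Qed.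

Lemma semi_inner_H1_vec : semi_inner (L2v Omega) (H1ip_vec Omega).
Proof.
apply: semi_inner_sum => [|i]; first exact: L2v_lin_closed.
apply: (semi_inner_comp (l := fun u : h1v => u i)) semi_inner_H1 => //.
exact: L2v_lin_closed.
Qed.

Lemma L2norm_sqr (f : fn) : L2fun Omega f -> L2norm Omega f ^+ 2 = ip Omega f f.
Proof. by move=> Lf; rewrite sqr_sqrtr// (si_ge0 siL2). Qed.

Lemma H1semi_sqr v : L2h Omega v -> H1semi Omega v ^+ 2 = grad_form Omega v v.
Proof.
move=> Lv; rewrite sqr_sqrtr; last by apply: sumr_ge0 => i _; exact: sqr_ge0.
by apply: eq_bigr => i _; rewrite L2norm_sqr//; exact: Lv.2.
Qed.

Lemma H1norm_sqr v : L2h Omega v -> H1norm Omega v ^+ 2 = H1ip Omega v v.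
Proof. by move=> Lv; rewrite sqr_sqrtr// (si_ge0 semi_inner_H1). Qed.

Lemma H1norm_vec_sqr u : L2v Omega u ->
  H1norm_vec Omega u ^+ 2 = H1ip_vec Omega u u.
Proof.
move=> Lu; rewrite sqr_sqrtr; last by apply: sumr_ge0 => i _; exact: sqr_ge0.
by apply: eq_bigr => i _; rewrite H1norm_sqr.
Qed.

Lemma b_formE K v w : L2h Omega v -> L2h Omega w ->
  b_form Omega K v w = K * grad_form Omega v w.
Proof.
move=> [_ Lv] [_ Lw]; rewrite /b_form /grad_form /ip.
have /(Rintegral_sum (index_enum _) mO) [h1 h2] : forall i,
    (lebesgue_rV d).-integrable Omega (EFin \o (fun x => v.2 i x * w.2 i x)).
  by move=> i; exact: L2fun_mul_integrable.
by rewrite RintegralZl// h2.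
Qed.

Lemma B_normE K v : 0 <= K -> L2h Omega v ->
  B_norm Omega K v = Num.sqrt K * H1semi Omega v.
Proof.
move=> K0 Lv; rewrite /B_norm b_formE// sqrtrM// -H1semi_sqr// sqrtr_sqr.
by rewrite ger0_norm// sqrtr_ge0.
Qed.

Lemma semi_inner_b K : 0 <= K -> semi_inner (L2h Omega) (b_form Omega K).
Proof.
move=> K0; apply: semi_inner_eq (semi_inner_scale K0 semi_inner_grad).
by move=> v w Lv Lw; rewrite b_formE.
Qed.

Lemma divergence_L2 u : L2v Omega u -> L2fun Omega (divergence u : fn).
Proof.
move=> Lu; rewrite (_ : divergence u = \sum_i (u i).2 i :> fn); last first.
  by apply/funext => x; rewrite fct_sumE.
by apply: lin_closed_sum => [|i]; [exact: L2fun_lin_closed|exact: (Lu i).2].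
Qed.

Lemma divergence_lin k u z :
  divergence (k *: u + z) = k *: (divergence u : fn) + divergence z :> fn.
Proof.
apply/funext => x; rewrite fnE /divergence mulr_sumr -big_split.
by apply: eq_bigr => i _; rewrite h1vecE h1fun_gradE fnE.
Qed.

Lemma divergenceB u z :
  divergence (u - z) = (divergence u : fn) - divergence z :> fn.
Proof. by rewrite addrC -scaleN1r divergence_lin scaleN1r addrC. Qed.

Lemma semi_inner_div : semi_inner (L2v Omega) (div_form Omega).
Proof.
apply: (semi_inner_comp (l := fun u : h1v => divergence u : fn)) siL2.
- exact: L2v_lin_closed.
- by move=> k u z; rewrite divergence_lin.
- exact: divergence_L2.
Qed.

Lemma sym_gradE u i j : sym_grad u i j =
  2^-1 *: ((u i).2 j : fn) + 2^-1 *: ((u j).2 i : fn) :> fn.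
Proof.
apply/funext => x; rewrite /sym_grad.
rewrite fnE -[_ *: (u j).2 i]addr0 fnE addr0.
by field.
Qed.

Lemma sym_grad_L2 u i j : L2v Omega u -> L2fun Omega (sym_grad u i j : fn).
Proof.
move=> Lu; have cL := L2fun_lin_closed mO; rewrite sym_gradE.
by apply: cL.2; [exact: (Lu i).2|apply: (lin_closedZ _ cL); exact: (Lu j).2].
Qed.

Definition strain_form u z : R :=
  \sum_i \sum_j ip Omega (sym_grad u i j) (sym_grad z i j).

Lemma a_formE (lambda mu : R) u z : L2v Omega u -> L2v Omega z ->
  a_form Omega lambda mu u z =
  2 * mu * strain_form u z + lambda * div_form Omega u z.
Proof.
move=> Lu Lz; rewrite /a_form /strain_form; congr (_ * _ + _).
have H i j : (lebesgue_rV d).-integrable Omega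
    (EFin \o (fun x => sym_grad u i j x * sym_grad z i j x)).
  by apply: L2fun_mul_integrable => //; exact: sym_grad_L2.
have H' i := Rintegral_sum (index_enum _) mO (H i).
rewrite (Rintegral_sum _ mO (fun i => (H' i).1)).2.
by apply: eq_bigr => i _; exact: (H' i).2.
Qed.

Lemma semi_inner_strain : semi_inner (L2v Omega) strain_form.
Proof.
have cLv := L2v_lin_closed.
apply: semi_inner_sum => // i; apply: semi_inner_sum => // j.
apply: (semi_inner_comp (l := fun u : h1v => sym_grad u i j : fn)) siL2 => //.
  move=> k u z; apply/funext => x.
  rewrite fnE /sym_grad !h1vecE !h1fun_gradE !fnE.
  by field.
by move=> u Lu; exact: sym_grad_L2.
Qed.

Lemma semi_inner_a (lambda mu : R) : 0 <= lambda -> 0 <= mu ->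
  semi_inner (L2v Omega) (a_form Omega lambda mu).
Proof.
move=> l0 m0.
apply: semi_inner_eq (semi_innerD
  (semi_inner_scale (mulr_ge0 (ler0n R 2) m0) semi_inner_strain)
  (semi_inner_scale l0 semi_inner_div)).
by move=> u z Lu Lz; rewrite a_formE.
Qed.

(** The divergence is the trace of the strain, a sum of d entries. *)
Lemma div_form_le_strain u : L2v Omega u ->
  div_form Omega u u <= d%:R * strain_form u u.
Proof.
move=> Lu; have Ls i j := sym_grad_L2 i j Lu.
have -> : div_form Omega u u =
    ip Omega (\sum_i (sym_grad u i i : fn)) (\sum_i (sym_grad u i i : fn)).
  suff -> : \sum_i (sym_grad u i i : fn) = divergence u :> fn by [].
  apply/funext => x; rewrite fct_sumE; apply: eq_bigr => i _.
  by rewrite /sym_grad; field.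
apply: (le_trans (si_sqr_sum siL2 _)) => [i//|].
rewrite ler_wpM2l// ler_sum// => i _; rewrite (bigD1 i)//= lerDl.
by apply: sumr_ge0 => j _; exact: (si_ge0 siL2).
Qed.

(** The origin of the threshold for L: the elastic energy controls the
    divergence with the constant lambda + 2 mu / d. *)
Lemma a_form_coercive_div (lambda mu : R) u : (0 < d)%N -> 0 <= mu -> L2v Omega u ->
  (lambda + 2 * mu / d%:R) * div_form Omega u u <= a_form Omega lambda mu u u.
Proof.
move=> d0 m0 Lu; rewrite a_formE// mulrDl addrC lerD2r -mulrA.
rewrite ler_wpM2l ?mulr_ge0// ler_pdivrMl ?ltr0n//.
exact: div_form_le_strain.
Qed.

Lemma grad_sum_le_H1_vec u : L2v Omega u ->
  \sum_i \sum_j ip Omega ((u i).2 j) ((u i).2 j) <= H1ip_vec Omega u u.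
Proof.
move=> Lu; apply: ler_sum => i _; rewrite /H1ip lerDr.
by apply: (si_ge0 siL2); exact: (Lu i).1.
Qed.

Lemma div_form_le_H1 u : L2v Omega u ->
  div_form Omega u u <= d%:R * H1ip_vec Omega u u.
Proof.
move=> Lu.
have -> : div_form Omega u u =
    ip Omega (\sum_i ((u i).2 i : fn)) (\sum_i ((u i).2 i : fn)).
  suff -> : \sum_i ((u i).2 i : fn) = divergence u :> fn by [].
  by apply/funext => x; rewrite fct_sumE.
apply: (le_trans (si_sqr_sum siL2 _)) => [i|]; first exact: (Lu i).2.
rewrite ler_wpM2l//; apply: le_trans (grad_sum_le_H1_vec Lu).
apply: ler_sum => i _; rewrite (bigD1 i)//= lerDl.
by apply: sumr_ge0 => j _; apply: (si_ge0 siL2); exact: (Lu i).2.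
Qed.

Lemma strain_form_le_H1 u : L2v Omega u ->
  strain_form u u <= H1ip_vec Omega u u.
Proof.
move=> Lu; apply: le_trans (grad_sum_le_H1_vec Lu).
pose N i j := ip Omega ((u i).2 j) ((u i).2 j).
have H i j : ip Omega (sym_grad u i j) (sym_grad u i j) <= (N i j + N j i) / 2.
  have Lij i' j' := (Lu i').2 j'; have cL := L2fun_lin_closed mO.
  rewrite sym_gradE; apply: (le_trans (si_sqrD_le siL2 _ _)).
  - by apply: lin_closedZ.
  - by apply: lin_closedZ.
  rewrite !(si_sqrZ siL2)// -/(N i j) -/(N j i).
  by rewrite le_eqVlt; apply/orP; left; apply/eqP; field.
have -> : \sum_i \sum_j N i j = \sum_i \sum_j (N i j + N j i) / 2.
  have -> : \sum_i \sum_j (N i j + N j i) / 2 =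
      (\sum_i \sum_j N i j + \sum_i \sum_j N j i) / 2.
    rewrite -big_split/= mulr_suml; apply: eq_bigr => i _.
    by rewrite -big_split/= mulr_suml.
  by rewrite [X in _ + X]exchange_big/=; field.
by apply: ler_sum => i _; apply: ler_sum => j _; exact: H.
Qed.

(** Makes paths that are C^1 in the H^1 norm differentiable for the elastic
    energy too. *)
Lemma a_form_le_H1 (lambda mu : R) u : 0 <= lambda -> 0 <= mu -> L2v Omega u ->
  a_form Omega lambda mu u u <=
  (2 * mu + lambda * d%:R) * H1ip_vec Omega u u.
Proof.
move=> l0 m0 Lu; rewrite a_formE// [leRHS]mulrDl lerD//.
  by rewrite ler_wpM2l ?mulr_ge0//; exact: strain_form_le_H1.
by rewrite -mulrA ler_wpM2l//; exact: div_form_le_H1.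
Qed.

End energy_forms.

(** * Linearity of the finite element spaces and mass lumping *)

Section finite_element_spaces.
Context {R : realType} {d : nat} {Omega : set 'rV[R]_d} {b : R}.
Hypothesis mO : measurable Omega.
Hypothesis Ob : Omega `<=` @cube R d b.
Local Notation fn := ('rV[R]_d -> R^o).
Let siL2 := semi_inner_ip mO.
Let cL := L2fun_lin_closed mO.

Lemma L2norm_comb_le k (f g f' g' : fn) : L2fun Omega f -> L2fun Omega g ->
  L2fun Omega f' -> L2fun Omega g' ->
  L2norm Omega (fun x => (k *: f + g) x - (k *: f' + g') x) <=
  `|k| * L2norm Omega (fun x => f x - f' x) +
  L2norm Omega (fun x => g x - g' x).
Proof.
move=> Lf Lg Lf' Lg'.
have Lff : L2fun Omega (f - f') by exact: lin_closedB.
have Lgg : L2fun Omega (g - g') by exact: lin_closedB.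
rewrite (_ : (fun x => _) = k *: (f - f') + (g - g') :> fn); last first.
  by apply/funext => x; rewrite !fnE; change (k * f x + g x - (k * f' x + g' x) =
    k * ((f x : R) - f' x) + ((g x : R) - g' x)); ring.
have Lkff : L2fun Omega (k *: (f - f')) by exact: lin_closedZ.
apply: (le_trans (si_triangle siL2 Lkff Lgg)); rewrite lerD2r.
by rewrite (si_sqrZ siL2)// sqrtrM ?sqr_ge0// sqrtr_sqr.
Qed.

Lemma H1_0_L2 v : H1_0 Omega v -> L2h Omega v.
Proof. by case. Qed.

(** Combinations of approximating test functions approximate combinations; the
    triangle inequality requires the test functions to be square-integrable. *)
Lemma H1_0_lin_closed : lin_closed (H1_0 Omega).
Proof.
have cT := @test_function_lin_closed R d Omega; have cS := L2h_lin_closed mO.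
have L2T phi : test_function Omega phi -> L2fun Omega phi.
  by move=> Tphi; exact: (@test_function_L2 R d Omega mO b Ob phi Tphi).
split.
  have [L1 L2] := cS.1; split => // e e0; exists (0 : fn).
  have N0 : L2norm Omega (fun=> 0) = 0.
    by rewrite /L2norm (si_0 siL2 cL.1) sqrtr0.
  split; first exact: cT.1.
    rewrite (_ : (fun x => _) = fun=> 0) ?N0//.
    by apply/funext => x; exact: subrr.
  move=> i; rewrite (_ : (fun x => _) = fun=> 0) ?N0//.
  by apply/funext => x; rewrite [partial _ _ _]derive_cst; exact: subrr.
move=> k v w Hv Hw.
have [Lv1 Lv2 Av] := Hv; have [Lw1 Lw2 Aw] := Hw.
have [L1 L2] := cS.2 k v w (conj Lv1 Lv2) (conj Lw1 Lw2); split => // e e0.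
have e'0 : 0 < e / (`|k| + 1).
  by rewrite divr_gt0// ltr_wpDl.
have H x y : x < e / (`|k| + 1) / 2 -> y < e / (`|k| + 1) / 2 ->
    `|k| * x + y < e.
  set t := _ / 2 => xt yt; have -> : e = (`|k| + 1) * (t + t).
    by rewrite /t -splitr mulrC divfK// gt_eqF// ltr_wpDl.
  have t0 : 0 < t by rewrite /t divr_gt0.
  have := normr_ge0 k; nra.
have e20 : 0 < e / (`|k| + 1) / 2 by rewrite divr_gt0.
have [phi [Tphi vphi vphi']] := Av _ e20.
have [psi [Tpsi wpsi wpsi']] := Aw _ e20.
exists (k *: (phi : fn) + (psi : fn)); split.
- exact: cT.2.
- rewrite h1fun_valE; apply: le_lt_trans (H _ _ vphi wpsi).
  by apply: L2norm_comb_le => //; exact: L2T.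
- move=> i; rewrite h1fun_gradE.
  have -> : partial i (k *: (phi : fn) + (psi : fn)) =
      k *: (partial i phi : fn) + (partial i psi : fn) :> fn.
    apply: partialD => x; [exact: (Tphi.1 [::])|exact: (Tpsi.1 [::])].
  apply: le_lt_trans (H _ _ (vphi' i) (wpsi' i)).
  by apply: L2norm_comb_le => //; apply: L2T; exact: test_function_partial.
Qed.

Lemma V_space_L2 u : V_space Omega u -> L2v Omega u.
Proof. by move=> Vu i; exact: H1_0_L2. Qed.

Variable M : mesh R d.

Lemma Q_h_lin_closed : lin_closed (Q_h M Omega).
Proof.
have cH := H1_0_lin_closed; split.
  split; [exact: cH.1|exact: cst_continuous|by []|].
  move=> k; exists 0, 0 => x _; rewrite addr0 big1// => i _.
  by rewrite mxE mul0r.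
move=> k v w [Hv cv v0 av] [Hw cw w0 aw]; split.
- exact: cH.2.
- rewrite h1fun_valE => x; apply: (@continuousD _ R^o); last exact: cw.
  by apply: continuousZr; exact: cv.
- by move=> x Ox; rewrite h1fun_valE fnE v0// w0// mulr0 addr0.
- move=> l; have [a [s va]] := av l; have [a' [s' wa]] := aw l.
  exists (k *: a + a'), (k * s + s') => x lx.
  rewrite h1fun_valE fnE va// wa// mulrDr addrACA mulr_sumr -big_split/=.
  by congr (_ + _); apply: eq_bigr => i _; rewrite !mxE; ring.
Qed.

Lemma V_h_lin_closed : lin_closed (V_h M Omega).
Proof.
have cQ := Q_h_lin_closed; split; first by move=> i; exact: cQ.1.
by move=> k u z Vu Vz i; rewrite h1vecE; exact: cQ.2.
Qed.

Lemma Q_h_L2 q : Q_h M Omega q -> L2h Omega q.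
Proof. by move=> [/H1_0_L2]. Qed.

Lemma V_h_L2 u : V_h M Omega u -> L2v Omega u.
Proof. by move=> Vu i; exact: Q_h_L2. Qed.

Lemma V_h_V_space u : V_h M Omega u -> V_space Omega u.
Proof. by move=> Vu i; have [] := Vu i. Qed.

Lemma lumped_lin k p q r :
  lumped M (k *: p + q) r = k * lumped M p r + lumped M q r.
Proof.
rewrite /lumped mulr_sumr -big_split/=; apply: eq_bigr => l _.
rewrite mulrCA -mulrDr; congr (_ * _).
rewrite mulr_sumr -big_split/=; apply: eq_bigr => i _.
by rewrite fnE mulrDl mulrA.
Qed.

(** The excess of the mass-lumped product over the exact one: the stabilisation
    of the scheme is L times this form. *)
Definition Z_form p q : R := lumped M p q - val_form Omega p q.

(** Nonnegativity comes from the upper half of the norm equivalence: C2 times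
    the form dominates a square. *)
Lemma semi_inner_Z C1 C2 : 0 < C2 -> Z_norm_equivalence M Omega C1 C2 ->
  semi_inner (Q_h M Omega) Z_form.
Proof.
move=> C20 Zeq; have siv := semi_inner_val mO; split.
- exact: Q_h_lin_closed.
- move=> k p q r /Q_h_L2 Lp /Q_h_L2 Lq /Q_h_L2 Lr.
  by rewrite /Z_form lumped_lin (si_lin siv)//; ring.
- move=> p q /Q_h_L2 Lp /Q_h_L2 Lq; rewrite /Z_form (si_sym siv)//.
  congr (_ - _); apply: eq_bigr => k _; congr (_ * _).
  by apply: eq_bigr => i _; rewrite mulrC.
- move=> q Qq; have [_] := Zeq q Qq; rewrite -[Z_norm_sqr _ _ _]/(Z_form q q).
  move=> /(le_trans _) H; rewrite -(pmulr_rge0 _ C20); apply: H.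
  by rewrite mulr_ge0 ?sqr_ge0.
Qed.

End finite_element_spaces.

(** * Paths and their difference quotients *)

Section C1_scalar.
Context {R : realType}.
Local Notation mu := (@lebesgue_measure R).
Implicit Types (T : R) (f df : R -> R).

Lemma within_dnbhs_cvg0P T (g : R -> R) t :
  g s @[s --> within `[0, T] t^'] --> 0 -> forall e : R, 0 < e ->
  exists2 r, 0 < r & forall s, s \in `[0, T] -> s != t -> `|t - s| < r ->
    `|g s| <= e.
Proof.
move=> + e e0 => /cvgrPdist_le/(_ e e0).
rewrite /within/= /dnbhs/within/= => /nbhs_ballP[r /= r0 H]; exists r => // s sT st ts.
by have := H s ts st sT; rewrite sub0r normrN.
Qed.

(** What remains of a C^1 path with values in a normed space once it is paired
    with a fixed vector. *)
Definition C1_on T f df : Prop := forall t, t \in `[0, T] ->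
  (s - t)^-1 * (f s - f t) - df t @[s --> within `[0, T] t^'] --> 0 /\
  df s @[s --> within `[0, T] (nbhs t)] --> df t.

Context {T : R} {f df : R -> R}.
Hypothesis C1f : C1_on T f df.

Lemma C1_on_continuous : {within `[0, T], continuous f}.
Proof.
apply/subspace_continuousP => t tT; have [H _] := C1f tT.
apply/cvgrPdist_le => e e0.
have [r r0 {}H] := within_dnbhs_cvg0P H ltr01.
set c := `|df t| + 1; have c0 : 0 < c by rewrite ltr_wpDl.
apply/nbhs_ballP; exists (Num.min r (e / c)).
  by rewrite /= lt_min r0 divr_gt0.
move=> s /=; rewrite /ball/= lt_min => /andP[tsr tse] sT.
have [->|st] := eqVneq s t; first by rewrite subrr normr0 ltW.
have := H s sT st tsr => Hs.
have st0 : s - t != 0 by rewrite subr_eq0.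
have {Hs} : `|(s - t)^-1 * (f s - f t)| <= c.
  rewrite -[X in `|X|](subrK (df t)) addrC.
  by rewrite (le_trans (ler_normD _ _))// lerD2l.
rewrite normrM normfV ler_pdivrMl ?normr_gt0// distrC => H1.
apply: (le_trans H1); rewrite (distrC s).
by rewrite -ler_pdivlMr// ltW.
Qed.

Lemma C1_on_derive t : t \in `]0, T[ -> is_derive t 1 f (df t).
Proof.
move=> /[dup] tT; rewrite in_itv/= => /andP[t0 tT'].
have tcT : t \in `[0, T] by rewrite in_itv/= !ltW.
have [H _] := C1f tcT.
have L : (fun h => h^-1 *: ((f \o shift t) (h *: (1 : R)) - f t)) @ 0^' --> df t.
  apply/cvgrPdist_le => e e0.
  have [r r0 {}H] := within_dnbhs_cvg0P H e0.
  apply/nbhs_ballP; exists (Num.min r (Num.min t (T - t))).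
    by rewrite /= !lt_min r0 t0 subr_gt0.
  move=> h /=; rewrite /ball/= sub0r normrN !lt_min => /and3P[hr ht hT] h0.
  have := H (h + t); rewrite addrK in_itv/= => Hs.
  rewrite [h *: _]mulr1 distrC; apply: Hs.
  - by move: ht hT; rewrite !ltr_norml => /andP[? ?] /andP[? ?]; apply/andP; split; lra.
  - by rewrite -subr_eq0 addrK.
  - by rewrite opprD addrCA subrr addr0 normrN.
apply: DeriveDef; last exact: cvg_lim L.
by apply/cvg_ex; exists (df t).
Qed.

Lemma C1_on_continuous_derive : {within `[0, T], continuous df}.
Proof. by apply/subspace_continuousP => t /C1f[]. Qed.

Lemma C1_on_mean_value (a b : R) : 0 <= a -> a < b -> b <= T ->
  exists2 r, r \in `[a, b] & f b - f a = df r * (b - a).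
Proof.
move=> a0 ab bT; have [] := @MVT R f df a b ab.
- move=> x; rewrite in_itv/= => /andP[ax xb]; apply: C1_on_derive.
  by rewrite in_itv/= (le_lt_trans a0)//= (lt_le_trans xb).
- apply: continuous_subspaceW C1_on_continuous => x /=; rewrite !in_itv/=.
  by move=> /andP[ax xb]; rewrite (le_trans a0)//= (le_trans xb).
- move=> r; rewrite in_itv/= => /andP[ar rb] ->; exists r => //.
  by rewrite in_itv/= !ltW.
Qed.

Lemma C1_on_integrable : mu.-integrable `[0, T] (EFin \o df).
Proof.
apply: continuous_compact_integrable; first exact: segment_compact.
exact: C1_on_continuous_derive.
Qed.

Lemma C1_on_FTC (b : R) : b \in `[0, T] ->
  f b - f 0 = \int[mu]_(r in `[0, b]) df r.
Proof.
rewrite in_itv/= => /andP[b0 bT]; have [<-|b0'] := eqVneq 0 b.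
  by rewrite subrr set_itv1 Rintegral_set1.
have {b0 b0'} b0 : 0 < b by rewrite lt_neqAle b0'.
have sub : [set` `[0, b]] `<=` [set` `[0, T]].
  move=> x /=; rewrite !in_itv/= => /andP[-> xb]/=; exact: le_trans bT.
have dft x : x \in `]0, b[ -> is_derive x 1 f (df x).
  rewrite in_itv/= => /andP[x0 xb]; apply: C1_on_derive.
  by rewrite in_itv/= x0 (lt_le_trans xb).
rewrite /Rintegral (@continuous_FTC2 _ df f)//.
- exact: continuous_subspaceW C1_on_continuous_derive.
- have /(continuous_within_itvP _ b0)[_ f0 fb] : {within `[0, b], continuous f}.
    exact: continuous_subspaceW C1_on_continuous.
  by split => // x xb; have [] := dft x xb.
- by move=> x xb; rewrite derive1E; have [_ ->] := dft x xb.
Qed.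

End C1_scalar.
Section paths.
Context {R : realType} {X : lmodType R}.
Local Notation mu := (@lebesgue_measure R).
Implicit Types (S : X -> Prop) (B : X -> X -> R) (v dv w dw : R -> X).
Implicit Types (G : R -> R) (T s t : R).

Definition primitive (G : R -> R) (t : R) : R := \int[mu]_(r in `[0, t]) G r.

(** An absolutely continuous path in weak form: paired with any vector of S, w is
    the primitive of dw, and G dominates the square of dw. This holds for the
    derivative of the solution, with a weak second derivative, as well as for
    the C^1 projection errors. *)
Definition integral_path S B (T : R) w dw (G : R -> R) : Prop :=
  [/\ forall t, t \in `[0, T] -> S (w t) /\ S (dw t),
      mu.-integrable `[0, T] (EFin \o G),
      forall t, t \in `[0, T] -> B (dw t) (dw t) <= G t &
      forall z, S z -> mu.-integrable `[0, T] (EFin \o (fun r => B (dw r) z)) /\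
        forall t, t \in `[0, T] ->
          B (w t - w 0) z = primitive (fun r => B (dw r) z) t].

Lemma primitive0 G : primitive G 0 = 0.
Proof. by rewrite /primitive set_itv1 Rintegral_set1. Qed.

Lemma primitiveB (T : R) G (s t : R) : mu.-integrable `[0, T] (EFin \o G) ->
  0 <= s -> s <= t -> t <= T ->
  primitive G t - primitive G s = \int[mu]_(r in `]s, t]) G r.
Proof.
move=> iG s0 st tT; rewrite /primitive Rintegral_itvB ?bnd_simp//.
by apply: integrableS iG => //; apply: subset_itvl; rewrite bnd_simp.
Qed.

Lemma primitive_scale T k G t : mu.-integrable `[0, T] (EFin \o G) -> t <= T ->
  primitive (fun s => k * G s) t = k * primitive G t.
Proof.
move=> iG tT; rewrite /primitive RintegralZl//.
by apply: integrableS iG => //; apply: subset_itvl; rewrite bnd_simp.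
Qed.

Lemma le_primitive (T : R) G (s t : R) : mu.-integrable `[0, T] (EFin \o G) ->
  (forall r : R, r \in `[0, T] -> 0 <= G r) -> 0 <= s -> s <= t -> t <= T ->
  primitive G s <= primitive G t.
Proof.
move=> iG G0 s0 st tT; rewrite -subr_ge0 (primitiveB iG)//.
apply: Rintegral_ge0 => r /=; rewrite in_itv/= => /andP[sr rt].
by apply: G0; rewrite in_itv/= (le_trans s0 (ltW sr)) (le_trans rt).
Qed.

(** Young's inequality for a quantity known through Cauchy-Schwarz only. *)
Lemma weighted_young (x g m k : R) : 0 < k -> 0 <= g -> 0 <= m ->
  x ^+ 2 <= g * m -> x <= k / 2 * g + m / (2 * k).
Proof.
move=> k0 g0 m0 xgm; have y0 : 0 <= k / 2 * g + m / (2 * k).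
  by have k'0 := ltW k0; rewrite addr_ge0 ?mulr_ge0 ?invr_ge0 ?mulr_ge0.
have [x0|x0] := leP x 0; first exact: le_trans y0.
rewrite -(@ler_pXn2r _ 2) ?nnegrE// ?(ltW x0)//; apply: (le_trans xgm).
rewrite -subr_ge0; have -> : (k / 2 * g + m / (2 * k)) ^+ 2 - g * m =
  (k / 2 * g - m / (2 * k)) ^+ 2 by field; rewrite gt_eqF.
exact: sqr_ge0.
Qed.

Section integral_path_theory.
Context {S : X -> Prop} {B : X -> X -> R} (siB : semi_inner S B).
Let cS := si_closed siB.

Lemma integral_path_primitive_ge0 T w dw G : integral_path S B T w dw G ->
  forall r : R, r \in `[0, T] -> 0 <= G r.
Proof.
move=> [Sw _ BG _] r rT; apply: le_trans (BG r rT).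
by apply: (si_ge0 siB); exact: (Sw r rT).2.
Qed.

(** Cauchy-Schwarz in time. Pairing with the increment z itself gives B z z as
    the integral of B (dw r) z, which Young's inequality with the weight t - s
    bounds by half of the claim plus half of B z z. *)
Lemma integral_path_increment T w dw G (s t : R) : integral_path S B T w dw G ->
  0 <= s -> s <= t -> t <= T ->
  B (w t - w s) (w t - w s) <= (t - s) * (primitive G t - primitive G s).
Proof.
move=> wP s0 st tT; have G0 := integral_path_primitive_ge0 wP.
have [Sw iG BG wE] := wP.
have sI : s \in `[0, T] by rewrite in_itv/= s0 (le_trans st).
have tI : t \in `[0, T] by rewrite in_itv/= tT (le_trans s0).
have oI : 0 \in `[0, T] by rewrite in_itv/= lexx (le_trans s0 (le_trans st tT)).
have [Ss St So] := And3 (Sw s sI).1 (Sw t tI).1 (Sw 0 oI).1.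
have [<-|st'] := eqVneq s t.
  by rewrite !subrr (si_0 siB) ?mul0r//; exact: cS.1.
have {st' } st' : 0 < t - s by rewrite subr_gt0 lt_neqAle st'.
set z := w t - w s; have Sz : S z by exact: lin_closedB.
have [iz zE] := wE z Sz.
have [m mE] : exists m, B z z = m by exists (B z z).
have mint : m = \int[mu]_(r in `]s, t]) B (dw r) z.
  rewrite -mE -(primitiveB iz)// -!zE// -(si_B siB)//; try exact: lin_closedB.
  by congr (B _ z); rewrite opprB addrA subrK.
have m0 : 0 <= m by rewrite -mE (si_ge0 siB).
have sub : [set` `]s, t]] `<=` [set` `[0, T]].
  move=> x /=; rewrite !in_itv/= => /andP[sx xt].
  by rewrite (le_trans s0 (ltW sx)) (le_trans xt).
have iGs : mu.-integrable `]s, t] (EFin \o G) by exact: integrableS iG.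
have iG2 : mu.-integrable `]s, t] (EFin \o (fun r => (t - s) / 2 * G r)).
  by apply: integrable_scale.
have muE : lebesgue_measure [set` `]s, t]] = (t - s)%:E.
  by rewrite lebesgue_measure_itv/= lte_fin -subr_gt0 st' -EFinB.
have ic : mu.-integrable `]s, t] (EFin \o (fun=> m / (2 * (t - s)))).
  apply: measurable_bounded_integrable => //.
    by have : (lebesgue_measure [set` `]s, t]] < +oo)%E by rewrite muE ltry.
  exact: bounded_cst.
have : m <= \int[mu]_(r in `]s, t]) ((t - s) / 2 * G r + m / (2 * (t - s))).
  rewrite {1}mint; apply: le_Rintegral => //.
  - exact: integrableS iz.
  - by apply: integrable_add.
  - move=> r /sub rI; have Sr := (Sw r rI).2.
    apply: weighted_young => //; first exact: G0.
    apply: (le_trans (si_CauchySchwarz siB Sr Sz)).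
    by rewrite mE ler_wpM2r// BG.
rewrite RintegralD// RintegralZl// Rintegral_cst// -(primitiveB iG)//.
rewrite (_ : fine _ = t - s); last by rewrite -[RHS]/(fine (t - s)%:E) -muE.
set P := primitive G t - _.
have -> : m / (2 * (t - s)) * (t - s) = m / 2 by field; rewrite gt_eqF.
by rewrite mE; lra.
Qed.

End integral_path_theory.

Section C1_paths.
Context {S S1 : X -> Prop} {B : X -> X -> R} {nrm : X -> R} {k : R}.
Hypothesis siB : semi_inner S B.
Hypothesis S1S : forall x, S1 x -> S x.
Hypothesis nrm0 : forall x, S x -> 0 <= nrm x.
Hypothesis k0 : 0 <= k.
Hypothesis Bnrm : forall x, S x -> B x x <= k * nrm x ^+ 2.
Let cS := si_closed siB.

Lemma form_le_norm x z : S x -> S z ->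
  `|B x z| <= Num.sqrt (k * B z z) * nrm x.
Proof.
move=> Sx Sz; apply: (le_trans (si_CauchySchwarz_sqrt siB Sx Sz)).
rewrite mulrC sqrtrM// (mulrC (Num.sqrt k)) -mulrA ler_wpM2l ?sqrtr_ge0//.
rewrite -[nrm x]ger0_norm ?nrm0// -sqrtr_sqr -sqrtrM//.
by rewrite ler_wsqrtr// Bnrm.
Qed.

Context {T : R} {v dv : R -> X}.
Hypothesis C1v : C1_path S1 nrm T v dv.

Lemma C1_path_in t : t \in `[0, T] -> S (v t) /\ S (dv t).
Proof. by move=> /C1v[/S1S ? /S1S ? _ _]. Qed.

Lemma C1_path_form z : S z -> C1_on T (fun r => B (v r) z) (fun r => B (dv r) z).
Proof.
move=> Sz t tT; have [Svt Sdvt] := C1_path_in tT; have [_ _ dvt cvt] := C1v tT.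
have [c c0 Hc] : exists2 c, 0 < c & forall x, S x -> `|B x z| <= c * nrm x.
  exists (Num.sqrt (k * B z z) + 1); first by rewrite ltr_wpDl ?sqrtr_ge0.
  move=> x Sx; apply: (le_trans (form_le_norm Sx Sz)).
  by rewrite ler_wpM2r ?nrm0// lerDl.
split; apply/cvgrPdist_le => e e0.
- have /(@cvgrPdist_le _ R^o)/(_ (e / c)) := dvt; rewrite divr_gt0// => /(_ isT).
  move=> H; have {}H : \forall s \near t^', s \in `[0, T] ->
      `|0 - nrm ((s - t)^-1 *: (v s - v t) - dv t)| <= e / c by exact: H.
  suff : \forall s \near t^', s \in `[0, T] ->
      `|0 - ((s - t)^-1 * (B (v s) z - B (v t) z) - B (dv t) z)| <= e by [].
  apply: filterS H => s + sT => /(_ sT); have [Svs _] := C1_path_in sT.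
  have Sd : S (v s - v t) by exact: lin_closedB.
  have Sq : S ((s - t)^-1 *: (v s - v t)) by exact: lin_closedZ.
  have Sqd : S ((s - t)^-1 *: (v s - v t) - dv t) by exact: lin_closedB.
  rewrite !sub0r !normrN ger0_norm ?nrm0// => H.
  rewrite -(si_B siB)// -(si_Z siB)// -(si_B siB)//.
  apply: (le_trans (Hc _ Sqd)).
  by rewrite mulrC -ler_pdivlMr.
- have /(@cvgrPdist_le _ R^o)/(_ (e / c)) := cvt; rewrite divr_gt0// => /(_ isT).
  move=> H; have {}H : \forall s \near nbhs t, s \in `[0, T] ->
      `|0 - nrm (dv s - dv t)| <= e / c by exact: H.
  suff : \forall s \near nbhs t, s \in `[0, T] ->
      `|B (dv t) z - B (dv s) z| <= e by [].
  apply: filterS H => s + sT => /(_ sT); have [_ Sdvs] := C1_path_in sT.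
  have Sd : S (dv s - dv t) by exact: lin_closedB.
  rewrite sub0r normrN ger0_norm ?nrm0// => H.
  rewrite distrC -(si_B siB)//; apply: (le_trans (Hc _ Sd)).
  by rewrite mulrC -ler_pdivlMr.
Qed.

Lemma C1_path_integral_path G : mu.-integrable `[0, T] (EFin \o G) ->
  (forall t : R, t \in `[0, T] -> B (dv t) (dv t) <= G t) ->
  integral_path S B T v dv G.
Proof.
move=> iG BG; split => // [|z Sz]; first exact: C1_path_in.
have C1z := C1_path_form Sz; split; first exact: C1_on_integrable C1z.
move=> t tT; have oT : 0 \in `[0, T].
  by move: tT; rewrite !in_itv/= lexx => /andP[]; exact: le_trans.
have [[? _] [? _]] := (C1_path_in tT, C1_path_in oT).
by rewrite (si_B siB)// (C1_on_FTC C1z).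
Qed.

(** Let z be the error. By the mean value theorem for the real function
    B (v _) z, the pairing of z with itself is the pairing of z with
    dv x - dv r for some x between s and t. So the error is at most the
    increment of dv, by Cauchy-Schwarz. *)
Lemma difference_quotient_error ddv G (s t r : R) :
  integral_path S B T dv ddv G -> 0 <= s -> s < t -> t <= r -> r <= T ->
  B ((t - s)^-1 *: (v t - v s) - dv r) ((t - s)^-1 *: (v t - v s) - dv r) <=
  (r - s) * (primitive G r - primitive G s).
Proof.
move=> dvP s0 st tr rT.
have G0 := integral_path_primitive_ge0 siB dvP; have [_ iG _ _] := dvP.
have inT x : s <= x -> x <= r -> x \in `[0, T].
  by move=> sx xr; rewrite in_itv/= (le_trans s0) ?(le_trans xr).
have st' := ltW st; have sr := le_trans st' tr.
have [Ss _] := C1_path_in (inT _ (lexx s) sr).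
have [St _] := C1_path_in (inT _ st' tr).
have [_ Sdr] := C1_path_in (inT _ sr (lexx r)).
have Sd : S (v t - v s) by exact: lin_closedB.
have Sq : S ((t - s)^-1 *: (v t - v s)) by exact: lin_closedZ.
set z := _ - dv r; have Sz : S z by exact: lin_closedB.
have [x] := C1_on_mean_value (C1_path_form Sz) s0 st (le_trans tr rT).
rewrite in_itv/= => /andP[sx xt] xE.
have xr := le_trans xt tr; have [_ Sdx] := C1_path_in (inT _ sx xr).
have Sdd : S (dv r - dv x) by exact: lin_closedB.
have zE : B z z = - B (dv r - dv x) z.
  have zl y : S y -> B z y =
      (t - s)^-1 * (B (v t) y - B (v s) y) - B (dv r) y.
    by move=> Sy; rewrite /z (si_B siB)// (si_Z siB)// (si_B siB).
  by rewrite zl// xE (si_B siB)//; field; rewrite subr_eq0 gt_eqF.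
have : B z z <= B (dv r - dv x) (dv r - dv x).
  have := si_CauchySchwarz siB Sdd Sz; have := si_ge0 siB Sz.
  have := si_ge0 siB Sdd.
  have -> : B (dv r - dv x) z ^+ 2 = B z z * B z z by rewrite zE; ring.
  move: (B z z) (B _ _) => p q q0; rewrite le_eqVlt => /predU1P[<-//|p0].
  by rewrite ler_pM2r.
move=> /le_trans; apply.
apply: (le_trans (integral_path_increment siB dvP (le_trans s0 sx) xr rT)).
apply: ler_pM; rewrite ?subr_ge0//.
- by apply: (le_primitive iG) => //; exact: le_trans sx.
- by rewrite lerD2l lerN2.
- by rewrite lerD2l lerN2; apply: (le_primitive iG) => //; exact: le_trans rT.
Qed.

End C1_paths.

End paths.

(** * Weak second derivatives in time *)

Section weak_time_derivatives.
Context {R : realType} {d : nat} {Omega : set 'rV[R]_d}.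
Hypothesis mO : measurable Omega.
Local Notation mu := (@lebesgue_measure R).
Local Notation h1 := (h1fun R d).
Local Notation h1v := (h1vec R d).
Context {T : R}.
Implicit Types (w dw : R -> h1) (G : R -> R).

Lemma H1_derivative_sqr_integrable w dw : L2_time_derivative Omega T w dw ->
  mu.-integrable `[0, T] (EFin \o (fun r => H1ip Omega (dw r) (dw r))).
Proof.
move=> [Hdw i1 i2 _].
have i12 : mu.-integrable `[0, T]
    (EFin \o (fun s => L2norm Omega (dw s).1 ^+ 2 + H1semi Omega (dw s) ^+ 2)).
  exact: integrable_add.
apply: eq_integrable i12 => // r; rewrite inE => /Hdw/H1_0_L2 Lr /=.
by rewrite H1semi_sqr// (L2norm_sqr mO Lr.1).
Qed.

(** The weak derivative comes with the measurability of the pairings;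
    integrability follows from Cauchy-Schwarz, z being constant in time. *)
Lemma H1_derivative_integrable w dw z : L2_time_derivative Omega T w dw ->
  L2h Omega z -> mu.-integrable `[0, T] (EFin \o (fun r => H1ip Omega (dw r) z)).
Proof.
move=> dwP Lz; have siH := semi_inner_H1 mO; have [Hdw _ _ wk] := dwP.
have [mz _] := wk z Lz.1 Lz.2.
have ic : mu.-integrable `[0, T] (EFin \o (fun=> H1ip Omega z z)).
  apply: continuous_compact_integrable; first exact: segment_compact.
  by apply: continuous_subspaceT => x; exact: cvg_cst.
have iz : mu.-integrable `[0, T]
    (EFin \o (fun r => H1ip Omega (dw r) (dw r) + H1ip Omega z z)).
  by apply: integrable_add => //; exact: H1_derivative_sqr_integrable dwP.
apply: le_integrable iz => //; first exact/measurable_EFinP.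
move=> r rT; rewrite /= lee_fin.
have Lr : L2h Omega (dw r) by apply: H1_0_L2; exact: Hdw.
have r0 := si_ge0 siH Lr; have z0 := si_ge0 siH Lz.
rewrite [leRHS]ger0_norm; last exact: addr_ge0.
apply: (le_trans (si_CauchySchwarz_sqrt siH Lr Lz)).
rewrite -[in leRHS](sqr_sqrtr r0) -[in leRHS](sqr_sqrtr z0).
move: (sqrtr_ge0 (H1ip Omega (dw r) (dw r))) (sqrtr_ge0 (H1ip Omega z z)).
move: (Num.sqrt _) (Num.sqrt _) => x y x0 y0.
have := sqr_ge0 (x - y); nra.
Qed.

(** The value and gradient parts of the H^1 product, and the product itself, are
    the H^1 product with a projection pi of the second argument, whose pairing
    with the path is given by the weak derivative. *)
Lemma weak_integral_path (B : h1 -> h1 -> R) (pi : h1 -> h1) w dw G :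
  (forall z, L2h Omega z -> L2h Omega (pi z)) ->
  (forall x z, L2h Omega x -> L2h Omega z -> B x z = H1ip Omega x (pi z)) ->
  (forall t : R, t \in `[0, T] -> L2h Omega (w t)) ->
  L2_time_derivative Omega T w dw ->
  mu.-integrable `[0, T] (EFin \o G) ->
  (forall t : R, t \in `[0, T] -> B (dw t) (dw t) <= G t) ->
  integral_path (L2h Omega) B T w dw G.
Proof.
move=> Lpi Bpi Lw dwP iG BG; have [Hdw _ _ wk] := dwP.
have Ldw (t : R) : t \in `[0, T] -> L2h Omega (dw t) by move=> /Hdw/H1_0_L2.
have cL := L2h_lin_closed mO.
split=> // [t tT|z Lz]; first by split; [exact: Lw|exact: Ldw].
have Lz' := Lpi z Lz; split.
  apply: eq_integrable (H1_derivative_integrable dwP Lz') => // r.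
  by rewrite inE => rT /=; rewrite Bpi//; exact: Ldw.
move=> t tT; have oT : 0 \in `[0, T].
  by move: tT; rewrite !in_itv/= lexx => /andP[]; exact: le_trans.
have [_ zE] := wk (pi z) Lz'.1 Lz'.2.
rewrite Bpi//; last by apply: lin_closedB => //; exact: Lw.
rewrite zE//; apply: eq_Rintegral => r; rewrite inE/= => rt.
rewrite Bpi//; apply: Ldw; move: rt tT; rewrite !in_itv/= => /andP[-> rt] /andP[_].
exact: le_trans.
Qed.

Lemma val_integral_path w dw : (forall t : R, t \in `[0, T] -> L2h Omega (w t)) ->
  L2_time_derivative Omega T w dw ->
  integral_path (L2h Omega) (val_form Omega) T w dw
    (fun s => L2norm Omega (dw s).1 ^+ 2).
Proof.
move=> Lw dwP; have [Hdw i1 _ _] := dwP; have [L1 L2] := (L2h_lin_closed mO).1.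
apply: (weak_integral_path (pi := fun z => (z.1, 0))) dwP _ _ => //.
- by move=> z [].
- move=> x z Lx Lz; rewrite /H1ip big1 ?addr0// => i _ /=.
  rewrite (si_sym (semi_inner_ip mO) (Lx.2 i) (L2 i)).
  by rewrite (si_0 (semi_inner_ip mO))//; exact: Lx.2.
- by move=> t /Hdw/H1_0_L2 Lt; rewrite (L2norm_sqr mO)//; exact: Lt.1.
Qed.

Lemma grad_integral_path w dw : (forall t : R, t \in `[0, T] -> L2h Omega (w t)) ->
  L2_time_derivative Omega T w dw ->
  integral_path (L2h Omega) (grad_form Omega) T w dw
    (fun s => H1semi Omega (dw s) ^+ 2).
Proof.
move=> Lw dwP; have [Hdw _ i2 _] := dwP; have [L1 L2] := (L2h_lin_closed mO).1.
apply: (weak_integral_path (pi := fun z => (0, z.2))) dwP _ _ => //.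
- by move=> z [].
- move=> x z Lx Lz; rewrite /H1ip /=.
  rewrite (si_sym (semi_inner_ip mO) Lx.1 L1).
  by rewrite (si_0 (semi_inner_ip mO) Lx.1) add0r.
- by move=> t /Hdw/H1_0_L2 Lt; rewrite H1semi_sqr.
Qed.

Lemma H1_vec_integral_path (w dw : R -> h1v) :
  (forall t : R, t \in `[0, T] -> L2v Omega (w t)) ->
  (forall i, L2_time_derivative Omega T (fun s => w s i) (fun s => dw s i)) ->
  integral_path (L2v Omega) (H1ip_vec Omega) T w dw
    (fun s => H1norm_vec Omega (dw s) ^+ 2).
Proof.
move=> Lw dwP.
have Ldw (t : R) : t \in `[0, T] -> L2v Omega (dw t).
  by move=> tT i; have [H _ _ _] := dwP i; exact/H1_0_L2/H.
have P i : integral_path (L2h Omega) (H1ip Omega) T (fun s => w s i)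
    (fun s => dw s i) (fun s => H1ip Omega (dw s i) (dw s i)).
  apply: (weak_integral_path (pi := id)) (dwP i) _ _ => //.
  - by move=> t /Lw.
  - exact: H1_derivative_sqr_integrable (dwP i).
have iS (F : 'I_d -> R -> R) : (forall i, mu.-integrable `[0, T] (EFin \o F i)) ->
  mu.-integrable `[0, T] (EFin \o (fun r => \sum_i F i r)).
  by move=> iF; apply: (fun mD => (Rintegral_sum (index_enum _) mD iF).1).
split.
- by move=> t tT; split; [exact: Lw|exact: Ldw].
- have iN : mu.-integrable `[0, T]
      (EFin \o (fun r => \sum_i H1ip Omega (dw r i) (dw r i))).
    by apply: iS => i; have [] := P i.
  apply: eq_integrable iN => // r; rewrite inE => rT /=.
  by rewrite H1norm_vec_sqr//; exact: Ldw.
- by move=> t tT; rewrite H1norm_vec_sqr//; exact: Ldw.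
- move=> z Lz.
  have Pz i := let: And4 _ _ _ H := P i in H (z i) (Lz i).
  split; first by apply: iS => i; exact: (Pz i).1.
  move=> t tT; rewrite /primitive /H1ip_vec.
  have sub : [set` `[0, t]] `<=` [set` `[0, T]].
    move=> x /=; move: tT; rewrite !in_itv/= => /andP[_ tT] /andP[-> xt]/=.
    exact: le_trans tT.
  have iz i : mu.-integrable `[0, t] (EFin \o (fun r => H1ip Omega (dw r i) (z i))).
    by apply: integrableS (Pz i).1.
  rewrite (fun mD => (Rintegral_sum (index_enum _) mD iz).2)//.
  by apply: eq_bigr => i _; exact: (Pz i).2.
Qed.

End weak_time_derivatives.

(** * Inequalities between real numbers *)

Ltac nonneg := repeat first
  [ assumption | exact: sqr_ge0 | exact: sqrtr_ge0 | exact: ler0n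
  | apply: addr_ge0 | apply: mulr_ge0 ].

Section scalar_inequalities.
Context {R : realType}.
Implicit Types (D E r s : nat -> R).

(** Multiplied by 2 tau, the step inequalities telescope. At j = 0 the
    predecessor is j itself and the difference of the D disappears, so that
    L tau D 0, needed by the next step, has to be extracted from the term
    tau / beta * D 0: this is the reason for the factor 1 + L beta. *)
Lemma energy_telescope (beta L tau : R) D E r s (N : nat) :
  0 < beta -> 0 <= L -> 0 < tau ->
  (forall j, (j <= N)%N -> 0 <= E j) ->
  (forall j, (j < N)%N -> 0 <= r j) -> (forall j, (j < N)%N -> 0 <= s j) ->
  (forall j, (j < N)%N ->
    D j / (2 * beta) + L / 2 * (D j - D j.-1) + (E j.+1 - E j) / (2 * tau) <=
    beta / 2 * r j + L / 4 * s j) ->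
  forall n, (n < N)%N ->
  tau / beta * \sum_(0 <= j < n.+1) D j + L * tau * D n + E n.+1 <=
  (1 + L * beta) *
    (E 0%N + tau * \sum_(0 <= j < n.+1) (beta * r j + L / 2 * s j)).
Proof.
move=> b0 L0 t0 E0 r0 s0 H.
have H' j : (j < N)%N -> tau / beta * D j + L * tau * (D j - D j.-1) +
    (E j.+1 - E j) <= tau * (beta * r j + L / 2 * s j).
  move=> /H; rewrite -(ler_pM2l (mulr_gt0 (ltr0Sn R 1) t0)).
  congr (_ <= _); first by field; rewrite !gt_eqF.
  by field.
have Lb : 0 <= L * beta by rewrite mulr_ge0// ltW.
elim=> [N0|n IH nN].
  rewrite !big_nat1; have := H' 0%N N0; rewrite /= subrr mulr0 addr0.
  set w := tau * (_ + _) => H0.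
  have := ler_wpM2l (addr_ge0 ler01 Lb) H0.
  have -> : (1 + L * beta) * (tau / beta * D 0%N + (E 1%N - E 0%N)) =
    tau / beta * D 0%N + L * tau * D 0%N + E 1%N - (1 + L * beta) * E 0%N
    + L * beta * E 1%N by field; rewrite gt_eqF.
  by have := mulr_ge0 Lb (E0 1%N N0); lra.
rewrite !(@big_nat_recr _ _ _ n.+1)//=.
have := IH (ltnW nN); have /= := H' n.+1 nN.
set w := tau * (beta * r n.+1 + _); set Y := \sum_(0 <= j < n.+1) (beta * r j + _).
set Dn := \sum_(0 <= _ < _) _ => H1 H2.
have w0 : 0 <= w.
  apply: mulr_ge0; first exact: ltW.
  by apply: addr_ge0; apply: mulr_ge0; rewrite ?r0 ?s0 ?divr_ge0// ltW.
have -> : tau * (Y + (beta * r n.+1 + L / 2 * s n.+1)) = tau * Y + w.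
  by rewrite mulrDr.
have := mulr_ge0 Lb w0; lra.
Qed.

(** Two consecutive windows overlap in one step, so that the sum telescopes to
    two boundary terms. *)
Lemma sum_windows_le (F : nat -> R) n : F 0%N = 0 ->
  (forall j, (j < n)%N -> F j <= F j.+1) ->
  \sum_(0 <= j < n) (F j.+1 - F j.-1) <= 2 * F n.
Proof.
move=> F0 mF.
have -> : \sum_(0 <= j < n) (F j.+1 - F j.-1) = F n + F n.-1.
  elim: n {mF} => [|n IH]; first by rewrite big_nil F0 addr0.
  rewrite big_nat_recr//= IH; lra.
case: n mF => [|n] mF /=; first by rewrite F0; lra.
by have := mF n (ltnSn n); lra.
Qed.

Lemma sqrD_le2 (x y : R) : (x + y) ^+ 2 <= 2 * (x ^+ 2 + y ^+ 2).
Proof.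
rewrite -subr_ge0 (_ : _ - _ = (x - y) ^+ 2); first exact: sqr_ge0.
by ring.
Qed.

Lemma sqr_le_mul (x y : R) : 0 <= x -> 0 <= y -> y ^+ 2 <= x * y -> y <= x.
Proof.
move=> x0; rewrite le_eqVlt => /predU1P[<-//|y0].
by rewrite expr2 ler_pM2r.
Qed.

(** The arithmetic of the bound of a residual with three terms; the factor 4
    is that of a difference of two quotients close to the same derivative. *)
Lemma weighted_sum_le (k1 k2 k3 v1 v2 v3 x y : R) :
  v1 <= x -> v2 <= 4 * x -> v3 <= y ->
  2 * (k1 ^+ 2 * v1) + 2 * (2 * (k2 ^+ 2 * v2) + 2 * (k3 ^+ 2 * v3)) <=
  (2 * k1 ^+ 2 + 16 * k2 ^+ 2) * x + 4 * k3 ^+ 2 * y.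
Proof.
move=> /(ler_wpM2l (sqr_ge0 k1)) v1x /(ler_wpM2l (sqr_ge0 k2)) v2x.
by move=> /(ler_wpM2l (sqr_ge0 k3)); lra.
Qed.

Lemma sum_sqr_le (x : nat -> R) n :
  (\sum_(0 <= j < n) x j) ^+ 2 <= n%:R * \sum_(0 <= j < n) x j ^+ 2.
Proof.
elim: n => [|n IH]; first by rewrite !big_nil mul0r expr0n.
rewrite !big_nat_recr//=.
set y := \sum_(0 <= i < n) x i in IH *; set z := \sum_(0 <= i < n) x i ^+ 2 in IH *.
have [n0|n0] := posnP n.
  by rewrite /y /z n0 !big_nil !add0r mul1r.
have n0' : 0 < n%:R :> R by rewrite ltr0n.
have : 0 <= (y - n%:R * x n) ^+ 2 / n%:R by rewrite divr_ge0// ?sqr_ge0// ltW.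
have -> : (y - n%:R * x n) ^+ 2 / n%:R = y ^+ 2 / n%:R - 2 * y * x n + n%:R * x n ^+ 2.
  by field; rewrite gt_eqF.
have yz : y ^+ 2 / n%:R <= z by rewrite ler_pdivrMr// mulrC.
have -> : n.+1%:R * (z + x n ^+ 2) = n%:R * z + z + n%:R * x n ^+ 2 + x n ^+ 2.
  by rewrite -[n.+1%:R]natr1; ring.
have -> : (y + x n) ^+ 2 = y ^+ 2 + 2 * y * x n + x n ^+ 2 by ring.
lra.
Qed.

(** Summation over the steps of the consistency bounds: w1 to w5 are meant to be
    windows and W1 to W5 the corresponding integrals, while e and e' compare
    the divergence with the H^1 and the energy norm. *)
Lemma sum_data_le (r s w1 w2 w3 w4 w5 k : nat -> R) (n : nat)
    (beta L tau A B C e e' W1 W2 W3 W4 W5 : R) :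
  0 <= beta -> 0 <= L -> 0 < tau -> 0 <= A -> 0 <= B -> 0 <= C ->
  0 <= e -> 0 <= e' ->
  (forall j, (j < n)%N -> r j <= A * (4 * tau * w1 j + 2 * (tau^-1 * w2 j)) +
     B * (4 * e * tau * w3 j + e' * (tau^-1 * w4 j))) ->
  (forall j, (j < n)%N -> s j <= C * (4 * tau * w5 j + 2 * k j)) ->
  \sum_(0 <= j < n) w1 j <= 2 * W1 -> \sum_(0 <= j < n) w2 j <= 2 * W2 ->
  \sum_(0 <= j < n) w3 j <= 2 * W3 -> \sum_(0 <= j < n) w4 j <= 2 * W4 ->
  \sum_(0 <= j < n) w5 j <= 2 * W5 ->
  tau * \sum_(0 <= j < n) (beta * r j + L / 2 * s j) <=
  beta * (A * (8 * tau ^+ 2 * W1 + 4 * W2) +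
          B * (8 * e * tau ^+ 2 * W3 + 2 * e' * W4)) +
  L / 2 * (C * (8 * tau ^+ 2 * W5 + 2 * (tau * \sum_(0 <= j < n) k j))).
Proof.
move=> b0 L0 t0 A0 B0 C0 e0 e'0 rH sH H1 H2 H3 H4 H5.
have -> : tau * \sum_(0 <= j < n) (beta * r j + L / 2 * s j) =
    beta * (tau * \sum_(0 <= j < n) r j) +
    L / 2 * (tau * \sum_(0 <= j < n) s j).
  by rewrite big_split/= -!mulr_sumr; ring.
have scale (x y z : R) : 0 <= z -> x <= 2 * y -> z * x <= z * (2 * y).
  by move=> z0 xy; rewrite ler_wpM2l.
have t1 := ltW t0; have tV0 : 0 <= tau^-1 by rewrite invr_ge0.
have tVt : tau * tau^-1 = 1 by rewrite divff// gt_eqF.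
apply: lerD; (apply: ler_wpM2l; first by rewrite ?divr_ge0).
  have Hr : \sum_(0 <= j < n) r j <=
      A * (4 * tau * \sum_(0 <= j < n) w1 j +
           2 * (tau^-1 * \sum_(0 <= j < n) w2 j)) +
      B * (4 * e * tau * \sum_(0 <= j < n) w3 j +
           e' * (tau^-1 * \sum_(0 <= j < n) w4 j)).
    rewrite !mulr_sumr -!big_split/= !mulr_sumr -big_split/=.
    by apply: ler_sum_nat => j /andP[_ jn]; exact: rH.
  apply: (le_trans (ler_wpM2l t1 Hr)).
  rewrite mulrDr; apply: lerD.
    rewrite mulrCA ler_wpM2l// mulrDr; apply: lerD.
      rewrite (_ : 8 * tau ^+ 2 * W1 = tau * (4 * tau * (2 * W1))); last by ring.
      by rewrite ler_wpM2l// ler_wpM2l// mulr_ge0.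
    rewrite (_ : 4 * W2 = tau * (2 * (tau^-1 * (2 * W2)))); last first.
      by rewrite mulrCA (mulrA tau) tVt mul1r; ring.
    by rewrite ler_wpM2l// ler_wpM2l// ler_wpM2l.
  rewrite mulrCA ler_wpM2l// mulrDr; apply: lerD.
    rewrite (_ : 8 * e * tau ^+ 2 * W3 = tau * (4 * e * tau * (2 * W3))); last by ring.
    by rewrite ler_wpM2l// ler_wpM2l// !mulr_ge0.
  rewrite (_ : 2 * e' * W4 = tau * (e' * (tau^-1 * (2 * W4)))); last first.
    by rewrite mulrCA (mulrA tau) tVt mul1r; ring.
  by rewrite ler_wpM2l// ler_wpM2l// ler_wpM2l.
have Hs : \sum_(0 <= j < n) s j <= C * (4 * tau * \sum_(0 <= j < n) w5 j +
    2 * \sum_(0 <= j < n) k j).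
  rewrite !mulr_sumr -!big_split/= mulr_sumr.
  by apply: ler_sum_nat => j /andP[_ jn]; exact: sH.
apply: (le_trans (ler_wpM2l t1 Hs)); rewrite mulrCA ler_wpM2l//.
rewrite mulrDr; apply: lerD; last by rewrite mulrCA.
rewrite (_ : 8 * tau ^+ 2 * W5 = tau * (4 * tau * (2 * W5))); last by ring.
by rewrite ler_wpM2l// ler_wpM2l// mulr_ge0.
Qed.

Lemma sqrtD_le (x y : R) : 0 <= x -> 0 <= y ->
  Num.sqrt (x + y) <= Num.sqrt x + Num.sqrt y.
Proof.
move=> x0 y0; have sx := sqrtr_ge0 x; have sy := sqrtr_ge0 y.
rewrite -(ger0_norm (addr_ge0 sx sy)) -sqrtr_sqr; apply: ler_wsqrtr.
rewrite sqrrD !sqr_sqrtr// addrAC lerDl.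
by rewrite mulrn_wge0// mulr_ge0.
Qed.

(** Sum of the coefficients with which the six terms of the error bound
    enter the consistency error, once h is replaced by its bound Dh. *)
Definition consistency_const (beta kp ku l i c Dh e e' : R) : R :=
  8 * beta * kp + 4 * beta * kp * c ^+ 2 * Dh ^+ 2 + 8 * beta * ku * e +
  4 * beta * ku * e' * c ^+ 2 + 8 * l * i + 2 * l * i.

Lemma consistency_const_ge0 (beta kp ku l i c Dh e e' : R) :
  0 <= beta -> 0 <= kp -> 0 <= ku -> 0 <= l -> 0 <= i -> 0 <= e -> 0 <= e' ->
  0 <= consistency_const beta kp ku l i c Dh e e'.
Proof.
move=> b0 kp0 ku0 l0 i0 e0 e'0; rewrite /consistency_const.
have c2 := sqr_ge0 c; have D2 := sqr_ge0 Dh.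
by nonneg.
Qed.

Lemma sum_mul_le (a1 a2 a3 a4 a5 a6 y1 y2 y3 y4 y5 y6 : R) :
  0 <= a1 -> 0 <= a2 -> 0 <= a3 -> 0 <= a4 -> 0 <= a5 -> 0 <= a6 ->
  0 <= y1 -> 0 <= y2 -> 0 <= y3 -> 0 <= y4 -> 0 <= y5 -> 0 <= y6 ->
  a1 * y1 + a2 * y2 + a3 * y3 + a4 * y4 + a5 * y5 + a6 * y6 <=
  (a1 + a2 + a3 + a4 + a5 + a6) * (y1 + y2 + y3 + y4 + y5 + y6).
Proof.
move=> *; rewrite !(mulrDl _ _ (y1 + y2 + y3 + y4 + y5 + y6)).
do 5?[apply: lerD]; apply: ler_wpM2l => //; rewrite -subr_ge0.
- by rewrite (_ : _ - _ = y2 + y3 + y4 + y5 + y6); [nonneg|ring].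
- by rewrite (_ : _ - _ = y1 + y3 + y4 + y5 + y6); [nonneg|ring].
- by rewrite (_ : _ - _ = y1 + y2 + y4 + y5 + y6); [nonneg|ring].
- by rewrite (_ : _ - _ = y1 + y2 + y3 + y5 + y6); [nonneg|ring].
- by rewrite (_ : _ - _ = y1 + y2 + y3 + y4 + y6); [nonneg|ring].
- by rewrite (_ : _ - _ = y1 + y2 + y3 + y4 + y5); [nonneg|ring].
Qed.

(** The square root of a sum of squares is at most the sum; the factors tau and
    h of the final bound are produced here, and of h ^+ 4 one square is
    absorbed in the constant. *)
Lemma sqrt_consistency_le (beta kp ku l i c Dh e e' h tau : R)
    (F1 F2 F3 F4 F5 F6 G1 G2 G3 G4 G5 G6 : R) :
  0 <= beta -> 0 <= kp -> 0 <= ku -> 0 <= l -> 0 <= i -> 0 <= e -> 0 <= e' ->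
  0 <= h -> h <= Dh -> 0 <= tau ->
  0 <= F1 -> 0 <= F2 -> 0 <= F3 -> 0 <= F4 -> 0 <= F5 -> 0 <= F6 ->
  F1 <= G1 -> F2 <= G2 -> F3 <= G3 -> F4 <= G4 -> F5 <= G5 -> F6 <= G6 ->
  Num.sqrt (beta * (kp * (8 * tau ^+ 2 * F1 + 4 * ((c * h ^+ 2) ^+ 2 * F2)) +
    ku * (8 * e * tau ^+ 2 * F3 + 2 * e' * (2 * (c * h) ^+ 2 * F4))) +
    l * (i * h ^+ 2 * (8 * tau ^+ 2 * F5 + 2 * F6))) <=
  Num.sqrt (consistency_const beta kp ku l i c Dh e e') *
  (tau * (Num.sqrt G1 + Num.sqrt G3) +
   h * (Num.sqrt G2 + Num.sqrt G4 + Num.sqrt G6 + tau * Num.sqrt G5)).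
Proof.
move=> b0 kp0 ku0 l0 i0 e0 e'0 h0 hD t0 F10 F20 F30 F40 F50 F60 H1 H2 H3 H4 H5 H6.
have K0 : 0 <= consistency_const beta kp ku l i c Dh e e'.
  exact: consistency_const_ge0.
have c2 := sqr_ge0 c; have D2 := sqr_ge0 Dh; have h2 := sqr_ge0 h.
have hh : h ^+ 2 <= Dh ^+ 2 by rewrite lerXn2r ?nnegrE// (le_trans h0).
have G10 := le_trans F10 H1; have G20 := le_trans F20 H2.
have G30 := le_trans F30 H3; have G40 := le_trans F40 H4.
have G50 := le_trans F50 H5; have G60 := le_trans F60 H6.
pose Y := (tau * Num.sqrt G1) ^+ 2 + (h * Num.sqrt G2) ^+ 2 +
  (tau * Num.sqrt G3) ^+ 2 + (h * Num.sqrt G4) ^+ 2 +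
  (h * (tau * Num.sqrt G5)) ^+ 2 + (h * Num.sqrt G6) ^+ 2.
set W := tau * (_ + _) + _.
have YW : Y <= W ^+ 2.
  have S2 (x y : R) : 0 <= x -> 0 <= y -> x ^+ 2 + y ^+ 2 <= (x + y) ^+ 2.
    by move=> x0 y0; rewrite sqrrD addrAC lerDl mulrn_wge0// mulr_ge0.
  have W0 : [/\ 0 <= tau * Num.sqrt G1, 0 <= h * Num.sqrt G2, 0 <= tau * Num.sqrt G3,
      0 <= h * Num.sqrt G4 & 0 <= h * (tau * Num.sqrt G5) /\ 0 <= h * Num.sqrt G6].
    by split; [..|split]; nonneg.
  have [w1 w2 w3 w4 [w5 w6]] := W0; rewrite /Y.
  have -> : W = tau * Num.sqrt G1 + h * Num.sqrt G2 + tau * Num.sqrt G3 +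
      h * Num.sqrt G4 + h * (tau * Num.sqrt G5) + h * Num.sqrt G6.
    by rewrite /W; ring.
  by do 5!(apply: le_trans (S2 _ _ _ _); [|by nonneg|by nonneg]; rewrite ?lerD2r).
have W0 : 0 <= W by rewrite /W; nonneg.
rewrite -[W in leRHS]ger0_norm// -sqrtr_sqr -sqrtrM//; apply: ler_wsqrtr.
apply: (le_trans _ (ler_wpM2l K0 YW)).
rewrite /Y !exprMn !sqr_sqrtr//.
have h4 : h ^+ 2 * (h ^+ 2 * F2) <= Dh ^+ 2 * (h ^+ 2 * G2).
  apply: ler_pM => //; first exact: mulr_ge0.
  exact: ler_wpM2l.
have t2 := sqr_ge0 tau.
have T1 := ler_wpM2l t2 H1; have T3 := ler_wpM2l t2 H3.
have T4 := ler_wpM2l h2 H4; have T6 := ler_wpM2l h2 H6.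
have T5 := ler_wpM2l h2 (ler_wpM2l t2 H5).
set y1 := tau ^+ 2 * G1; set y2 := h ^+ 2 * G2; set y3 := tau ^+ 2 * G3.
set y4 := h ^+ 2 * G4; set y5 := h ^+ 2 * (tau ^+ 2 * G5); set y6 := h ^+ 2 * G6.
have [y10 y20 y30 y40 [y50 y60]] : [/\ 0 <= y1, 0 <= y2, 0 <= y3, 0 <= y4 &
    0 <= y5 /\ 0 <= y6].
  by split; [..|split]; nonneg.
rewrite -/y1 -/y2 -/y3 -/y4 -/y5 -/y6 in h4 T1 T3 T4 T5 T6 *.
have bk := mulr_ge0 b0 kp0; have bu := mulr_ge0 b0 ku0; have li := mulr_ge0 l0 i0.
apply: (@le_trans _ _ (8 * beta * kp * y1 + 4 * beta * kp * c ^+ 2 * Dh ^+ 2 * y2 +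
   8 * beta * ku * e * y3 + 4 * beta * ku * e' * c ^+ 2 * y4 + 8 * l * i * y5 +
   2 * l * i * y6)).
  have R1 := ler_wpM2l bk T1; have R2 := ler_wpM2l (mulr_ge0 bk c2) h4.
  have R3 := ler_wpM2l (mulr_ge0 bu e0) T3.
  have R4 := ler_wpM2l (mulr_ge0 (mulr_ge0 bu e'0) c2) T4.
  have R5 := ler_wpM2l li T5; have R6 := ler_wpM2l li T6.
  by move: y1 y2 y3 y4 y5 y6 R1 R2 R3 R4 R5 R6 {h4 T1 T3 T4 T5 T6 YW Y y10 y20 y30 y40 y50 y60} => *; lra.
have A1 : 0 <= 8 * beta * kp by nonneg.
have A2 : 0 <= 4 * beta * kp * c ^+ 2 * Dh ^+ 2 by nonneg.
have A3 : 0 <= 8 * beta * ku * e by nonneg.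
have A4 : 0 <= 4 * beta * ku * e' * c ^+ 2 by nonneg.
have A5 : 0 <= 8 * l * i by nonneg.
have A6 : 0 <= 2 * l * i by nonneg.
exact: sum_mul_le.
Qed.

(** The order of the estimates: initial discrete displacement and pressure
    (tu0, e0), initial pressure in the L^2 norm (q0), final pressure in both
    norms (en, qn), final displacement (un). At most three of these bounds are
    composed, hence the power 3. *)
Lemma error_assembly (A x y m0 mn W tu0 e0 q0 en qn un Eu Ep Eq : R) :
  1 <= A -> 0 <= x -> 0 <= y -> 0 <= m0 -> 0 <= mn -> 0 <= W ->
  tu0 <= x + A * m0 -> e0 <= y + A * m0 -> q0 <= A * (tu0 + e0) ->
  en <= A * (e0 + W) -> qn <= q0 + A * (e0 + W) -> un <= A * qn ->
  Eu <= A * mn + un -> Ep <= A * mn + en -> Eq <= A * mn + qn ->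
  Eu + Ep + Eq <= 7 * A ^+ 3 * (x + y + m0 + mn + W).
Proof.
move=> A1 x0 y0 m00 mn0 W0 tu e q en' qn' un' Eu' Ep' Eq'.
have A0 : 0 <= A by exact: le_trans A1.
have A12 : A <= A ^+ 2 by rewrite expr2 ler_peMl.
have A23 : A ^+ 2 <= A ^+ 3 by rewrite exprS ler_peMl ?sqr_ge0.
have A20 := sqr_ge0 A.
have q' : q0 <= A * (x + y + 2 * A * m0).
  by apply: (le_trans q); rewrite ler_wpM2l//; lra.
have eW : A * (e0 + W) <= A * (y + A * m0 + W) by rewrite ler_wpM2l//; lra.
have qn2 : qn <= A * x + 2 * A * y + 3 * A ^+ 2 * m0 + A * W.
  apply: (le_trans qn'); apply: (le_trans (lerD q' eW)).
  by rewrite le_eqVlt; apply/orP; left; apply/eqP; ring.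
have un2 : un <= A ^+ 2 * x + 2 * A ^+ 2 * y + 3 * A ^+ 3 * m0 + A ^+ 2 * W.
  apply: (le_trans un'); apply: (le_trans (ler_wpM2l A0 qn2)).
  by rewrite le_eqVlt; apply/orP; left; apply/eqP; ring.
have en2 : en <= A * y + A ^+ 2 * m0 + A * W.
  apply: (le_trans en'); apply: (le_trans eW).
  by rewrite le_eqVlt; apply/orP; left; apply/eqP; ring.
have A13 := le_trans A12 A23.
have [X1 X2] := (ler_wpM2r x0 A13, ler_wpM2r x0 A23).
have [Y1 Y2] := (ler_wpM2r y0 A13, ler_wpM2r y0 A23).
have M2 := ler_wpM2r m00 A23; have N1 := ler_wpM2r mn0 A13.
have [W1 W2] := (ler_wpM2r W0 A13, ler_wpM2r W0 A23).
have A30 : 0 <= A ^+ 3 by exact: exprn_ge0.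
have X0 := mulr_ge0 A30 x0; have Y0 := mulr_ge0 A30 y0.
have M0 := mulr_ge0 A30 m00; have N0 := mulr_ge0 A30 mn0.
have V0 := mulr_ge0 A30 W0.
lra.
Qed.

(** The same chain with explicit constants, all of them at most A. The factor h
    in front of the gradient g in the inf-sup bound, and one factor of the h^2
    in the L^2 projection error, are absorbed by means of h <= Dh. *)
Lemma error_bound_arith (c h Dh k sK a1 a3 a4 a5 cc A x y U0 P0 Un Pn : R)
    (ru0 rp0 tu e g q0 S En Qn Vn EU EP EQ ru rp rq tau w1 w2 : R) :
  0 <= c -> 0 <= h -> h <= Dh -> 0 <= k -> 0 < sK ->
  0 <= a1 -> 0 <= a3 -> 0 <= a4 -> 0 <= a5 -> 0 <= cc ->
  1 <= A -> c <= A -> c * Dh <= A -> a1 <= A -> k * Dh / sK <= A -> a3 <= A ->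
  a4 <= A -> a4 * cc <= A -> a5 <= A -> a5 * cc <= A ->
  0 <= x -> 0 <= y -> 0 <= U0 -> 0 <= P0 -> 0 <= Un -> 0 <= Pn ->
  0 <= tu -> 0 <= g -> 0 <= tau -> 0 <= w1 -> 0 <= w2 ->
  tu <= x + ru0 -> ru0 <= c * h * (U0 + P0) ->
  e <= y + rp0 -> rp0 <= c * h * P0 ->
  q0 <= a1 * tu + k * h * g -> e = sK * g ->
  En <= a4 * (e + S) -> Qn <= q0 + a5 * (e + S) -> Vn <= a3 * Qn ->
  S <= cc * (tau * w1 + h * w2) ->
  EU <= ru + Vn -> ru <= c * h * (Un + Pn) ->
  EP <= rp + En -> rp <= c * h * Pn ->
  EQ <= rq + Qn -> rq <= c * h ^+ 2 * Pn ->
  0 <= Qn ->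
  EU + EP + EQ <= 7 * A ^+ 3 * (x + y) + 7 * A ^+ 3 * h * (U0 + P0 + Un + Pn) +
    7 * A ^+ 3 * tau * w1 + 7 * A ^+ 3 * h * w2.
Proof.
move=> c0 h0 hD k0 sK0 a10 a30 a40 a50 cc0 A1 Ac AcD Aa1 Ak Aa3 Aa4 Aa4c Aa5 Aa5c.
move=> x0 y0 U00 P00 Un0 Pn0 tu0 g0 t0 w10 w20.
move=> Htu Hru0 He Hrp0 Hq Eg HEn HQn HVn HS HEU Hru HEP Hrp HEQ Hrq Qn0.
have A0 : 0 <= A by exact: le_trans A1.
have e0 : 0 <= e by rewrite Eg mulr_ge0// ltW.
pose W := tau * w1 + h * w2; have W0 : 0 <= W by rewrite /W; nonneg.
pose m0 := h * (U0 + P0); pose mn := h * (Un + Pn).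
have m00 : 0 <= m0 by rewrite /m0; nonneg.
have mn0 : 0 <= mn by rewrite /mn; nonneg.
have -> : 7 * A ^+ 3 * (x + y) + 7 * A ^+ 3 * h * (U0 + P0 + Un + Pn) +
    7 * A ^+ 3 * tau * w1 + 7 * A ^+ 3 * h * w2 =
    7 * A ^+ 3 * (x + y + m0 + mn + W) by rewrite /m0 /mn /W; ring.
have cA z : 0 <= z -> c * z <= A * z by move=> z0; exact: ler_wpM2r.
have hP0 : h * P0 <= m0 by rewrite /m0 ler_wpM2l// lerDr.
have hPn : h * Pn <= mn by rewrite /mn ler_wpM2l// lerDr.
have S' a : 0 <= a -> a <= A -> a * cc <= A -> a * (e + S) <= A * (e + W).
  move=> a0 aA acA; rewrite (mulrDr a) (mulrDr A e W).
  apply: lerD; first exact: ler_wpM2r.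
  apply: (le_trans (ler_wpM2l a0 HS)).
  by rewrite mulrA ler_wpM2r.
apply: (error_assembly (tu0 := tu) (e0 := e) (q0 := q0) (en := En) (qn := Qn)
  (un := Vn) A1 x0 y0 m00 mn0 W0).
- apply: (le_trans Htu); rewrite lerD2l; apply: (le_trans Hru0).
  by rewrite -mulrA; exact: cA.
- apply: (le_trans He); rewrite lerD2l; apply: (le_trans Hrp0).
  rewrite -mulrA; apply: (le_trans (ler_wpM2l c0 hP0)); exact: cA.
- apply: (le_trans Hq); rewrite mulrDr; apply: lerD; first exact: ler_wpM2r.
  rewrite Eg mulrA ler_wpM2r//; apply: (@le_trans _ _ (k * Dh)).
    exact: ler_wpM2l.
  by rewrite -ler_pdivrMr.
- by apply: (le_trans HEn); exact: S'.
- by apply: (le_trans HQn); rewrite lerD2l; exact: S'.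
- by apply: (le_trans HVn); exact: ler_wpM2r.
- apply: (le_trans HEU); rewrite lerD2r; apply: (le_trans Hru).
  by rewrite -mulrA; exact: cA.
- apply: (le_trans HEP); rewrite lerD2r; apply: (le_trans Hrp).
  rewrite -mulrA; apply: (le_trans (ler_wpM2l c0 hPn)); exact: cA.
- apply: (le_trans HEQ); rewrite lerD2r; apply: (le_trans Hrq).
  have -> : c * h ^+ 2 * Pn = c * h * (h * Pn) by ring.
  apply: ler_pM => //; first exact: mulr_ge0.
    exact: mulr_ge0.
  by apply: le_trans AcD; exact: ler_wpM2l.
Qed.

End scalar_inequalities.

(** * The energy balance of one time step *)

Section energy_step.
Context {R : realType} {d : nat} {Omega : set 'rV[R]_d} {b : R}.
Hypothesis mO : measurable Omega.
Hypothesis Ob : Omega `<=` @cube R d b.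
Hypothesis d0 : (0 < d)%N.
Context {lambda mu alpha K : R}.
Hypotheses (l0 : 0 < lambda) (m0 : 0 < mu) (a0 : 0 < alpha) (K0 : 0 < K).
Context {M : mesh R d}.
Local Notation a := (a_form Omega lambda mu).
Local Notation bf := (b_form Omega K).
Local Notation vf := (val_form Omega).
Local Notation zf := (@Z_form R d Omega M).
Local Notation gam := (lambda + 2 * mu / d%:R).
Local Notation h1 := (h1fun R d).
Local Notation h1v := (h1vec R d).

Lemma gam_gt0 : 0 < gam.
Proof. by rewrite ltr_pwDl// divr_ge0// mulr_ge0// ltW. Qed.

(** Momentum balance without load. The differences between the projection and
    the discrete solution satisfy it at every time, and so do their
    quotients. *)
Definition equilibrium (th : h1v) (q : h1) : Prop := forall v, V_h M Omega v ->
  a th v = alpha * ip Omega q.1 (divergence v).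

Lemma equilibriumB k th th' q q' : V_h M Omega th -> V_h M Omega th' ->
  Q_h M Omega q -> Q_h M Omega q' ->
  equilibrium th q -> equilibrium th' q' ->
  equilibrium (k *: (th - th')) (k *: (q - q')).
Proof.
move=> Vt Vt' Qq Qq' e e' v Vv; have sia := semi_inner_a mO (ltW l0) (ltW m0).
have [Lt Lt' Lv] := And3 (V_h_L2 Vt) (V_h_L2 Vt') (V_h_L2 Vv).
have [[Lq _] [Lq' _]] := (Q_h_L2 Qq, Q_h_L2 Qq').
have Ld := divergence_L2 mO Lv.
have sii := semi_inner_ip mO; have cL := L2fun_lin_closed mO.
have LB : L2v Omega (th - th') by exact: (lin_closedB (L2v_lin_closed mO)).
have Lq'' : L2fun Omega (q.1 - q'.1) by exact: (lin_closedB cL).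
rewrite (si_Z sia)// (si_B sia)// e// e'//.
change (k * (alpha * ip Omega q.1 (divergence v) -
  alpha * ip Omega q'.1 (divergence v)) =
  alpha * ip Omega (k *: (q.1 - q'.1)) (divergence v)).
by rewrite (si_Z sii)// (si_B sii)//; ring.
Qed.

(** Test with th: a th th = alpha (q, div th), and the divergence is controlled
    by the energy itself. *)
Lemma equilibrium_stable th q : V_h M Omega th -> Q_h M Omega q ->
  equilibrium th q -> a th th <= alpha ^+ 2 / gam * vf q q.
Proof.
move=> Vt Qq e; have sia := semi_inner_a mO (ltW l0) (ltW m0).
have Lt := V_h_L2 Vt; have [Lq _] := Q_h_L2 Qq; have Ld := divergence_L2 mO Lt.
have sii := semi_inner_ip mO; have g0 := gam_gt0.
have A0 := si_ge0 sia Lt; have := a_form_coercive_div mO lambda d0 (ltW m0) Lt.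
have := si_CauchySchwarz sii Lq Ld; rewrite -/(vf q q) -/(div_form Omega th th).
have := e th Vt; have := si_ge0 sii Ld; rewrite -/(div_form Omega th th).
have := si_ge0 sii Lq; rewrite -/(vf q q).
move: (a th th) (vf q q) (div_form Omega th th) (ip _ _ _) A0 =>
  A P D J A0 P0 D0 AE CS coer.
have [A0'|A0'] := eqVneq A 0.
  by rewrite A0' mulr_ge0// divr_ge0// ?sqr_ge0// ltW.
have {A0'} {}A0 : 0 < A by rewrite lt_neqAle eq_sym A0'.
rewrite mulrAC ler_pdivlMr// -(ler_pM2l A0).
have -> : A * (A * gam) = gam * (alpha ^+ 2 * J ^+ 2) by rewrite AE; ring.
apply: (@le_trans _ _ (alpha ^+ 2 * P * (gam * D))).
  have -> : alpha ^+ 2 * P * (gam * D) = gam * (alpha ^+ 2 * (P * D)) by ring.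
  by rewrite ler_wpM2l ?(ltW g0)// ler_wpM2l ?sqr_ge0.
by rewrite mulrC ler_wpM2r// mulr_ge0// sqr_ge0.
Qed.

(** The heart of the stability proof; q and q' are the quotients of the pressure
    in the current and the previous step, th and th' those of the
    displacement. By equilibrium the lagged coupling term is a th th', which
    exceeds minus one half of the energy of th - th'. That energy is at most
    L ||q - q'||^2, and the term L (q - q', q) of the scheme contains one half of
    L ||q - q'||^2: this is where the size of L is used. *)
Lemma energy_step (beta L tau C1 C2 : R) (th th' : h1v) (p q q' P : h1)
    (r : 'rV[R]_d -> R^o) :
  0 < beta -> 0 < tau -> alpha ^+ 2 / gam <= L -> 0 < C2 ->
  Z_norm_equivalence M Omega C1 C2 ->
  V_h M Omega th -> V_h M Omega th' -> Q_h M Omega q -> Q_h M Omega q' ->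
  Q_h M Omega p -> Q_h M Omega P -> L2fun Omega r ->
  equilibrium th q -> equilibrium th' q' ->
  beta^-1 * vf q q + L * zf q q + L * vf (q - q') q
    + alpha * ip Omega (divergence th') q.1 + bf (p + tau *: q) q =
  ip Omega r q.1 + L * zf P q ->
  vf q q / (2 * beta) + L / 2 * (vf q q - vf q' q') +
    (bf (p + tau *: q) (p + tau *: q) - bf p p) / (2 * tau) <=
  beta / 2 * ip Omega r r + L / 4 * zf P P.
Proof.
move=> b0 t0 aL C20 Zeq Vt Vt' Qq Qq' Qp QP Lr e e' E.
have sia := semi_inner_a mO (ltW l0) (ltW m0).
have sib := semi_inner_b mO (ltW K0).
have siv := semi_inner_val mO.
have siZ := semi_inner_Z mO Ob C20 Zeq.
have sii := semi_inner_ip mO; have g0 := gam_gt0.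
have cQ := @Q_h_lin_closed R d Omega b mO Ob M.
have cV := @V_h_lin_closed R d Omega b mO Ob M.
have [Lt Lt' Lq Lq' Lp] := And5 (V_h_L2 Vt) (V_h_L2 Vt') (Q_h_L2 Qq) (Q_h_L2 Qq')
  (Q_h_L2 Qp).
have L0 : 0 <= L by apply: le_trans aL; rewrite divr_ge0 ?sqr_ge0// ltW.
(* the equilibrium of th, tested with th', removes the divergence from the
   coupling term *)
have aE : alpha * ip Omega (divergence th') q.1 = a th th'.
  by rewrite e// (si_sym sii)//; [exact: divergence_L2|exact: Lq.1].
have aD : a (th - th') (th - th') <= L * vf (q - q') (q - q').
  have Qqq : Q_h M Omega (q - q') by exact: lin_closedB.
  have := equilibriumB 1 Vt Vt' Qq Qq' e e'; rewrite !scale1r.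
  move=> /(equilibrium_stable (lin_closedB cV Vt Vt') Qqq) H.
  apply: (le_trans H); apply: ler_wpM2r => //; apply: (si_ge0 siv).
  exact: (Q_h_L2 Qqq).
rewrite (si_sqrB sia)// (si_sqrB siv)// in aD.
have at0 := si_ge0 sia Lt; have at0' := si_ge0 sia Lt'.
have vE : vf (q - q') q = vf q q - vf q q'.
  by rewrite (si_B siv)// (si_sym siv Lq').
(* convexity of the quadratic form bf along the step *)
have Ltq : L2h Omega (tau *: q) by exact: (lin_closedZ _ (L2h_lin_closed mO)).
have bE : (bf (p + tau *: q) (p + tau *: q) - bf p p) / (2 * tau) <=
    bf (p + tau *: q) q.
  rewrite (si_sqrD sib)// (si_sqrZ sib)// (si_D sib)// (si_Z sib)// (si_Zr sib)//.
  have := si_ge0 sib Lq => q0.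
  rewrite ler_pdivrMr ?mulr_gt0//.
  have := mulr_ge0 (sqr_ge0 tau) q0; nra.
(* the weights leave half of the mass term, and the whole of L zf q q is
   spent on the lumping error *)
have rq : ip Omega r q.1 <= beta / 2 * ip Omega r r + vf q q / (2 * beta).
  apply: weighted_young => //; [exact: (si_ge0 sii)|exact: (si_ge0 siv)|].
  by apply: (si_CauchySchwarz sii) => //; exact: Lq.1.
have Zq : zf P q <= zf P P / 4 + zf q q.
  have := weighted_young (x := zf P q) (k := 2^-1)
    _ (si_ge0 siZ QP) (si_ge0 siZ Qq) (si_CauchySchwarz siZ QP Qq).
  rewrite invr_gt0 ltr0n => /(_ isT) /le_trans; apply.
  by rewrite le_eqVlt; apply/orP; left; apply/eqP; field.
have := ler_wpM2l L0 Zq.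
have Pb : beta^-1 * vf q q = 2 * (vf q q / (2 * beta)) by field; rewrite gt_eqF.
rewrite Pb aE vE in E.
move: E aD bE rq at0 at0' => + + + + + + /=.
move: {Pb Zq vE} (vf q q / (2 * beta)) (bf (p + tau *: q) q) => vb bq.
move: ((bf _ _ - _) / (2 * tau)) (zf P q) (zf P P) (zf q q) => dE ZPq ZP Zq.
move: (vf q q) (vf q q') (vf q' q') (a th th') {aE} => v1 v2 v3 a2.
move: (a th th) (a th' th') (ip Omega r q.1) (ip Omega r r) => a1 a3 r1 r2.
lra.
Qed.

End energy_step.

(** * Weak inf-sup bound and time grid *)

Section inf_sup.
Context {R : realType} {d : nat} {Omega : set 'rV[R]_d}.
Hypothesis mO : measurable Omega.
Context {lambda mu alpha eta eps : R} {M : mesh R d}.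
Hypotheses (l0 : 0 < lambda) (m0 : 0 < mu) (a0 : 0 < alpha) (eta0 : 0 < eta).
Local Notation gam := (lambda + 2 * mu / d%:R).

(** In equilibrium the quotients of the weak inf-sup condition are bounded by
    the energy of the displacement over alpha. It is applied to the initial
    data, whose pressure error is given in the gradient norm, to obtain the
    L^2 norm. *)
Lemma inf_sup_pressure_bound th q : weak_inf_sup M Omega lambda mu eta eps ->
  V_h M Omega th -> Q_h M Omega q ->
  equilibrium (Omega := Omega) (lambda := lambda) (mu := mu) (alpha := alpha)
    (M := M) th q ->
  L2norm Omega q.1 <= Num.sqrt gam / (eta * alpha) * A_norm Omega lambda mu th +
    eps / eta * mesh_size M * H1semi Omega q.
Proof.
move=> wis Vt Qq e; have sia := semi_inner_a mO (ltW l0) (ltW m0).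
have g0 : 0 < Num.sqrt gam by rewrite sqrtr_gt0 gam_gt0.
have Lt := V_h_L2 Vt; set S := A_norm _ _ _ th.
have S0 : 0 <= S by exact: sqrtr_ge0.
have := wis q Qq; set X := (X in sup X).
have supX : sup X <= S / alpha.
  have [->|/set0P X0] := eqVneq X set0; first by rewrite sup0 divr_ge0// ltW.
  apply: ge_sup => // _ [w [Vw _] <-].
  have Lw := V_h_L2 Vw; have := e w Vw.
  have := le_trans (ler_norm _) (si_CauchySchwarz_sqrt sia Lt Lw).
  rewrite -/(A_norm Omega lambda mu th) -/(A_norm Omega lambda mu w) -/S => CS aE.
  have Aw0 : 0 <= A_norm Omega lambda mu w by exact: sqrtr_ge0.
  have [->|Aw] := eqVneq (A_norm Omega lambda mu w) 0.
    by rewrite invr0 mulr0 divr_ge0// ltW.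
  have {Aw0} Aw0 : 0 < A_norm Omega lambda mu w by rewrite lt_neqAle eq_sym Aw.
  rewrite ler_pdivrMr// mulrAC ler_pdivlMr// mulrC.
  rewrite (si_sym (semi_inner_ip mO)) -?aE//; first exact: divergence_L2.
  by have [] := Q_h_L2 Qq.
move=> /le_trans/(_ supX).
move: (L2norm _ _) (mesh_size M) (H1semi _ _) => Q h G H.
have : (Num.sqrt gam / eta) * (eta / Num.sqrt gam * Q -
    eps / Num.sqrt gam * h * G) <= Num.sqrt gam / eta * (S / alpha).
  by rewrite ler_wpM2l// divr_ge0// ltW.
have -> : (Num.sqrt gam / eta) * (eta / Num.sqrt gam * Q -
    eps / Num.sqrt gam * h * G) = Q - eps / eta * h * G.
  by field; rewrite !gt_eqF.
have -> : Num.sqrt gam / eta * (S / alpha) = Num.sqrt gam / (eta * alpha) * S.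
  by field; rewrite !gt_eqF.
lra.
Qed.

End inf_sup.

Section time_grid.
Context {R : realType} {T : R} {N : nat}.
Hypotheses (T0 : 0 < T) (N0 : (0 < N)%N).
Local Notation tau := (T / N%:R).
Local Notation t_ := (time_node T N).
Local Notation mu := (@lebesgue_measure R).

Lemma tau_gt0 : 0 < tau.
Proof. by rewrite divr_gt0// ltr0n. Qed.

Lemma time_node0 : t_ 0%N = 0.
Proof. by rewrite /time_node mul0r. Qed.

Lemma time_nodeS j : t_ j.+1 = t_ j + tau.
Proof. by rewrite /time_node -natr1 mulrDl mul1r. Qed.

Lemma time_node_ge0 j : 0 <= t_ j.
Proof. by rewrite mulr_ge0// ltW// tau_gt0. Qed.

Lemma le_time_node i j : (i <= j)%N -> t_ i <= t_ j.
Proof. by move=> ij; rewrite ler_wpM2r ?ler_nat// ltW// tau_gt0. Qed.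

Lemma time_node_leT j : (j <= N)%N -> t_ j <= T.
Proof.
move=> jN; rewrite /time_node mulrCA ger_pMr// ler_pdivrMr ?ltr0n//.
by rewrite mul1r ler_nat.
Qed.

Lemma time_node_in j : (j <= N)%N -> t_ j \in `[0, T].
Proof. by move=> jN; rewrite in_itv/= time_node_ge0 time_node_leT. Qed.

(** Step j of the scheme involves the times from j - 1 to j + 1; the window of
    the first step starts at time 0 as 0.-1 = 0. *)
Definition window (F : R -> R) (j : nat) : R :=
  primitive F (t_ j.+1) - primitive F (t_ j.-1).

Section monotone.
Context {F : R -> R}.
Hypothesis iF : mu.-integrable `[0, T] (EFin \o F).
Hypothesis F0 : forall t : R, t \in `[0, T] -> 0 <= F t.

Lemma le_primitive_node i j : (i <= j)%N -> (j <= N)%N ->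
  primitive F (t_ i) <= primitive F (t_ j).
Proof.
move=> ij jN; apply: (le_primitive iF) => //; first exact: time_node_ge0.
  exact: le_time_node.
exact: time_node_leT.
Qed.

Lemma sum_window_le n : (n <= N)%N ->
  \sum_(0 <= j < n) window F j <= 2 * primitive F (t_ n).
Proof.
move=> nN; apply: (sum_windows_le (F := fun j => primitive F (t_ j))).
  by rewrite time_node0 primitive0.
by move=> j jn; apply: le_primitive_node => //; exact: leq_trans nN.
Qed.

Lemma sub_primitive_le_window i i' j : (j.-1 <= i)%N -> (i' <= j.+1)%N ->
  (i <= N)%N -> (j < N)%N ->
  primitive F (t_ i') - primitive F (t_ i) <= window F j.
Proof.
move=> ji ij iN jN; rewrite lerD// ?lerN2; apply: le_primitive_node => //.
Qed.

End monotone.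

Section quotients.
Context {X : lmodType R} {S S1 : X -> Prop} {B : X -> X -> R} {nrm : X -> R}.
Context {k : R}.
Hypothesis siB : semi_inner S B.
Let cS := si_closed siB.

Local Notation nodes v := (fun j : nat => v (t_ j)).

Lemma dquotB (x y : nat -> X) j :
  dquot T N (fun i => x i - y i) j = dquot T N x j - dquot T N y j.
Proof. by rewrite /dquot -scalerBr !opprD !opprK addrACA. Qed.

Lemma dquotS (x : nat -> X) j : x j.+1 = x j + tau *: dquot T N x j.
Proof.
rewrite /dquot scalerA divff ?gt_eqF ?tau_gt0// scale1r addrC subrK.
by [].
Qed.

Lemma dquot_increment_le (w dw : R -> X) G i j : integral_path S B T w dw G ->
  (j.-1 <= i <= j)%N -> (j < N)%N ->
  B (dquot T N (nodes w) i) (dquot T N (nodes w) i) <= tau^-1 * window G j.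
Proof.
move=> wP /andP[ji ij] jN; have [Sw iG _ _] := wP.
have iN : (i < N)%N by exact: leq_ltn_trans jN.
have G0 := integral_path_primitive_ge0 siB wP.
have [Si _] := Sw _ (time_node_in (ltnW iN)).
have [Si' _] := Sw _ (time_node_in iN).
rewrite /dquot (si_sqrZ siB); last exact: lin_closedB.
rewrite exprVn expr2 invfM -mulrA ler_pM2l ?invr_gt0 ?tau_gt0//.
rewrite ler_pdivrMl ?tau_gt0//.
have := integral_path_increment siB wP (time_node_ge0 i) (le_time_node (leqnSn i))
  (time_node_leT iN).
move=> /le_trans; apply; rewrite time_nodeS addrAC subrr add0r -time_nodeS.
rewrite ler_pM2l ?tau_gt0//; apply: sub_primitive_le_window => //.
exact: ltnW.
Qed.

(** Both the quotient of the step and the lagged one are compared with the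
    derivative at the new time, at a distance of at most 2 tau. *)
Lemma dquot_error_le (v dv ddv : R -> X) G i j :
  (forall x, S1 x -> S x) -> (forall x, S x -> 0 <= nrm x) -> 0 <= k ->
  (forall x, S x -> B x x <= k * nrm x ^+ 2) ->
  C1_path S1 nrm T v dv -> integral_path S B T dv ddv G ->
  (j.-1 <= i <= j)%N -> (j < N)%N ->
  B (dquot T N (nodes v) i - dv (t_ j.+1)) (dquot T N (nodes v) i - dv (t_ j.+1))
  <= 2 * tau * window G j.
Proof.
move=> S1S nrm0 k0 Bnrm C1v dvP /andP[ji ij] jN.
have [_ iG _ _] := dvP; have G0 := integral_path_primitive_ge0 siB dvP.
have iN : (i < N)%N by exact: leq_ltn_trans jN.
have := difference_quotient_error siB S1S nrm0 k0 Bnrm C1v dvP (time_node_ge0 i)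
  (_ : t_ i < t_ i.+1) (le_time_node (_ : i.+1 <= j.+1)%N) (time_node_leT jN).
rewrite time_nodeS ltrDl tau_gt0 => /(_ isT ij).
rewrite (addrC (t_ i)) addrK -(addrC (t_ i)) -time_nodeS => /le_trans; apply.
have w0 : 0 <= window G j.
  by rewrite subr_ge0; apply: le_primitive_node => //; rewrite leqW// leq_pred.
have wi : primitive G (t_ j.+1) - primitive G (t_ i) <= window G j.
  by apply: sub_primitive_le_window => //; exact: ltnW.
apply: ler_pM => //.
- by rewrite subr_ge0 le_time_node// leqW.
- by rewrite subr_ge0 le_primitive_node// leqW.
- have : t_ j.+1 <= t_ i.+2 by apply: le_time_node; case: j ji {ij jN w0 wi}.
  by rewrite [t_ i.+2]time_nodeS [t_ i.+1]time_nodeS; lra.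
Qed.

End quotients.

End time_grid.

(** * Error equations and energy estimate *)

Section error_equations.
Context {R : realType} {d : nat} {Omega : set 'rV[R]_d} {b0 : R}.
Hypothesis mO : measurable Omega.
Hypothesis Ob : Omega `<=` @cube R d b0.
Hypothesis d0 : (0 < d)%N.
Context {T lambda mu alpha beta K C1 C2 c L : R} {M : mesh R d} {N : nat}.
Hypotheses (T0 : 0 < T) (N0 : (0 < N)%N).
Hypotheses (l0 : 0 < lambda) (m0 : 0 < mu) (a0 : 0 < alpha) (be0 : 0 < beta).
Hypotheses (K0 : 0 < K) (C10 : 0 < C1) (C20 : 0 < C2).
Hypothesis aL : alpha ^+ 2 / (lambda + 2 * mu / d%:R) <= L.
Hypothesis Zeq : Z_norm_equivalence M Omega C1 C2.
Context {f : R -> 'I_d -> 'rV[R]_d -> R} {g : R -> 'rV[R]_d -> R}.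
Context {u du ddu : R -> h1vec R d} {p dp ddp : R -> h1fun R d}.
Context {ub dru : R -> h1vec R d} {pb drp : R -> h1fun R d}.
Hypothesis biot : biot_solution Omega lambda mu alpha beta K T f g u du p dp.
Hypothesis regular : regular_solution Omega T u du ddu p dp ddp.
Hypothesis elliptic : forall t, t \in `[0, T] ->
  elliptic_projection Omega lambda mu alpha K M (u t) (ub t) (p t) (pb t).
Hypothesis C1ru :
  C1_path (V_space Omega) (H1norm_vec Omega) T (fun t => u t - ub t) dru.
Hypothesis C1rp : C1_path (H1_0 Omega) (H1norm Omega) T (fun t => p t - pb t) drp.
Hypothesis drbound : forall t, t \in `[0, T] ->
  projection_bounds Omega lambda mu K M c (du t) (dru t) (dp t) (drp t).
Context {fh : nat -> 'I_d -> 'rV[R]_d -> R} {gh : nat -> 'rV[R]_d -> R}.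
Context {uh : nat -> h1vec R d} {ph : nat -> h1fun R d}.
Hypothesis data : discrete_data Omega T M N f g fh gh.
Hypothesis uphh : forall j, (j <= N)%N -> V_h M Omega (uh j) /\ Q_h M Omega (ph j).
Hypothesis step0 : initial_step Omega lambda mu alpha M fh gh uh ph.
Hypothesis step1 :
  implicit_first_step Omega lambda mu alpha beta K T M L N fh gh uh ph.
Hypothesis stepj :
  explicit_coupling Omega lambda mu alpha beta K T M L N fh gh uh ph.

Local Notation a := (a_form Omega lambda mu).
Local Notation bf := (b_form Omega K).
Local Notation vf := (val_form Omega).
Local Notation zf := (@Z_form R d Omega M).
Local Notation gam := (lambda + 2 * mu / d%:R).
Local Notation fn := ('rV[R]_d -> R^o).
Local Notation tau := (T / N%:R).
Local Notation t_ := (time_node T N).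
Local Notation h := (mesh_size M).
Local Notation D := (dquot T N).
Local Notation leb := (@lebesgue_measure R).
Local Notation win := (@window R T N).

Let siv := semi_inner_val mO.
Let sig := semi_inner_grad mO.
Let sii := semi_inner_ip mO.
Let sia := semi_inner_a mO (ltW l0) (ltW m0).
Let sib := semi_inner_b mO (ltW K0).
Let sid := semi_inner_div mO.
Let siZ := semi_inner_Z mO Ob C20 Zeq.
Let cLh := L2h_lin_closed mO.
Let cLv := L2v_lin_closed mO.
Let cL := L2fun_lin_closed mO.
Let cQ := @Q_h_lin_closed R d Omega b0 mO Ob M.
Let cV := @V_h_lin_closed R d Omega b0 mO Ob M.

Definition theta_u (j : nat) : h1vec R d := ub (t_ j) - uh j.
Definition theta_p (j : nat) : h1fun R d := pb (t_ j) - ph j.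
Definition pb_ (j : nat) : h1fun R d := pb (t_ j).
Definition ub_ (j : nat) : h1vec R d := ub (t_ j).

Let tin j : (j <= N)%N -> t_ j \in `[0, T]. Proof. exact: time_node_in. Qed.

Let C1u : C1_path (V_space Omega) (H1norm_vec Omega) T u du.
Proof. by case: biot. Qed.

Let C1p : C1_path (H1_0 Omega) (H1norm Omega) T p dp.
Proof. by case: biot. Qed.

Lemma solution_L2 t : t \in `[0, T] ->
  [/\ L2v Omega (u t), L2v Omega (du t), L2h Omega (p t) & L2h Omega (dp t)].
Proof.
move=> tT; have [Vu Vdu _ _] := C1u tT; have [Hp Hdp _ _] := C1p tT.
by split; [exact: V_space_L2..|exact: H1_0_L2|exact: H1_0_L2].
Qed.

Lemma projection_in t : t \in `[0, T] -> V_h M Omega (ub t) /\ Q_h M Omega (pb t).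
Proof. by move=> /elliptic[]. Qed.

Lemma theta_in j : (j <= N)%N -> V_h M Omega (theta_u j) /\ Q_h M Omega (theta_p j).
Proof.
move=> jN; have [Vu Qp] := uphh jN; have [Vub Qpb] := projection_in (tin jN).
by split; [exact: (lin_closedB cV)|exact: (lin_closedB cQ)].
Qed.

(** The projection was defined with the coupling term precisely so that no
    consistency error appears in the momentum equation. *)
Lemma theta_equilibrium j : (j <= N)%N ->
  equilibrium (Omega := Omega) (lambda := lambda) (mu := mu) (alpha := alpha)
    (M := M) (theta_u j) (theta_p j).
Proof.
move=> jN v Vv; have [Vu Qp] := uphh jN.
have [Vub Qpb] := projection_in (tin jN).
have [_ _ _ /(_ v Vv) E1] := elliptic (tin jN).
have [_ _ bio] := biot; have [/(_ v (V_h_V_space Vv)) E2 _] := bio _ (tin jN).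
have E3 : a (uh j) v - alpha * ip Omega (ph j).1 (divergence v) =
    ip_vec Omega (f (t_ j)) v.
  have [_ _ fE _] := data; rewrite -(fE j jN v Vv).
  case: j jN {E1 E2 Vu Qp Vub Qpb} => [|[|j]] jN; first exact: step0.1.
    exact: step1.1.
  by have [_ ->//] := stepj (j := j.+1) jN; rewrite addrAC subrr add0r.
have [Lu Lub Lv] := And3 (V_h_L2 Vu) (V_h_L2 Vub) (V_h_L2 Vv).
have [[Lp _] [Lpb _]] := (Q_h_L2 Qp, Q_h_L2 Qpb).
have Ld := divergence_L2 mO Lv.
rewrite /theta_u /theta_p (si_B sia)//.
have -> : ip Omega (pb (t_ j) - ph j).1 (divergence v) =
    ip Omega (pb (t_ j)).1 (divergence v) - ip Omega (ph j).1 (divergence v).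
  by rewrite -(si_B sii).
lra.
Qed.

(** The implicit first step has the form of the explicit ones with j - 1
    replaced by j, which is what 0.-1 = 0 does. *)
Lemma scheme_equation j q : (j < N)%N -> Q_h M Omega q ->
  beta^-1 * vf (D ph j) q + L * lumped M (D ph j) q - L * vf (D ph j.-1) q
  + alpha * ip Omega (divergence (D uh j.-1)) q.1 + bf (ph j.+1) q =
  ip Omega (g (t_ j.+1)) q.1.
Proof.
move=> jN Qq; have [_ _ _ gE] := data; rewrite -(gE j.+1 jN q Qq).
case: j jN => [|j] jN; first exact: step1.2.
have [/(_ q Qq) + _] := stepj (j := j.+1) jN; rewrite mulNr.
have lin (x1 x2 x3 x4 x5 x6 : R) :
    x1 + x2 + x3 = - x4 + x5 + x6 -> x1 + x2 - x5 + x4 + x3 = x6 by lra.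
exact: lin.
Qed.

(** Consistency error of the scheme at the projection: the backward quotient,
    the artificial diffusion L of the splitting and the lag of the coupling
    term contribute one summand each. *)
Definition residual (j : nat) : fn :=
  beta^-1 *: (D pb_ j - dp (t_ j.+1)).1 +
  (L *: (D pb_ j - D pb_ j.-1).1 +
   alpha *: (divergence (D ub_ j.-1 - du (t_ j.+1)) : fn)).

Lemma D_in j : (j < N)%N -> [/\ Q_h M Omega (D pb_ j), V_h M Omega (D ub_ j),
  Q_h M Omega (D ph j), V_h M Omega (D uh j) &
  Q_h M Omega (D theta_p j) /\ V_h M Omega (D theta_u j)].
Proof.
move=> jN; have [Vu Qp] := uphh (ltnW jN); have [Vu' Qp'] := uphh jN.
have [Vub Qpb] := projection_in (tin (ltnW jN)).
have [Vub' Qpb'] := projection_in (tin jN).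
have [Vt Qt] := theta_in (ltnW jN); have [Vt' Qt'] := theta_in jN.
have DQ x : Q_h M Omega (x j) -> Q_h M Omega (x j.+1) -> Q_h M Omega (D x j).
  by move=> Qx Qx'; apply: (lin_closedZ _ cQ); exact: (lin_closedB cQ).
have DV x : V_h M Omega (x j) -> V_h M Omega (x j.+1) -> V_h M Omega (D x j).
  by move=> Vx Vx'; apply: (lin_closedZ _ cV); exact: (lin_closedB cV).
split; [exact: DQ|exact: DV|exact: DQ|exact: DV|].
by split; [exact: DQ|exact: DV].
Qed.

Lemma pred_ltN j : (j < N)%N -> (j.-1 < N)%N.
Proof. exact: leq_ltn_trans (leq_pred j). Qed.

Lemma residual_L2 j : (j < N)%N -> L2fun Omega (residual j).
Proof.
move=> jN; have jN' := pred_ltN jN.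
have [/Q_h_L2 Q1 _ _ _ _] := D_in jN; have [/Q_h_L2 Q2 /V_h_L2 V2 _ _ _] := D_in jN'.
have [_ Ldu _ Ldp] := solution_L2 (tin jN).
apply: cL.2; first by have [] := lin_closedB cLh Q1 Ldp.
apply: cL.2; first by have [] := lin_closedB cLh Q1 Q2.
apply: (lin_closedZ _ cL); apply: divergence_L2 => //; exact: (lin_closedB cLv).
Qed.

(** Linear algebra behind the error equation, on abstract vectors: P and Q are
    the quotients of the projected and the discrete pressure, P' and Q' the
    lagged ones, U and W those of the displacement. *)
Lemma consistency_identity (P P' Q Q' pt ph' dpt q : h1fun R d)
    (U W dut : h1vec R d) (G : R) :
  L2h Omega P -> L2h Omega P' -> L2h Omega Q -> L2h Omega Q' ->
  L2h Omega pt -> L2h Omega ph' -> L2h Omega dpt -> L2h Omega q ->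
  L2v Omega U -> L2v Omega W -> L2v Omega dut ->
  beta^-1 * vf Q q + L * lumped M Q q - L * vf Q' q
  + alpha * ip Omega (divergence W) q.1 + bf ph' q = G ->
  beta^-1 * vf dpt q + alpha * ip Omega (divergence dut) q.1 + bf pt q = G ->
  beta^-1 * vf (P - Q) q + L * zf (P - Q) q + L * vf (P - Q - (P' - Q')) q
  + alpha * ip Omega (divergence (U - W)) q.1 + bf (pt - ph') q =
  ip Omega (beta^-1 *: (P - dpt).1 + (L *: (P - P').1 +
    alpha *: (divergence (U - dut) : fn))) q.1 + L * zf P q.
Proof.
move=> LP LP' LQ LQ' Lpt Lph Ldp Lq LU LW Ldu.
have lumpB x y : lumped M (x - y) q = lumped M x q - lumped M y q.
  by rewrite addrC -scaleN1r lumped_lin mulN1r addrC.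
have divB x y : L2v Omega x -> L2v Omega y -> ip Omega (divergence (x - y)) q.1 =
    ip Omega (divergence x) q.1 - ip Omega (divergence y) q.1.
  move=> Lx Ly; rewrite divergenceB (si_B sii)//; try exact: divergence_L2.
  exact: Lq.1.
have vB x y : L2h Omega x -> L2h Omega y ->
    ip Omega (x - y).1 q.1 = vf x q - vf y q.
  by move=> Lx Ly; rewrite -(si_B siv).
have H3 (k1 k2 k3 : R) (x y z w : fn) : L2fun Omega x -> L2fun Omega y ->
    L2fun Omega z -> L2fun Omega w ->
    ip Omega (k1 *: x + (k2 *: y + k3 *: z)) w =
    k1 * ip Omega x w + (k2 * ip Omega y w + k3 * ip Omega z w).
  move=> Lx Ly Lz Lw; have Lkz : L2fun Omega (k3 *: z) by exact: (lin_closedZ _ cL).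
  rewrite (si_lin sii)//; last exact: cL.2.
  by rewrite (si_lin sii)// (si_Z sii).
have [Ld1 Ld2] := (lin_closedB cLh LP Ldp, lin_closedB cLh LP LP').
have Ld3 := divergence_L2 mO (lin_closedB cLv LU Ldu).
have [LPQ LPQ'] := (lin_closedB cLh LP LQ, lin_closedB cLh LP' LQ').
rewrite H3//; [|exact: Ld1.1|exact: Ld2.1|exact: Lq.1].
rewrite !vB// !divB// /Z_form lumpB !(si_B siv)// (si_B sib)//.
move: (vf Q q) (vf Q' q) (vf P q) (vf P' q) (vf dpt q) => w w' v v' z.
move: (lumped M P q) (lumped M Q q) (bf pt q) (bf ph' q) => x1 x2 y1 y2.
move: (ip _ (divergence W) _) (ip _ (divergence U) _) (ip _ (divergence dut) _).
by move=> s2 s1 s3 E1 E2; lra.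
Qed.

Lemma pressure_error_equation j q : (j < N)%N -> Q_h M Omega q ->
  beta^-1 * vf (D theta_p j) q + L * zf (D theta_p j) q
  + L * vf (D theta_p j - D theta_p j.-1) q
  + alpha * ip Omega (divergence (D theta_u j.-1)) q.1 + bf (theta_p j.+1) q =
  ip Omega (residual j) q.1 + L * zf (D pb_ j) q.
Proof.
move=> jN Qq; have jN' := pred_ltN jN.
have [Q1 V1 Q2 V2 _] := D_in jN; have [Q1' V1' Q2' V2' _] := D_in jN'.
have [_ Ldu _ Ldp] := solution_L2 (tin jN).
have [Vuh Qph] := uphh jN; have [Vub Qpb] := projection_in (tin jN).
have [_ _ /(_ q Qq) bE _] := elliptic (tin jN).
have Hq : H1_0 Omega q by case: Qq.
have [_ _ bio] := biot; have [_ /(_ q Hq) E2] := bio _ (tin jN).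
rewrite -bE in E2.
have Etp i : D theta_p i = D pb_ i - D ph i by rewrite -dquotB.
have Etu i : D theta_u i = D ub_ i - D uh i by rewrite -dquotB.
rewrite (Etp j) (Etp j.-1) (Etu j.-1).
exact: (consistency_identity (Q_h_L2 Q1) (Q_h_L2 Q1') (Q_h_L2 Q2) (Q_h_L2 Q2')
  (Q_h_L2 Qpb) (Q_h_L2 Qph) Ldp (Q_h_L2 Qq) (V_h_L2 V1') (V_h_L2 V2') Ldu
  (scheme_equation jN Qq) E2).
Qed.

Definition rate_p (s : R) : R := L2norm Omega (ddp s).1 ^+ 2.
Definition rate_grad (s : R) : R := H1semi Omega (ddp s) ^+ 2.
Definition rate_u (s : R) : R := H1norm_vec Omega (ddu s) ^+ 2.
Definition curv_p (s : R) : R := H2semi Omega (dp s) ^+ 2.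
Definition curv_up (s : R) : R :=
  H2semi_vec Omega (du s) ^+ 2 + H2semi Omega (dp s) ^+ 2.

Lemma rate_p_path : integral_path (L2h Omega) vf T dp ddp rate_p.
Proof.
have [_ _ _ _ wp] := regular; apply: val_integral_path => //.
by move=> t /solution_L2[].
Qed.

Lemma rate_grad_path : integral_path (L2h Omega) (grad_form Omega) T dp ddp rate_grad.
Proof.
have [_ _ _ _ wp] := regular; apply: grad_integral_path => //.
by move=> t /solution_L2[].
Qed.

Lemma rate_u_path : integral_path (L2v Omega) (H1ip_vec Omega) T du ddu rate_u.
Proof.
have [_ _ _ wu _] := regular; apply: H1_vec_integral_path => //.
by move=> t /solution_L2[].
Qed.

Lemma curv_p_integrable : leb.-integrable `[0, T] (EFin \o curv_p).
Proof. by have [_ _ i2 _ _] := regular. Qed.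

Lemma curv_up_integrable : leb.-integrable `[0, T] (EFin \o curv_up).
Proof. by have [_ i1 i2 _ _] := regular; exact: integrable_add. Qed.

Lemma val_form_le_H1 x : L2h Omega x -> vf x x <= 1 * H1norm Omega x ^+ 2.
Proof.
by move=> Lx; rewrite mul1r H1norm_sqr// lerDl; exact: (si_ge0 sig).
Qed.

Lemma grad_form_le_H1 x : L2h Omega x ->
  grad_form Omega x x <= 1 * H1norm Omega x ^+ 2.
Proof.
by move=> Lx; rewrite mul1r H1norm_sqr// lerDr; exact: (si_ge0 siv).
Qed.

(** The projection error is C^1 in time, and the approximation property of its
    derivative supplies the dominating function. *)
Lemma rho_p_path : integral_path (L2h Omega) vf T (fun t => p t - pb t) drp
  (fun s => (c * h ^+ 2) ^+ 2 * curv_p s).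
Proof.
apply: (C1_path_integral_path siv (S1 := H1_0 Omega) (nrm := H1norm Omega) (k := 1)) => //.
- by move=> x; exact: H1_0_L2.
- by move=> x _; exact: sqrtr_ge0.
- by move=> x Lx; exact: val_form_le_H1.
- by apply: integrable_scale => //; exact: curv_p_integrable.
- move=> t tT; have [_ _ H] := drbound tT; have [_ Hd _ _] := C1rp tT.
  have [Ld _] := H1_0_L2 Hd; rewrite /curv_p -exprMn.
  rewrite -[vf _ _](L2norm_sqr mO Ld) lerXn2r ?nnegrE ?sqrtr_ge0//.
  by apply: le_trans H; exact: sqrtr_ge0.
Qed.

Lemma rho_u_path : integral_path (L2v Omega) a T (fun t => u t - ub t) dru
  (fun s => 2 * (c * h) ^+ 2 * curv_up s).
Proof.
have k0 : 0 <= 2 * mu + lambda * d%:R by rewrite addr_ge0 ?mulr_ge0// ltW.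
apply: (C1_path_integral_path sia (S1 := V_space Omega) (nrm := H1norm_vec Omega)
  (k := 2 * mu + lambda * d%:R)) => //.
- by move=> x; exact: V_space_L2.
- by move=> x _; exact: sqrtr_ge0.
- by move=> x Lx; rewrite H1norm_vec_sqr//; apply: a_form_le_H1 => //; exact: ltW.
- by apply: integrable_scale => //; exact: curv_up_integrable.
- move=> t tT; have [H _ _] := drbound tT; have [_ Hd _ _] := C1ru tT.
  have Ld := V_space_L2 Hd; have A0 := si_ge0 sia Ld.
  rewrite -(sqr_sqrtr A0) -/(A_norm Omega lambda mu (dru t)).
  apply: (@le_trans _ _ ((c * h * (H2semi_vec Omega (du t) + H2semi Omega (dp t))) ^+ 2)).
    by rewrite lerXn2r ?nnegrE ?sqrtr_ge0//; apply: le_trans H; exact: sqrtr_ge0.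
  rewrite /curv_up exprMn; move: (c * h) (H2semi_vec _ _) (H2semi _ _) => k x y.
  rewrite -mulrA [leRHS]mulrCA ler_wpM2l ?sqr_ge0//.
  exact: sqrD_le2.
Qed.

Lemma pb_quotient i : D pb_ i =
  D (fun j => p (t_ j)) i - D (fun j => p (t_ j) - pb (t_ j)) i.
Proof.
rewrite -dquotB; congr (dquot T N _ i).
by apply/funext => j; rewrite opprB addrCA subrr addr0.
Qed.

Lemma ub_quotient i : D ub_ i =
  D (fun j => u (t_ j)) i - D (fun j => u (t_ j) - ub (t_ j)) i.
Proof.
rewrite -dquotB; congr (dquot T N _ i).
by apply/funext => j; rewrite opprB addrCA subrr addr0.
Qed.

Lemma path_quotient_in (X : lmodType R) (S : X -> Prop) (x : R -> X) i :
  lin_closed S -> (forall t, t \in `[0, T] -> S (x t)) -> (i < N)%N ->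
  S (D (fun j => x (t_ j)) i).
Proof.
move=> cS Sx iN; apply: (lin_closedZ _ cS); apply: (lin_closedB cS); apply: Sx.
  exact: tin.
exact: tin (ltnW iN).
Qed.

(** Error of the time quotient of p plus the quotient of the projection error,
    each with its own kind of smallness: tau for the first, h^2 for the
    second. *)
Lemma pressure_quotient_error i j : (j.-1 <= i <= j)%N -> (j < N)%N ->
  vf (D pb_ i - dp (t_ j.+1)) (D pb_ i - dp (t_ j.+1)) <=
  4 * tau * win rate_p j +
  2 * (tau^-1 * win (fun s => (c * h ^+ 2) ^+ 2 * curv_p s) j).
Proof.
move=> /[dup] /andP[ji ij] jij jN; have iN : (i < N)%N by exact: leq_ltn_trans jN.
have E1 := dquot_error_le T0 N0 siv (S1 := H1_0 Omega) (nrm := H1norm Omega)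
  (@H1_0_L2 _ _ _) (fun x _ => sqrtr_ge0 _) ler01 val_form_le_H1 C1p
  rate_p_path jij jN.
have E2 := dquot_increment_le T0 N0 siv rho_p_path jij jN.
have Lp : L2h Omega (D (fun j => p (t_ j)) i).
  by apply: path_quotient_in => // t /solution_L2[].
have Lr : L2h Omega (D (fun j => p (t_ j) - pb (t_ j)) i).
  apply: (path_quotient_in (x := fun t => p t - pb t)) => // t tT.
  by have [/H1_0_L2 ? _ _ _] := C1rp tT.
have [_ _ _ Ldp] := solution_L2 (tin jN).
rewrite pb_quotient addrAC; move: E1 E2 Lp Lr Ldp.
move: (D _ i) (D _ i) (dp _) => x y z E1 E2 Lx Ly Lz.
have Lxz := lin_closedB cLh Lx Lz.
apply: (le_trans (si_sqrB_le siv Lxz Ly)); apply: lerD.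
  by rewrite (_ : 4 * tau * _ = 2 * (2 * tau * win rate_p j));
    [rewrite ler_pM2l|ring].
by rewrite ler_pM2l.
Qed.

(** The time error is measured in H^1, the projection error in the energy norm
    with the help of the coercivity in the divergence. *)
Lemma displacement_quotient_error j : (j < N)%N ->
  div_form Omega (D ub_ j.-1 - du (t_ j.+1)) (D ub_ j.-1 - du (t_ j.+1)) <=
  4 * d%:R * tau * win rate_u j +
  2 / gam * (tau^-1 * win (fun s => 2 * (c * h) ^+ 2 * curv_up s) j).
Proof.
move=> jN; have jN' := pred_ltN jN; have siH := semi_inner_H1_vec mO.
have jij : (j.-1 <= j.-1 <= j)%N by rewrite leqnn leq_pred.
have E1 := dquot_error_le T0 N0 siH (S1 := V_space Omega) (nrm := H1norm_vec Omega)
  (@V_space_L2 _ _ _) (fun x _ => sqrtr_ge0 _) ler01 _ C1u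
  rate_u_path jij jN.
have {}E1 := E1 (fun x Lx => etrans (congr1 (fun y => _ <= y)
  (etrans (mul1r _) (H1norm_vec_sqr mO Lx))) (lexx _)).
have E2 := dquot_increment_le T0 N0 sia rho_u_path jij jN.
have Lp : L2v Omega (D (fun j => u (t_ j)) j.-1).
  by apply: path_quotient_in => // t /solution_L2[].
have Lr : L2v Omega (D (fun j => u (t_ j) - ub (t_ j)) j.-1).
  apply: (path_quotient_in (x := fun t => u t - ub t)) => // t tT.
  by have [/V_space_L2 ? _ _ _] := C1ru tT.
have [_ Ldu _ _] := solution_L2 (tin jN).
rewrite ub_quotient addrAC; move: E1 E2 Lp Lr Ldu.
move: (D _ j.-1) (D _ j.-1) (du _) => x y z E1 E2 Lx Ly Lz.
have Lxz := lin_closedB cLv Lx Lz.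
apply: (le_trans (si_sqrB_le sid Lxz Ly)); apply: lerD.
  rewrite (_ : 4 * d%:R * tau * _ = 2 * (d%:R * (2 * tau * win rate_u j))).
    rewrite ler_pM2l//; apply: (le_trans (div_form_le_H1 mO Lxz)).
    by rewrite ler_wpM2l.
  by ring.
rewrite -mulrA ler_pM2l// ler_pdivlMl; last exact: gam_gt0.
by apply: le_trans E2; exact: (a_form_coercive_div mO lambda d0 (ltW m0) Ly).
Qed.

Lemma residual_le j : (j < N)%N ->
  ip Omega (residual j) (residual j) <=
  (2 * beta^-1 ^+ 2 + 16 * L ^+ 2) *
    (4 * tau * win rate_p j +
     2 * (tau^-1 * win (fun s => (c * h ^+ 2) ^+ 2 * curv_p s) j)) +
  4 * alpha ^+ 2 *
    (4 * d%:R * tau * win rate_u j +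
     2 / gam * (tau^-1 * win (fun s => 2 * (c * h) ^+ 2 * curv_up s) j)).
Proof.
move=> jN; have jN' := pred_ltN jN.
have [/Q_h_L2 LP _ _ _ _] := D_in jN.
have [/Q_h_L2 LP' /V_h_L2 LU _ _ _] := D_in jN'.
have [_ Ldu _ Ldp] := solution_L2 (tin jN).
have := displacement_quotient_error jN.
have := pressure_quotient_error (i := j.-1) (j := j) _ jN.
rewrite leqnn leq_pred => /(_ isT).
have := pressure_quotient_error (i := j) (j := j) _ jN.
rewrite leqnn leq_pred => /(_ isT); rewrite /residual.
move: (4 * tau * _ + _) (4 * d%:R * tau * _ + _) => x y.
move: (D pb_ j) (D pb_ j.-1) (D ub_ j.-1) (dp _) (du _) LP LP' LU Ldp Ldu.
move=> P P' U p' u' LP LP' LU Lp' Lu' H1 H2 H3.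
have L1 := lin_closedB cLh LP Lp'; have L1' := lin_closedB cLh LP' Lp'.
have L2 := lin_closedB cLh LP LP'.
have L3 := divergence_L2 mO (lin_closedB cLv LU Lu').
have H4 : vf (P - P') (P - P') <= 4 * x.
  have -> : P - P' = (P - p') - (P' - p') by rewrite opprB addrA subrK.
  apply: (le_trans (si_sqrB_le siv L1 L1')).
  rewrite (_ : 4 * x = 2 * x + 2 * x); last by ring.
  apply: lerD; rewrite (ler_pM2l (ltr0Sn R 1)); [exact: H1|exact: H2].
have G3 (k1 k2 k3 : R) (x1 x2 x3 : fn) : L2fun Omega x1 -> L2fun Omega x2 ->
    L2fun Omega x3 ->
    ip Omega (k1 *: x1 + (k2 *: x2 + k3 *: x3)) (k1 *: x1 + (k2 *: x2 + k3 *: x3))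
    <= 2 * (k1 ^+ 2 * ip Omega x1 x1) + 2 * (2 * (k2 ^+ 2 * ip Omega x2 x2) +
      2 * (k3 ^+ 2 * ip Omega x3 x3)).
  move=> Lx1 Lx2 Lx3.
  have M1 : L2fun Omega (k1 *: x1) by exact: (lin_closedZ _ cL).
  have M2 : L2fun Omega (k2 *: x2) by exact: (lin_closedZ _ cL).
  have M3 : L2fun Omega (k3 *: x3) by exact: (lin_closedZ _ cL).
  have M23 : L2fun Omega (k2 *: x2 + k3 *: x3) by exact: (lin_closedD cL).
  apply: (le_trans (si_sqrD_le sii M1 M23)); rewrite (si_sqrZ sii)// lerD2l.
  rewrite ler_pM2l//; apply: (le_trans (si_sqrD_le sii M2 M3)).
  by rewrite !(si_sqrZ sii).
apply: (le_trans (G3 _ _ _ _ _ _ L1.1 L2.1 L3)).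
rewrite -/(vf _ _) -/(vf (P - P') (P - P')) -/(div_form Omega (U - u') (U - u')).
exact: (weighted_sum_le _ _ _ H1 H4 H3).
Qed.

(** The lumping error of a discrete function is at most h times its gradient,
    and the gradient of the projected quotient is at most that of the exact
    quotient, which is close to the gradient of the derivative. *)
Lemma lumping_error_le j : (j < N)%N ->
  zf (D pb_ j) (D pb_ j) <=
  C1^-1 * h ^+ 2 * (4 * tau * win rate_grad j +
    2 * H1semi Omega (dp (t_ j.+1)) ^+ 2).
Proof.
move=> jN; have [QP _ _ _ _] := D_in jN; have LP := Q_h_L2 QP.
have jij : (j.-1 <= j <= j)%N by rewrite leqnn leq_pred.
have [_ _ _ Ldp] := solution_L2 (tin jN).
have Lp : L2h Omega (D (fun j => p (t_ j)) j).
  by apply: path_quotient_in => // t /solution_L2[].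
have E1 := dquot_error_le T0 N0 sig (S1 := H1_0 Omega) (nrm := H1norm Omega)
  (@H1_0_L2 _ _ _) (fun x _ => sqrtr_ge0 _) ler01 grad_form_le_H1 C1p
  rate_grad_path jij jN.
(* Galerkin orthogonality and Cauchy-Schwarz: the elliptic projection does
   not increase the gradient norm *)
have stab : grad_form Omega (D pb_ j) (D pb_ j) <=
    grad_form Omega (D (fun j => p (t_ j)) j) (D (fun j => p (t_ j)) j).
  have ort : grad_form Omega (D pb_ j) (D pb_ j) =
      grad_form Omega (D (fun j => p (t_ j)) j) (D pb_ j).
    have bt t : t \in `[0, T] -> L2h Omega (pb t) /\ L2h Omega (p t) /\
        grad_form Omega (pb t) (D pb_ j) = grad_form Omega (p t) (D pb_ j).
      move=> tT; have [_ /Q_h_L2 Lpb /(_ _ QP) + _] := elliptic tT.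
      have [_ _ Lpt _] := solution_L2 tT; rewrite !b_formE//.
      by move=> /(mulfI (lt0r_neq0 K0)).
    have [A1 [A2 A3]] := bt _ (tin jN).
    have [B1 [B2 B3]] := bt _ (tin (ltnW jN)).
    have lin y y' z : L2h Omega y -> L2h Omega y' -> L2h Omega z ->
        grad_form Omega (tau^-1 *: (y - y')) z =
        tau^-1 * (grad_form Omega y z - grad_form Omega y' z).
      move=> Ly Ly' Lz; have Lyy := lin_closedB cLh Ly Ly'.
      by rewrite (si_Z sig)// (si_B sig).
    transitivity (tau^-1 * (grad_form Omega (pb (t_ j.+1)) (D pb_ j) -
        grad_form Omega (pb (t_ j)) (D pb_ j))); first exact: lin.
    by rewrite A3 B3; symmetry; exact: lin.
  have CS := si_CauchySchwarz sig Lp LP; rewrite -ort in CS.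
  exact: (sqr_le_mul (si_ge0 sig Lp) (si_ge0 sig LP) CS).
have [H1 _] := Zeq QP.
rewrite -mulrA ler_pdivlMl//; apply: (le_trans H1).
rewrite H1semi_sqr// ler_wpM2l ?sqr_ge0//; apply: (le_trans stab).
have -> : D (fun j => p (t_ j)) j =
    (D (fun j => p (t_ j)) j - dp (t_ j.+1)) + dp (t_ j.+1) by rewrite subrK.
apply: (le_trans (si_sqrD_le sig (lin_closedB cLh Lp Ldp) Ldp)).
rewrite -(H1semi_sqr mO Ldp); apply: lerD => //.
by rewrite (_ : 4 * tau * _ = 2 * (2 * tau * win rate_grad j));
  [rewrite ler_pM2l|ring].
Qed.

Lemma energy_estimate n : (n < N)%N ->
  tau / beta * \sum_(0 <= j < n.+1) vf (D theta_p j) (D theta_p j)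
  + bf (theta_p n.+1) (theta_p n.+1) <=
  (1 + L * beta) * (bf (theta_p 0%N) (theta_p 0%N) +
    tau * \sum_(0 <= j < n.+1) (beta * ip Omega (residual j) (residual j) +
      L / 2 * zf (D pb_ j) (D pb_ j))).
Proof.
move=> nN; have t0 := tau_gt0 T0 N0.
have L0 : 0 <= L.
  by apply: le_trans aL; rewrite divr_ge0 ?sqr_ge0// ltW// gam_gt0.
have := energy_telescope (beta := beta) (L := L) (tau := tau)
  (D := fun j => vf (D theta_p j) (D theta_p j))
  (E := fun j => bf (theta_p j) (theta_p j))
  (r := fun j => ip Omega (residual j) (residual j))
  (s := fun j => zf (D pb_ j) (D pb_ j)) (N := N) be0 L0 t0 _ _ _ _ nN.
move=> H; apply: le_trans (H _ _ _ _).
- rewrite lerD2r lerDl mulr_ge0 ?(mulr_ge0 L0 (ltW t0))//.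
  by apply: (si_ge0 siv); have [_ _ _ _ [/Q_h_L2]] := D_in nN.
- by move=> j /theta_in[_ /Q_h_L2 Lt]; exact: (si_ge0 sib).
- by move=> j jN; apply: (si_ge0 sii); exact: residual_L2.
- by move=> j /D_in[QP _ _ _ _]; exact: (si_ge0 siZ).
move=> j jN; have jN' := pred_ltN jN.
have [QP _ _ _ [Qt Vt]] := D_in jN; have [_ _ _ _ [Qt' Vt']] := D_in jN'.
have [Vj Qj] := theta_in (ltnW jN); have [Vj1 Qj1] := theta_in jN.
have eqD i : (i < N)%N -> equilibrium (Omega := Omega) (lambda := lambda)
    (mu := mu) (alpha := alpha) (M := M) (D theta_u i) (D theta_p i).
  move=> iN; have [Vi Qi] := theta_in (ltnW iN); have [Vi1 Qi1] := theta_in iN.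
  exact: (equilibriumB mO l0 m0 tau^-1 Vi1 Vi Qi1 Qi (theta_equilibrium iN)
    (theta_equilibrium (ltnW iN))).
have PE := pressure_error_equation jN Qt.
have thS : theta_p j.+1 = theta_p j + tau *: D theta_p j by exact: dquotS.
rewrite thS in PE *.
exact: (energy_step mO Ob d0 l0 m0 K0 be0 t0 aL C20 Zeq Vt Vt' Qt Qt' Qj QP
  (residual_L2 jN) (eqD _ jN) (eqD _ jN') PE).
Qed.

Definition consistency (n : nat) : R :=
  beta * ((2 * beta^-1 ^+ 2 + 16 * L ^+ 2) *
    (8 * tau ^+ 2 * primitive rate_p (t_ n) +
     4 * ((c * h ^+ 2) ^+ 2 * primitive curv_p (t_ n))) +
    4 * alpha ^+ 2 * (8 * d%:R * tau ^+ 2 * primitive rate_u (t_ n) +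
     2 * (2 / gam) * (2 * (c * h) ^+ 2 * primitive curv_up (t_ n)))) +
  L / 2 * (C1^-1 * h ^+ 2 * (8 * tau ^+ 2 * primitive rate_grad (t_ n) +
    2 * (tau * \sum_(0 <= j < n) H1semi Omega (dp (t_ j.+1)) ^+ 2))).

(** Sum over the steps of the squares of the consistency errors; the windows
    overlap twice, which turns them into integrals over the whole interval. *)
Lemma consistency_le n : (n <= N)%N ->
  tau * \sum_(0 <= j < n) (beta * ip Omega (residual j) (residual j) +
    L / 2 * zf (D pb_ j) (D pb_ j)) <= consistency n.
Proof.
move=> nN; have t0 := tau_gt0 T0 N0; have g0 : 0 < gam by exact: gam_gt0.
have L0 : 0 <= L by apply: le_trans aL; rewrite divr_ge0 ?sqr_ge0// ltW.
have tnT := time_node_leT T0 N0 nN.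
have P1 := rate_p_path; have P2 := rho_p_path; have P3 := rate_u_path.
have P4 := rho_u_path; have P5 := rate_grad_path.
rewrite /consistency -(primitive_scale _ curv_p_integrable tnT).
rewrite -(primitive_scale _ curv_up_integrable tnT).
have win_le (X : lmodType R) (S : X -> Prop) (B : X -> X -> R)
    (siB : semi_inner S B) (w dw : R -> X) (G : R -> R) :
    integral_path S B T w dw G ->
    \sum_(0 <= j < n) win G j <= 2 * primitive G (t_ n).
  move=> wP; have [_ iG _ _] := wP.
  exact: (sum_window_le T0 N0 iG (integral_path_primitive_ge0 siB wP) nN).
apply: (sum_data_le (w1 := win rate_p) (w3 := win rate_u) (w5 := win rate_grad)
  (w2 := win (fun s => (c * h ^+ 2) ^+ 2 * curv_p s))
  (w4 := win (fun s => 2 * (c * h) ^+ 2 * curv_up s))).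
- exact: ltW.
- exact: L0.
- exact: t0.
- by apply: addr_ge0; apply: mulr_ge0 => //; exact: sqr_ge0.
- by apply: mulr_ge0 => //; exact: sqr_ge0.
- by apply: mulr_ge0; [rewrite invr_ge0 ltW|exact: sqr_ge0].
- exact: ler0n.
- by rewrite divr_ge0// ltW.
- by move=> j jn; apply: residual_le; exact: leq_trans nN.
- by move=> j jn; apply: lumping_error_le; exact: leq_trans nN.
- exact: (win_le _ _ _ siv _ _ _ P1).
- exact: (win_le _ _ _ siv _ _ _ P2).
- exact: (win_le _ _ _ (semi_inner_H1_vec mO) _ _ _ P3).
- exact: (win_le _ _ _ sia _ _ _ P4).
- exact: (win_le _ _ _ sig _ _ _ P5).
Qed.

(** The discrete pressure is its initial value plus the sum of its increments,
    estimated by Cauchy-Schwarz in time: the mass term of the energy estimate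
    controls the quotients in L^2. *)
Lemma theta_p_norm_le n : (n < N)%N ->
  L2norm Omega (theta_p n.+1).1 <= L2norm Omega (theta_p 0%N).1 +
    Num.sqrt (T * beta * (tau / beta *
      \sum_(0 <= j < n.+1) vf (D theta_p j) (D theta_p j))).
Proof.
move=> nN; have t0 := tau_gt0 T0 N0.
pose y j := Num.sqrt (vf (D theta_p j) (D theta_p j)).
have H m : (m <= N)%N -> L2norm Omega (theta_p m).1 <=
    L2norm Omega (theta_p 0%N).1 + tau * \sum_(0 <= j < m) y j.
  elim: m => [|m IH] mN; first by rewrite big_nil mulr0 addr0.
  have [_ /Q_h_L2 Lm] := theta_in (ltnW mN).
  have [_ _ _ _ [/Q_h_L2 LD _]] := D_in mN.
  have LtD : L2h Omega (tau *: D theta_p m) by exact: (lin_closedZ _ cLh).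
  have thS : theta_p m.+1 = theta_p m + tau *: D theta_p m by exact: dquotS.
  rewrite thS big_nat_recr// mulrDr addrA.
  apply: (le_trans (si_triangle siv Lm LtD)); apply: lerD; first exact: IH (ltnW mN).
  by rewrite (si_sqrZ siv)// sqrtrM ?sqr_ge0// sqrtr_sqr gtr0_norm.
apply: (le_trans (H n.+1 nN)); rewrite lerD2l.
have y0 j : 0 <= y j by exact: sqrtr_ge0.
have s0 : 0 <= \sum_(0 <= j < n.+1) y j by apply: sumr_ge0.
have ts0 : 0 <= tau * \sum_(0 <= j < n.+1) y j by rewrite mulr_ge0// ltW.
rewrite -(ger0_norm ts0) -sqrtr_sqr; apply: ler_wsqrtr.
have yE : \sum_(0 <= j < n.+1) y j ^+ 2 =
    \sum_(0 <= j < n.+1) vf (D theta_p j) (D theta_p j).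
  apply: eq_big_nat => j /andP[_ jn]; rewrite sqr_sqrtr//; apply: (si_ge0 siv).
  by have [_ _ _ _ [/Q_h_L2]] := D_in (leq_trans jn nN).
rewrite -yE exprMn; have S0 : 0 <= \sum_(0 <= j < n.+1) y j ^+ 2.
  by apply: sumr_ge0 => j _; exact: sqr_ge0.
apply: (le_trans (ler_wpM2l (sqr_ge0 tau) (sum_sqr_le y n.+1))).
rewrite (_ : tau ^+ 2 * (n.+1%:R * _) =
  (t_ n.+1) * (tau * \sum_(0 <= j < n.+1) y j ^+ 2)); last first.
  by rewrite /time_node; ring.
rewrite (_ : T * beta * _ = T * (tau * \sum_(0 <= j < n.+1) y j ^+ 2)).
  by rewrite ler_wpM2r ?time_node_leT// mulr_ge0// ltW.
by rewrite -mulrA; congr (_ * _); rewrite mulrA mulrCA divff ?mulr1// gt_eqF.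
Qed.

Lemma theta_u_norm_le j : (j <= N)%N ->
  A_norm Omega lambda mu (theta_u j) <=
  Num.sqrt (alpha ^+ 2 / gam) * L2norm Omega (theta_p j).1.
Proof.
move=> jN; have [Vu Qp] := theta_in jN.
have k0 : 0 <= alpha ^+ 2 / gam by rewrite divr_ge0 ?sqr_ge0// ltW// gam_gt0.
rewrite -sqrtrM//; apply: ler_wsqrtr.
exact: (equilibrium_stable mO d0 l0 m0 Vu Qp (theta_equilibrium jN)).
Qed.

Lemma discrete_error_le n : (n < N)%N ->
  B_norm Omega K (theta_p n.+1) <=
    Num.sqrt (1 + L * beta) *
      (B_norm Omega K (theta_p 0%N) + Num.sqrt (consistency n.+1)) /\
  L2norm Omega (theta_p n.+1).1 <= L2norm Omega (theta_p 0%N).1 +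
    Num.sqrt (T * beta * (1 + L * beta)) *
      (B_norm Omega K (theta_p 0%N) + Num.sqrt (consistency n.+1)).
Proof.
move=> nN; have t0 := tau_gt0 T0 N0.
have L0 : 0 <= L.
  by apply: le_trans aL; rewrite divr_ge0 ?sqr_ge0// ltW// gam_gt0.
have Lb : 0 <= 1 + L * beta by rewrite addr_ge0// mulr_ge0// ltW.
have Tb : 0 <= T * beta by rewrite mulr_ge0// ltW.
have [_ /Q_h_L2 Lt0] := theta_in (leq0n N); have [_ /Q_h_L2 Ltn] := theta_in nN.
have E0 := si_ge0 sib Lt0; have En := si_ge0 sib Ltn.
have sum0 (F : nat -> R) : (forall j, (j < n.+1)%N -> 0 <= F j) ->
    0 <= \sum_(0 <= j < n.+1) F j.
  move=> F0; rewrite big_nat_cond sumr_ge0// => j; rewrite andbT => /andP[_].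
  exact: F0.
have cons := consistency_le nN; have EE := energy_estimate nN.
have D0 : 0 <= tau / beta * \sum_(0 <= j < n.+1) vf (D theta_p j) (D theta_p j).
  apply: mulr_ge0; first by rewrite divr_ge0// ltW.
  apply: sum0 => j jn; apply: (si_ge0 siv).
  by have [_ _ _ _ [/Q_h_L2]] := D_in (leq_trans jn nN).
have S0 : 0 <= tau * \sum_(0 <= j < n.+1)
    (beta * ip Omega (residual j) (residual j) + L / 2 * zf (D pb_ j) (D pb_ j)).
  apply: mulr_ge0; first exact: ltW.
  apply: sum0 => j jn; have jN := leq_trans jn nN.
  have r0 := si_ge0 sii (residual_L2 jN).
  have [QP _ _ _ _] := D_in jN; have z0 := si_ge0 siZ QP.
  by apply: addr_ge0; apply: mulr_ge0 => //; [exact: ltW|exact: divr_ge0].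
have C0 := le_trans S0 cons.
have X : (1 + L * beta) * (bf (theta_p 0%N) (theta_p 0%N) +
   tau * \sum_(0 <= j < n.+1) (beta * ip Omega (residual j) (residual j) +
     L / 2 * zf (D pb_ j) (D pb_ j))) <=
   (1 + L * beta) * (bf (theta_p 0%N) (theta_p 0%N) + consistency n.+1).
  by apply: ler_wpM2l => //; rewrite lerD2l.
have {EE X} XE := le_trans EE X.
have sX : Num.sqrt (bf (theta_p 0%N) (theta_p 0%N) + consistency n.+1) <=
    B_norm Omega K (theta_p 0%N) + Num.sqrt (consistency n.+1) by exact: sqrtD_le.
split.
  apply: (@le_trans _ _ (Num.sqrt ((1 + L * beta) *
      (bf (theta_p 0%N) (theta_p 0%N) + consistency n.+1)))).
    by apply: ler_wsqrtr; apply: le_trans XE; rewrite lerDr.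
  by rewrite sqrtrM// ler_wpM2l// sqrtr_ge0.
apply: (le_trans (theta_p_norm_le nN)); rewrite lerD2l.
apply: (@le_trans _ _ (Num.sqrt (T * beta * ((1 + L * beta) *
    (bf (theta_p 0%N) (theta_p 0%N) + consistency n.+1))))).
  by apply: ler_wsqrtr; apply: ler_wpM2l => //; apply: le_trans XE; rewrite lerDl.
by rewrite mulrA (sqrtrM _ (mulr_ge0 Tb Lb)) ler_wpM2l// sqrtr_ge0.
Qed.

Local Notation sqrtP n G := (Num.sqrt (primitive G (t_ n))).

(** The window of the last step reaches the time n only; all integrals are
    extended by one step to those of the final bound. *)
Lemma sqrt_consistency_bound n (Dh : R) : (n < N)%N -> h <= Dh ->
  Num.sqrt (consistency n) <=
  Num.sqrt (consistency_const beta (2 * beta^-1 ^+ 2 + 16 * L ^+ 2)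
    (4 * alpha ^+ 2) (L / 2) C1^-1 c Dh d%:R (2 / gam)) *
  (tau * (sqrtP n.+1 rate_p + sqrtP n.+1 rate_u) + h * (sqrtP n.+1 curv_p + sqrtP n.+1 curv_up +
    Num.sqrt (tau * \sum_(0 <= j < n.+1) H1semi Omega (dp (t_ j.+1)) ^+ 2) +
    tau * sqrtP n.+1 rate_grad)).
Proof.
move=> nN hD; have t0 := tau_gt0 T0 N0; have g0 : 0 < gam by exact: gam_gt0.
have L0 : 0 <= L by apply: le_trans aL; rewrite divr_ge0 ?sqr_ge0// ltW.
have P1 := rate_p_path; have P3 := rate_u_path; have P5 := rate_grad_path.
have mono G : leb.-integrable `[0, T] (EFin \o G) ->
    (forall t : R, t \in `[0, T] -> 0 <= G t) ->
    0 <= primitive G (t_ n) /\ primitive G (t_ n) <= primitive G (t_ n.+1).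
  move=> iG G0; split; last exact: (le_primitive_node T0 N0 iG G0 (leqnSn n)).
  have := le_primitive_node T0 N0 iG G0 (leq0n n) (ltnW nN).
  by rewrite time_node0 primitive0.
have monoP (X : lmodType R) (S : X -> Prop) (B : X -> X -> R)
    (siB : semi_inner S B) (w dw : R -> X) (G : R -> R) :
    integral_path S B T w dw G ->
    0 <= primitive G (t_ n) /\ primitive G (t_ n) <= primitive G (t_ n.+1).
  move=> wP; have [_ iG _ _] := wP.
  exact: (mono _ iG (integral_path_primitive_ge0 siB wP)).
have [p1 p1'] := monoP _ _ _ siv _ _ _ P1.
have [p3 p3'] := monoP _ _ _ (semi_inner_H1_vec mO) _ _ _ P3.
have [p5 p5'] := monoP _ _ _ sig _ _ _ P5.
have [p2 p2'] := mono _ curv_p_integrable (fun t _ => sqr_ge0 _).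
have [p4 p4'] := mono _ curv_up_integrable (fun t _ => addr_ge0 (sqr_ge0 _) (sqr_ge0 _)).
apply: sqrt_consistency_le => //.
- exact: ltW.
- by nonneg.
- by nonneg.
- by rewrite divr_ge0.
- by rewrite invr_ge0 ltW.
- by rewrite divr_ge0// ltW.
- exact: mesh_size_ge0.
- exact: ltW.
- by rewrite mulr_ge0 ?(ltW t0)// sumr_ge0// => j _; exact: sqr_ge0.
- by rewrite ler_wpM2l ?(ltW t0)// big_nat_recr//= lerDl sqr_ge0.
Qed.

End error_equations.

(** * The error bound *)

Theorem theorem2 (R : realType) (d : nat) (Omega : set 'rV[R]_d)
    (T lambda mu alpha beta K eta eps C1 C2 omega c L : R) :
  d = 2%N \/ d = 3%N ->
  polyhedral_domain Omega ->
  0 < T ->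
  0 < lambda -> 0 < mu -> 0 < alpha -> 0 < beta -> 0 < K ->
  0 < eta -> 0 < eps -> 0 < C1 -> 0 < C2 -> 0 < c ->
  1 <= omega ->
  L = omega * (alpha ^+ 2 / (lambda + 2 * mu / d%:R)) ->
  exists2 C : R, 0 < C &
    forall (M : mesh R d),
      simplicial_partition M Omega ->
      weak_inf_sup M Omega lambda mu eta eps ->
      Z_norm_equivalence M Omega C1 C2 ->
    forall (f : R -> 'I_d -> 'rV[R]_d -> R) (g : R -> 'rV[R]_d -> R)
           (u du ddu : R -> h1vec R d) (p dp ddp : R -> h1fun R d),
      (forall t, t \in `[0, T] ->
         (forall i, L2fun Omega (f t i)) /\ L2fun Omega (g t)) ->
      biot_solution Omega lambda mu alpha beta K T f g u du p dp ->
      regular_solution Omega T u du ddu p dp ddp ->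
      approximation_assumption Omega lambda mu alpha K T M c u du p dp ->
    forall (N : nat) (uh : nat -> h1vec R d) (ph : nat -> h1fun R d),
      discrete_solution Omega lambda mu alpha beta K T M L N f g uh ph ->
    forall n : nat, (1 <= n < N)%N ->
      let h := mesh_size M in
      let tau := T / N%:R in
      let t_ := time_node T N in
      A_norm Omega lambda mu (u (t_ n) - uh n)
      + B_norm Omega K (p (t_ n) - ph n)
      + L2norm Omega (p (t_ n) - ph n).1
      <= C * (A_norm Omega lambda mu (u (t_ 0%N) - uh 0%N)
              + B_norm Omega K (p (t_ 0%N) - ph 0%N))
       + C * h * (H2semi_vec Omega (u (t_ 0%N)) + H2semi Omega (p (t_ 0%N))
                  + H2semi_vec Omega (u (t_ n)) + H2semi Omega (p (t_ n)))
       + C * tau *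
         (Num.sqrt (\int[lebesgue_measure]_(s in `[t_ 0%N, t_ n.+1])
                      L2norm Omega (ddp s).1 ^+ 2)
          + Num.sqrt (\int[lebesgue_measure]_(s in `[t_ 0%N, t_ n.+1])
                        H1norm_vec Omega (ddu s) ^+ 2))
       + C * h *
         (Num.sqrt (\int[lebesgue_measure]_(s in `[t_ 0%N, t_ n.+1])
                      H2semi Omega (dp s) ^+ 2)
          + Num.sqrt (\int[lebesgue_measure]_(s in `[t_ 0%N, t_ n.+1])
                        (H2semi_vec Omega (du s) ^+ 2
                         + H2semi Omega (dp s) ^+ 2))
          + Num.sqrt (tau * \sum_(0 <= j < n.+1)
                              H1semi Omega (dp (t_ j.+1)) ^+ 2)
          + tau * Num.sqrt (\int[lebesgue_measure]_(s in `[t_ 0%N, t_ n.+1])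
                              H1semi Omega (ddp s) ^+ 2)).
Proof.
move=> d23 poly T0 l0 m0 a0 be0 K0 eta0 eps0 C10 C20 c0 om1 LE.
have d0 : (0 < d)%N by case: d23 => ->.
have mO := polyhedral_measurable poly; have [b b0 Ob] := polyhedral_bounded poly.
set gam := lambda + 2 * mu / d%:R in LE *.
have g0 : 0 < gam by exact: gam_gt0.
have k0 : 0 <= alpha ^+ 2 / gam by rewrite divr_ge0 ?sqr_ge0// ltW.
have aL : alpha ^+ 2 / gam <= L by rewrite LE ler_peMl.
have L0 : 0 <= L by exact: le_trans aL.
(* bounds the size of every mesh of the domain *)
pose Dh : R := Num.sqrt (d%:R * (2 * (b + 1)) ^+ 2).
have Dh0 : 0 <= Dh by exact: sqrtr_ge0.
pose cc : R := Num.sqrt (consistency_const beta (2 * beta^-1 ^+ 2 + 16 * L ^+ 2)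
    (4 * alpha ^+ 2) (L / 2) C1^-1 c Dh d%:R (2 / gam)).
have cc0 : 0 <= cc by exact: sqrtr_ge0.
(* a1, a2: weak inf-sup bound of the initial pressure; a3: displacement in terms
   of the pressure; a4, a5: energy estimate in the gradient and the L^2 norm *)
pose a1 : R := Num.sqrt gam / (eta * alpha); pose a2 : R := eps / eta * Dh / Num.sqrt K.
pose a3 : R := Num.sqrt (alpha ^+ 2 / gam).
pose a4 : R := Num.sqrt (1 + L * beta); pose a5 : R := Num.sqrt (T * beta * (1 + L * beta)).
have [a10 a20 a30 a40 a50] : [/\ 0 <= a1, 0 <= a2, 0 <= a3, 0 <= a4 & 0 <= a5].
  split; rewrite ?sqrtr_ge0//.
    by rewrite divr_ge0 ?sqrtr_ge0// ltW// mulr_gt0.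
  by rewrite divr_ge0 ?sqrtr_ge0// mulr_ge0// divr_ge0 ?(ltW eps0) ?(ltW eta0).
pose A : R := 1 + c + c * Dh + a1 + a2 + a3 + a4 * (1 + cc) + a5 * (1 + cc).
have cD0 : 0 <= c * Dh by rewrite mulr_ge0// ltW.
have a4c : 0 <= a4 * (1 + cc) by rewrite mulr_ge0// addr_ge0.
have a5c : 0 <= a5 * (1 + cc) by rewrite mulr_ge0// addr_ge0.
have a4cc := mulr_ge0 a40 cc0; have a5cc := mulr_ge0 a50 cc0.
have A1 : 1 <= A by rewrite /A; lra.
have A0 : 0 < A by exact: lt_le_trans A1.
have [Ac AcD Aa1 Aa2 Aa3] :
    [/\ c <= A, c * Dh <= A, a1 <= A, a2 <= A & a3 <= A].
  by rewrite /A; split; lra.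
have [Aa4 Aa4c Aa5 Aa5c] : [/\ a4 <= A, a4 * cc <= A, a5 <= A & a5 * cc <= A].
  by rewrite /A; split; lra.
exists (7 * A ^+ 3); first by rewrite mulr_gt0// exprn_gt0.
move=> M part wis Zeq f g u du ddu p dp ddp _ biot reg.
move=> [ub [dru [pb [drp [ell C1ru C1rp bnd dbnd]]]]] N uh ph.
move=> [fh [gh [data uphh st0 st1 stj]]] [//|n] /andP[_ nN]; cbv zeta.
set h := mesh_size M; set tau := T / N%:R; set t_ := time_node T N.
have nN' : (n < N)%N by exact: ltnW.
have N0 : (0 < N)%N by exact: leq_ltn_trans nN.
have h0 : 0 <= h by exact: mesh_size_ge0.
have hD : h <= Dh by exact: mesh_size_le part.
have t0 : 0 < tau by exact: tau_gt0.
have tin j : (j <= N)%N -> t_ j \in `[0, T] by exact: time_node_in.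
pose thu := theta_u (T := T) (N := N) (ub := ub) (uh := uh).
pose thp := theta_p (T := T) (N := N) (pb := pb) (ph := ph).
have thin j : (j <= N)%N -> V_h M Omega (thu j) /\ Q_h M Omega (thp j).
  move=> jN.
  exact: (theta_in mO Ob T0 N0 ell uphh jN).
have sia := semi_inner_a mO (ltW l0) (ltW m0).
have sib := semi_inner_b mO (ltW K0).
have siv := semi_inner_val mO.
have Lu j : (j <= N)%N -> L2v Omega (u (t_ j) - ub (t_ j)) /\
    L2h Omega (p (t_ j) - pb (t_ j)).
  move=> /tin tj; have [/V_space_L2 ? _ _ _] := C1ru _ tj.
  by have [/H1_0_L2 ? _ _ _] := C1rp _ tj.
have eu j : u (t_ j) - uh j = (u (t_ j) - ub (t_ j)) + thu j.
  by rewrite /thu /theta_u addrA subrK.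
have ep j : p (t_ j) - ph j = (p (t_ j) - pb (t_ j)) + thp j.
  by rewrite /thp /theta_p addrA subrK.
have [Vt0 Qt0] := thin 0%N (leq0n N); have [Vtn Qtn] := thin n.+1 (ltnW nN).
have [Lu0 Lp0] := Lu 0%N (leq0n N); have [Lun Lpn] := Lu n.+1 (ltnW nN).
have [B1 B2 _] := bnd _ (tin _ (leq0n N)).
have [D1 D2 D3] := bnd _ (tin _ (ltnW nN)).
set x := A_norm Omega lambda mu (u (t_ 0%N) - uh 0%N).
set y := B_norm Omega K (p (t_ 0%N) - ph 0%N).
set U0 := H2semi_vec Omega (u (t_ 0%N)) in B1 *.
set P0 := H2semi Omega (p (t_ 0%N)) in B1 B2 *.
set Un := H2semi_vec Omega (u (t_ n.+1)) in D1 *.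
set Pn := H2semi Omega (p (t_ n.+1)) in D1 D2 D3 *.
have [U00 P00 Un0 Pn0] : [/\ 0 <= U0, 0 <= P0, 0 <= Un & 0 <= Pn].
  by split; exact: sqrtr_ge0.
have hU0 := mulr_ge0 h0 U00; have hP0 := mulr_ge0 h0 P00.
have hUn := mulr_ge0 h0 Un0; have hPn := mulr_ge0 h0 Pn0.
have eps_eta : 0 < eps / eta by rewrite divr_gt0.
have sK0 : 0 < Num.sqrt K by rewrite sqrtr_gt0.
have Lthp0 := Q_h_L2 Qt0; have Lthpn := Q_h_L2 Qtn.
have Lthu0 := V_h_L2 Vt0; have Lthun := V_h_L2 Vtn.
have [tu0' _] := si_split sia Lu0 Lthu0 (eu 0%N).
have [_ Eu'] := si_split sia Lun Lthun (eu n.+1).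
have [e0' _] := si_split sib Lp0 Lthp0 (ep 0%N).
have [_ Ep'] := si_split sib Lpn Lthpn (ep n.+1).
have [_ Eq'] := si_split siv Lpn Lthpn (ep n.+1).
have eq0 := theta_equilibrium mO T0 N0 l0 m0 biot ell data uphh st0 st1 stj (leq0n N).
have q0 := inf_sup_pressure_bound mO l0 m0 a0 eta0 wis Vt0 Qt0 eq0.
have Bk : B_norm Omega K (thp 0%N) = Num.sqrt K * H1semi Omega (thp 0%N).
  by apply: B_normE => //; exact: ltW.
have [en qn] := discrete_error_le mO Ob d0 T0 N0 l0 m0 be0 K0 C10 C20 aL Zeq biot
  reg ell C1ru C1rp dbnd data uphh st0 st1 stj nN'.
have un := theta_u_norm_le mO Ob d0 T0 N0 l0 m0 biot ell data uphh st0 st1 stj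
  (ltnW nN).
have prim G : primitive G (t_ n.+2) =
    \int[lebesgue_measure]_(s in `[t_ 0%N, t_ n.+2]) G s.
  by rewrite /primitive /t_ time_node0.
have W0 := sqrt_consistency_bound (c := c) mO T0 N0 l0 m0 be0 C10 aL biot reg nN hD.
rewrite !prim /rate_p /rate_u /rate_grad /curv_p /curv_up -/tau -/h -/cc in W0.
exact: (error_bound_arith (ltW c0) h0 hD (ltW eps_eta) sK0 a10 a30 a40 a50 cc0
  A1 Ac AcD Aa1 Aa2 Aa3 Aa4 Aa4c Aa5 Aa5c (sqrtr_ge0 _) (sqrtr_ge0 _)
  U00 P00 Un0 Pn0 (sqrtr_ge0 _) (sqrtr_ge0 _) (ltW t0)
  (addr_ge0 (sqrtr_ge0 _) (sqrtr_ge0 _))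
  (addr_ge0 (addr_ge0 (addr_ge0 (sqrtr_ge0 _) (sqrtr_ge0 _)) (sqrtr_ge0 _))
    (mulr_ge0 (ltW t0) (sqrtr_ge0 _)))
  tu0' B1 e0' B2 q0 Bk en qn un W0 Eu' D1 Ep' D2 Eq' D3
  (sqrtr_ge0 _)).
Qed.
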